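(* Let $K$ be a compact metric space and let $(f_n)$ be a normalized Schauder basic sequence in $C(K)$ such that the series $\sum_n|f_n(t)|$ converges for all $t\in K$. Then there exist an ordinal $\xi<\omega_1$ and a block basis of $\xi$-averages of $(f_n)$ which is equivalent to the unit vector basis of $c_0$.
   Context: $[M]$ denotes the set of infinite subsets of $M\subset\mathbb{N}$. $C(K)$ is the Banach space of scalar valued continuous functions on $K$ with the sup norm. Associated sequences: to every countable ordinal $\alpha\ge 1$ a sequence of successor ordinals $(\alpha_n+1)_{n}$ is associated once and for all: if $\alpha$ is a successor, $\alpha_n=\alpha-1$ for all $n$; if $\alpha$ is a limit ordinal, $(\alpha_n+1)$ is a (fixed) strictly increasing sequence of ordinals tending to $\alpha$. Blocks: for a normalized basic sequence $(e_n)$, a block is a nonzero finite linear combination $u=\sum a_ne_n$, with support $\mathrm{supp}\,u=\{n:a_n\neq0\}$; $u<v$ means $\max\mathrm{supp}\,u<\min\mathrm{supp}\,v$; a block basis is an infinite sequence of blocks $u_1<u_2<\cdots$. Transfinite averages: for a normalized basic sequence $(e_n)$, for $\alpha<\omega_1$ and $M\in[\mathbb{N}]$, normalized blocks $\alpha_1^M<\alpha_2^M<\cdots$ with $\bigcup_n\mathrm{supp}\,\alpha_n^M=M$ are defined by transfinite recursion on $\alpha$. If $\alpha=0$ and $M=\{m_1<m_2<\cdots\}$, then $\alpha_n^M=e_{m_n}$. If $\alpha=\beta+1$, then $\alpha_1^M=\big(\sum_{i=1}^{k}\beta_i^M\big)/\big\|\sum_{i=1}^{k}\beta_i^M\big\|$,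 where $k$ is the unique integer such that $\{\min\mathrm{supp}\,\beta_i^M: i\le k\}$ is a maximal (under inclusion) member of $S_1=\{F\subset\mathbb{N}: F \text{ finite}, |F|\le\min F\}\cup\{\emptyset\}$ (i.e. $k=\min M$). If $\alpha$ is a limit ordinal with associated sequence $(\alpha_n+1)$ and $m=\min M$, then $\alpha_1^M=e_1$ if $m=1$, and $\alpha_1^M=u/\|u\|$ with $u=\frac1m e_m+[\alpha_m]_1^{M\setminus\{m\}}$ if $m>1$. In the successor and limit cases, $\alpha_{n+1}^M=\alpha_1^{M_{n+1}}$, where $M_{n+1}=\{m\in M: m>\max\mathrm{supp}\,\alpha_n^M\}$. An $\alpha$-average of $(e_n)$ is any vector $\alpha_1^L$, $L\in[\mathbb{N}]$. A block basis of $\alpha$-averages is a block basis $u_1<u_2<\cdots$ all of whose terms are $\alpha$-averages. *)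

(* Defs.v *)
From HB Require Import structures.
From mathcomp Require Import all_boot all_order all_algebra complex.
From mathcomp Require Import all_classical all_reals all_analysis.

Set Implicit Arguments.
Unset Strict Implicit.
Unset Printing Implicit Defensive.

Import Order.TTheory GRing.Theory Num.Theory.
Import numFieldNormedType.Exports.

Local Open Scope classical_set_scope.
Local Open Scope ring_scope.

(* Indexing convention: the positive integers 1, 2, ... that label a sequence
   are represented by the elements 0, 1, ... of nat, so that n : nat stands for
   the label n.+1.  The value of a label matters only in avg_succ, avg_lim1 and
   avg_lim below. *)

(** Ordinals *)

(* omega_1: an uncountable well-order with countable proper initial segments.
   It is unique up to isomorphism, and exists by omega1_exists below. *)
Record omega1 := Omega1 {
  ord :> Type;
  olt : ord -> ord -> Prop;
  olt_trans : forall a b c, olt a b -> olt b c -> olt a c;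
  olt_total : forall a b, olt a b \/ a = b \/ olt b a;
  olt_wf : well_founded olt;
  olt_countable : forall a, countable [set b | olt b a];
  ord_uncountable : ~ countable [set: ord] }.

Section Ordinals.
Variable W : omega1.
Implicit Types a b c : W.

Definition is_zero a := forall b, ~ olt b a.

(* a = b + 1 *)
Definition is_succ b a := olt b a /\ forall c, olt c a -> ~ olt b c.

Definition is_limit a := ~ is_zero a /\ forall b, ~ is_succ b a.

(* assoc a n is alpha_n; in the limit case s n is the successor ordinal
   alpha_n + 1.  The choice at a = 0 is irrelevant. *)
Definition associated_sequences (assoc : W -> nat -> W) :=
  (forall a b, is_succ b a -> forall n, assoc a n = b) /\
  (forall a, is_limit a -> exists s : nat -> W,
    [/\ forall n, is_succ (assoc a n) (s n),
        forall m n, (m < n)%N -> olt (s m) (s n),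
        forall n, olt (s n) a
      & forall b, olt b a -> exists n, olt b (s n)]).

End Ordinals.

(** Scalars *)

Variant scalar_kind := RealScalars | ComplexScalars.

Definition scalars (R : realType) (k : scalar_kind) : numFieldType :=
  match k with RealScalars => R | ComplexScalars => R[i] end.

Definition modulus (R : realType) (k : scalar_kind) : scalars R k -> R :=
  match k with
  | RealScalars => fun x : R => `|x|
  | ComplexScalars => fun z : R[i] => complex.Re `|z|
  end.

Definition of_real (R : realType) (k : scalar_kind) : R -> scalars R k :=
  match k with
  | RealScalars => fun x : R => x
  | ComplexScalars => fun x : R => x%:C%C
  end.

Arguments of_real {R} k x.

Section Sequences.
Variables (R : realType) (k : scalar_kind).
Local Notation F := (scalars R k).

(* Meaningful for bounded functions: sup of an unbounded set is 0. *)
Definition supnorm (T : Type) (x : T -> F) : R :=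
  sup [set modulus (x t) | t in [set: T]].

Definition supp (c : nat -> F) : set nat := [set n | c n != 0].

(* sum_n c n * x n, for c of finite support *)
Definition lincomb (T : Type) (x : nat -> T -> F) (c : nat -> F) : T -> F :=
  fun t => \sum_(n \in supp c) c n * x n t.

Definition unit_vector (n : nat) : nat -> F := fun j => (j == n)%:R.

Section SchauderBasic.
Variable K : topologicalType.
Implicit Types (f : nat -> K -> F) (x : K -> F).

Definition closed_span f x :=
  continuous x /\
  forall e : R, 0 < e -> exists c : nat -> F,
    finite_set (supp c) /\ supnorm (x \- lincomb f c) < e.

Definition expansion f x (c : nat -> F) :=
  supnorm (fun t => x t - \sum_(i < N) c i * f i t) @[N --> \oo] --> (0 : R).

(* (f n) is a Schauder basis of its closed linear span in C(K). *)
Definition schauder_basic f :=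
  forall x, closed_span f x -> exists! c, expansion f x c.

End SchauderBasic.

(* Equivalence of sequences of bounded functions, for the sup norms. *)
Definition equivalent_sequences (S T : Type)
    (x : nat -> S -> F) (y : nat -> T -> F) :=
  exists C D : R, [/\ 0 < C, 0 < D &
    forall c : nat -> F, finite_set (supp c) ->
      C * supnorm (lincomb y c) <= supnorm (lincomb x c) /\
      supnorm (lincomb x c) <= D * supnorm (lincomb y c)].

(* unit_vector, viewed in the space c_0 of null sequences with the sup norm *)
Definition equivalent_c0_basis (S : Type) (x : nat -> S -> F) :=
  equivalent_sequences x unit_vector.

(** Blocks of a sequence e are represented by their coefficients; these are
    determined by the vector when e is basic. *)
Section Blocks.
Variables (T : Type) (e : nat -> T -> F).
Implicit Types u v : nat -> F.

Definition is_block u := finite_set (supp u) /\ supp u !=set0.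

Definition block_lt u v := forall i j, supp u i -> supp v j -> (i < j)%N.

Definition block_basis (u : nat -> nat -> F) :=
  (forall n, is_block (u n)) /\ (forall n, block_lt (u n) (u n.+1)).

Definition normalize u : nat -> F :=
  fun j => u j / of_real k (supnorm (lincomb e u)).

Definition is_min (M : set nat) m := M m /\ forall j, M j -> (m <= j)%N.

Variables (W : omega1) (assoc : W -> nat -> W).

(* avg a M n u is the graph of the transfinite recursion that defines the
   averages, one constructor per clause: for infinite M it says that u is the
   (n+1)-st block a_{n+1}^M.  See avg_exists and avg_uniq below.  In avg_succ
   the label of min M = m is m.+1, which is the number of summands, i.e. the k
   such that k minima of supports form a maximal Schreier set; in avg_lim it is
   the denominator of the coefficient of e_m. *)
Inductive avg : W -> set nat -> nat -> (nat -> F) -> Prop :=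
| avg_zero a M (g : nat -> nat) n :
    is_zero a ->
    (forall i j, (i < j)%N -> (g i < g j)%N) -> range g = M ->
    avg a M n (unit_vector (g n))
| avg_succ a b M m (v : nat -> nat -> F) :
    is_succ b a -> is_min M m ->
    (forall i, (i < m.+1)%N -> avg b M i (v i)) ->
    avg a M 0 (normalize (fun j => \sum_(i < m.+1) v i j))
| avg_lim1 a M :
    is_limit a -> is_min M 0 ->
    avg a M 0 (unit_vector 0)
| avg_lim a M m (v : nat -> F) :
    is_limit a -> is_min M m -> (0 < m)%N ->
    avg (assoc a m) (M `\ m) 0 v ->
    avg a M 0 (normalize (fun j => m.+1%:R^-1 * unit_vector m j + v j))
| avg_next a M n (u v : nat -> F) :
    ~ is_zero a ->
    avg a M n u ->
    avg a [set m | M m /\ forall i, supp u i -> (i < m)%N] 0 v ->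
    avg a M n.+1 v.

Definition is_average (a : W) u :=
  exists2 L : set nat, infinite_set L & avg a L 0 u.

End Blocks.

End Sequences.

(** The notions above are not vacuous, and the averages are well defined. *)

Lemma set_nat_uncountable : ~ countable [set: set nat].
Proof.
move=> /countable_injP[f finj].
pose D : set nat := [set n | exists2 A, f A = n & ~ A n].
have nD : ~ D (f D).
  move=> DfD; case: (DfD) => A fAD nA.
  have AD : A = D by apply: finj; rewrite ?inE.
  by apply: nA; rewrite AD.
by apply: (nD); exists D.
Qed.

Lemma omega1_exists : inhabited omega1.
Proof.
have [r r_wo] := @wochoice.well_ordering_principle (set nat).
pose lt a b := ~ r b a.
have min3 (A : set (set nat)) : A !=set0 ->
    exists2 z, A z & forall x, A x -> r z x.
  case=> x Ax; have [|z [[Az zmin] _]] := r_wo (mem A).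
    by exists x; rewrite inE.
  by exists z; [rewrite inE in Az|move=> y Ay; apply: zmin; rewrite inE].
have r_total x y : r x y \/ r y x.
  have [|z [] -> zmin] := min3 [set x; y]; first by exists x; left.
    by left; apply: zmin; right.
  by right; apply: zmin; left.
have r_anti x y : r x y -> r y x -> x = y.
  have /wochoice.wo_chain_antisymmetric anti : wochoice.wo_chain r predT.
    by move=> A _; apply: r_wo.
  by move=> xy yx; apply: anti => //; rewrite xy yx.
have ltW x y : lt x y -> r x y by move=> xy; case: (r_total x y).
have lt_trans x y z : lt x y -> lt y z -> lt x z.
  have [|t [[]->|->] tmin] := min3 [set x; y; z]; first by exists x; left; left.
  - move=> xy yz zx; apply: xy; have {}zx : z = x.
      by apply: r_anti => //; apply: tmin; right.
    by rewrite -zx; exact: ltW.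
  - by move=> xy; case: xy; apply: tmin; left; left.
  - by move=> _; case; apply: tmin; left; right.
have lt_total x y : lt x y \/ x = y \/ lt y x.
  have [yx|] := pselect (r y x); last by left.
  have [xy|] := pselect (r x y); last by right; right.
  by right; left; exact: r_anti.
have lt_wf (A : set (set nat)) :
    (forall x, (forall y, lt y x -> A y) -> A x) -> forall x, A x.
  move=> Aind x; apply: contrapT => nAx.
  have [|z nAz zmin] := min3 (~` A); first by exists x.
  by apply/nAz/Aind => y yz; apply: contrapT => nAy; apply/yz/zmin.
pose P : set (set nat) := [set a | countable [set b | lt b a]].
have Pdown a b : lt a b -> P b -> P a.
  move=> ab; apply: sub_countable; apply: subset_card_le => c /= ca.
  exact: lt_trans ab.
have Punc : ~ countable P.
  move=> Pc; have [PT|] := pselect (P = setT).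
    by apply: set_nat_uncountable; rewrite -PT.
  move=> nPT; have [|z nPz zmin] := min3 (~` P).
    by apply/set0P/eqP => P0; apply: nPT; rewrite -[P]setCK P0 setC0.
  apply: nPz; apply: sub_countable Pc; apply: subset_card_le => b /= bz.
  by apply: contrapT => nPb; apply/bz/zmin.
pose S := {a : set nat | P a}.
pose ltS (a b : S) := lt (sval a) (sval b).
have sval_inj' (a b : S) : sval a = sval b -> a = b.
  by case: a b => [a Pa] [b Pb] /= ab; exact: eq_exist.
constructor; apply: (@Omega1 S ltS).
- by move=> a b c; exact: lt_trans.
- move=> a b; case: (lt_total (sval a) (sval b)) => [|[/sval_inj'|]]; tauto.
- move=> [a Pa]; move: a Pa; apply: lt_wf => a IH Pa.
  by constructor => -[b Pb] ba; apply: IH.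
- move=> [a Pa]; move/countable_injP: (Pa) => -[g ginj].
  apply/countable_injP; exists (g \o sval) => x y.
  by rewrite !inE => xa ya gxy; apply/sval_inj'/ginj; rewrite ?inE.
- move=> /countable_injP[g ginj]; apply: Punc; apply/countable_injP.
  exists (fun a => if pselect (P a) is left Pa then g (exist _ a Pa) else 0%N).
  move=> a b; rewrite !inE => Pa Pb.
  case: pselect => // Pa'; case: pselect => // Pb' gE.
  exact: (congr1 sval (ginj _ _ (mem_set I) (mem_set I) gE)).
Qed.

Lemma zero_succ_or_limit (W : omega1) (a : W) :
  is_zero a \/ (exists b, is_succ b a) \/ is_limit a.
Proof.
have [?|nz] := pselect (is_zero a); first by left.
have [?|ns] := pselect (exists b, is_succ b a); first by right; left.
by right; right; split=> // b sb; apply: ns; exists b.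
Qed.

Lemma olt_irr (W : omega1) (a : W) : ~ olt a a.
Proof. by move: a; apply: (well_founded_ind (@olt_wf W)) => x IH xx; exact: (IH _ xx xx). Qed.

Lemma wf_min (W : omega1) (A : set W) : A !=set0 ->
  exists2 z, A z & forall x, A x -> ~ olt x z.
Proof.
case=> x; move: x; apply: (well_founded_ind (@olt_wf W)) => x IH Ax.
have [[y [yx Ay]]|n] := pselect (exists y, olt y x /\ A y); first exact: IH Ay.
by exists x => // y Ay yx; apply: n; exists y.
Qed.

Lemma limit_succ (W : omega1) (a b : W) : is_limit a -> olt b a ->
  exists2 s, is_succ b s & olt s a.
Proof.
move=> [_ la] ba; have [|s bs smin] := @wf_min W [set c | olt b c]; first by exists a.
exists s; first by split=> // c cs bc; exact: smin bc cs.
have [//|[sa|as_]] := olt_total s a; last by case: (smin a ba).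
case: (la b); split=> // c ca bc; apply: (smin c) => //; by rewrite sa.
Qed.

Lemma associated_sequences_exist (W : omega1) :
  exists assoc : W -> nat -> W, associated_sequences assoc.
Proof.
suff H (a : W) : exists s : nat -> W,
    (forall b, is_succ b a -> forall n, s n = b) /\ (is_limit a -> exists t : nat -> W,
    [/\ forall n, is_succ (s n) (t n),
        forall m n, (m < n)%N -> olt (t m) (t n),
        forall n, olt (t n) a
      & forall b, olt b a -> exists n, olt b (t n)]).
  have [s sP] := boolp.choice H; exists s; split=> [a|a]; by case: (sP a).
have [z|[[b sb]|la]] := zero_succ_or_limit a.
- exists (fun=> a); split=> [b [ba _]|[/(_ z)//]]; by case: (z b).
- exists (fun=> b); split=> [c [ca cmax] _|[_ /(_ b)//]].
  case: sb => ba bmax.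
  by have [bc|[//|cb]] := olt_total b c; [case: (bmax c)|case: (cmax b)].
have /countable_injP[g ginj] := olt_countable a.
have [b0 b0a] : exists b, olt b a.
  by apply: contrapT => n; apply: la.1 => b ba; apply: n; exists b.
pose S := {b : W | olt b a}.
have step (n : nat) (b : S) : exists c : S, olt (sval b) (sval c) /\ forall d, olt d a -> g d = n -> ~ olt (sval c) d.
  case: b => b ba /=; have [s sb sa] := limit_succ la ba.
  have [[d [da gd]]|nd] := pselect (exists d, olt d a /\ g d = n); last first.
    exists (exist _ s sa); split=> /=; first exact: sb.1.
    by move=> d da gd; case: nd; exists d.
  have uniq e : olt e a -> g e = n -> e = d.
    by move=> ea ge; apply: ginj; rewrite ?inE// ge gd.
  have [sd|nsd] := pselect (olt s d).
    exists (exist _ d da); split=> /=; first exact: olt_trans sb.1 sd.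
    by move=> e ea /(uniq e ea) ->; exact: olt_irr.
  exists (exist _ s sa); split=> /=; first exact: sb.1.
  by move=> e ea /(uniq e ea) ->.
have [nx nxP] : exists nx : nat -> S -> S, forall n b, olt (sval b) (sval (nx n b)) /\ forall d, olt d a -> g d = n -> ~ olt (sval (nx n b)) d.
  exists (fun n b => projT1 (cid (step n b))) => n b; exact: (projT2 (cid (step n b))).
pose q := fix q n := if n is m.+1 then nx m (q m) else exist _ b0 b0a : S.
have suP (x : S) : exists y : S, is_succ (sval x) (sval y).
  case: x => x xa; have [y yx ya] := limit_succ la xa; by exists (exist _ y ya).
have [su su_] := boolp.choice suP.
have qlt m n : (m < n)%N -> olt (sval (q m)) (sval (q n)).
  elim: n => // n IH; rewrite ltnS leq_eqVlt => /orP[/eqP->|/IH h]; first exact: (nxP _ _).1.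
  exact: olt_trans h (nxP _ _).1.
exists (sval \o q); split=> [b sb|_]; first by case: (la.2 b).
exists (fun n => sval (su (q n))); split=> /=.
- by move=> n; exact: su_.
- move=> m n mn; have := qlt _ _ mn; have [h1 h2] := su_ (q m); have [h3 h4] := su_ (q n).
  move=> h; have [//|[e|l]] := olt_total (sval (su (q m))) (sval (su (q n))).
    by case: (h2 (sval (q n))) => //; rewrite e.
  by case: (h2 (sval (q n))) => //; exact: olt_trans l.
- by move=> n; exact: (svalP (su (q n))).
- move=> b ba; exists (g b).+1; have := (nxP (g b) (q (g b))).2 b ba erefl.
  have [h1 h2] := su_ (q (g b).+1).
  move=> nl; case: (olt_total (sval (q (g b).+1)) b) => [l|[E|l]].
  + by case: (nl l).
  + by move: h1; rewrite E.
  + exact: olt_trans l h1.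
Qed.

Section AverageFacts.
Variables (R : realType) (k : scalar_kind).
Variables (T : Type) (e : nat -> T -> scalars R k).
Variables (W : omega1) (assoc : W -> nat -> W).

Lemma is_min_uniq M m n : is_min M m -> is_min M n -> m = n.
Proof. by move=> [Mm mm] [Mn nm]; apply/eqP; rewrite eqn_leq mm// nm. Qed.

Lemma enum_uniq (g h : nat -> nat) :
  (forall i j, (i < j)%N -> (g i < g j)%N) ->
  (forall i j, (i < j)%N -> (h i < h j)%N) -> range g = range h -> g =1 h.
Proof.
move=> gm hm gh n; elim/ltn_ind: n => n IH.
wlog lt_gh : g h gm hm gh IH / (g n < h n)%N.
  move=> H; case: (ltngtP (g n) (h n)) => // l; first exact: H l.
  by apply/esym/(H h g) => // m /IH.
have : range h (g n) by rewrite -gh; exists n.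
case=> m _ hmn; case: (ltngtP m n) => mn.
- have := IH _ mn; rewrite hmn => /= E; have := gm _ _ mn; by rewrite E ltnn.
- by have := hm _ _ mn; rewrite hmn => /(ltn_trans lt_gh); rewrite ltnn.
- by rewrite -hmn mn.
Qed.

Lemma succ_uniq (a b c : W) : is_succ b a -> is_succ c a -> b = c.
Proof.
case=> ba bm [ca cm]; have [bc|[//|cb]] := olt_total b c; [by case: (bm c)|by case: (cm b)].
Qed.

Lemma avg_uniq a M n u v : avg e assoc a M n u -> avg e assoc a M n v -> u = v.
Proof.
move=> h; elim: h v => {a M n u}.
- move=> a M g n za gm gM v hv.
  inversion hv; subst; try by [case: (za b); case: H|case: H => /(_ za)|case: (H za)].
  by rewrite (enum_uniq H0 gm H1).
- move=> a b M m w sb minM IH1 IH v hv; inversion hv; subst.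
  + by case: (H b); case: sb.
  + have E := succ_uniq sb H; subst b0; have E := is_min_uniq minM H0; subst m0.
    congr normalize; apply/funext => j; apply: eq_bigr => i _.
    by rewrite (IH i _ (v0 i))// ; exact: H1.
  + by case: H => _ /(_ b).
  + by case: H => _ /(_ b).
- move=> a M la min0 v hv; inversion hv; subst => //.
  + by case: la => /(_ H).
  + by case: la => _ /(_ b).
  + by have := is_min_uniq min0 H0 => E; subst m.
- move=> a M m w la minm m0 h IH v hv; inversion hv; subst.
  + by case: la => /(_ H).
  + by case: la => _ /(_ b).
  + by have := is_min_uniq minm H0 => E; subst m.
  + by have E := is_min_uniq minm H0; subst m1; rewrite (IH _ H2).
- move=> a M n u v nz h1 IH1 h2 IH2 w hv; inversion hv; subst => //.
  by apply: IH2; rewrite (IH1 _ H1).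
Qed.

Lemma min_ex (M : set nat) : M !=set0 -> exists m, is_min M m.
Proof.
case=> x; elim/ltn_ind: x => x IH Mx.
have [[y [yx My]]|n] := pselect (exists y, (y < x)%N /\ M y); first exact: IH My.
exists x; split=> // j Mj; rewrite leqNgt; apply/negP => jx; apply: n; by exists j.
Qed.

Lemma finite_nat_bound (A : set nat) : finite_set A ->
  exists N, forall i, A i -> (i < N)%N.
Proof.
move=> /finite_fsetP[X ->]; exists (\max_(i <- finmap.enum_fset X) i).+1 => i /= iX.
by rewrite ltnS; exact: leq_bigmax_seq.
Qed.

Lemma infinite_nat_enum (M : set nat) : infinite_set M ->
  exists g : nat -> nat, (forall i j, (i < j)%N -> (g i < g j)%N) /\ range g = M.
Proof.
move=> Mi.
have nxt n : exists m, is_min [set m | M m /\ (n <= m)%N] m.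
  apply: min_ex; apply: contrapT => /set0P/negP/negPn/eqP E; apply: Mi.
  apply: sub_finite_set (finite_II n) => x Mx /=.
  rewrite ltnNge; apply/negP => nx.
  by have : set0 x by rewrite -E.
have [s sP] := boolp.choice nxt.
pose g := fix g n := if n is m.+1 then s (g m).+1 else s 0%N.
have gM n : M (g n) by case: n => [|n]; [case: (sP 0%N)|case: (sP (g n).+1)] => -[].
have gS n : (g n < g n.+1)%N by case: (sP (g n).+1) => -[].
have gm i j : (i < j)%N -> (g i < g j)%N.
  elim: j => // j IH; rewrite ltnS leq_eqVlt => /orP[/eqP->//|/IH h].
  exact: ltn_trans h (gS j).
exists g; split=> //; apply/seteqP; split=> [_ [n _ <-]//|x Mx].
apply: contrapT => nx.
have lt_gx n : (g n < x)%N.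
  elim: n => [|n IH]; rewrite ltn_neqAle; apply/andP; split.
  - by apply/eqP => E; apply: nx; exists 0%N.
  - by case: (sP 0%N) => _; apply.
  - by apply/eqP => E; apply: nx; exists n.+1.
  - by case: (sP (g n).+1) => _; apply.
have le_g n : (n <= g n)%N by elim: n => // n IH; exact: leq_ltn_trans IH (gS n).
by have := leq_ltn_trans (le_g x) (lt_gx x); rewrite ltnn.
Qed.

Lemma supp_unit n : supp (unit_vector R k n) `<=` [set n].
Proof. by move=> j; rewrite /supp/unit_vector/=; case: (j =P n) => //= _; rewrite mulr0n eqxx. Qed.

Lemma avg_exists : associated_sequences assoc ->
  forall a n M, infinite_set M -> exists u, avg e assoc a M n u /\ finite_set (supp u).
Proof.
move=> [as1 as2] a; move: a; apply: (well_founded_ind (@olt_wf W)) => a IH.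
have [z n M Mi|nz] := pselect (is_zero a).
  have [g [gm gr]] := infinite_nat_enum Mi.
  exists (unit_vector R k (g n)); split; first exact: avg_zero.
  exact: sub_finite_set (@supp_unit _) (finite_set1 _).
have H0 M : infinite_set M -> exists u, avg e assoc a M 0 u /\ finite_set (supp u).
  move=> Mi; have [m mM] := min_ex (infinite_setN0 Mi).
  have [//|[[b sb]|la]] := zero_succ_or_limit a.
    have [v vP] := boolp.choice (fun i => IH b sb.1 i M Mi).
    eexists; split; first by apply: (avg_succ sb mM (v := v)) => i _; case: (vP i).
    apply: (@sub_finite_set _ _ (\bigcup_(i < m.+1) supp (v i))).
      move=> j; rewrite /supp/= /normalize => H; apply: contrapT => n.
      move: H; rewrite big1 ?mul0r ?eqxx// => i _; apply/eqP; apply: contrapT => /negP h.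
      by apply: n; exists i => /=.
    by apply: bigcup_finite => // i _; case: (vP i).
  case: m mM => [|m] mM.
    exists (unit_vector R k 0); split; first exact: avg_lim1.
    exact: sub_finite_set (@supp_unit _) (finite_set1 _).
  have [s [h1 _ h2 _]] := as2 a la.
  have la' : olt (assoc a m.+1) a by apply: olt_trans (h1 _).1 (h2 _).
  have [|v [vP vf]] := IH _ la' 0%N (M `\ m.+1).
    by apply: infinite_setD => //.
  eexists; split; first exact: (avg_lim la mM _ vP).
  apply: (@sub_finite_set _ _ ([set m.+1] `|` supp v)); last by rewrite finite_setU.
  move=> j H; have [->|jm] := eqVneq j m.+1; first by left.
  right; apply: contraNN H => /eqP vj.
  by rewrite /normalize/unit_vector (negbTE jm) vj mulr0 add0r mul0r.
elim=> // n IHn M Mi; have [u [uP uf]] := IHn M Mi.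
have [|v [vP vf]] := H0 [set m | M m /\ forall i, supp u i -> (i < m)%N].
  move=> H; apply: Mi.
  have [N NP] := finite_nat_bound uf.
  apply: (@sub_finite_set _ _ (`I_N `|` [set m | M m /\ forall i, supp u i -> (i < m)%N])).
    move=> x Mx; case: (ltnP x N) => xN; [by left|right].
    split=> // i /NP iN; exact: leq_trans xN.
  by rewrite finite_setU.
by exists v; split=> //; apply: avg_next uP vP.
Qed.
End AverageFacts.

(* Main.v *)
Require Import Defs.
From HB Require Import structures.
From mathcomp Require Import all_boot all_order all_algebra complex.
From mathcomp Require Import all_classical all_reals all_analysis.
From mathcomp Require Import lra zify.
Import Order.TTheory GRing.Theory Num.Theory.
Import numFieldNormedType.Exports.
Local Open Scope classical_set_scope.
Local Open Scope ring_scope.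
Set Implicit Arguments.
Unset Strict Implicit.
Unset Printing Implicit Defensive.

(** A sequence of blocks whose moduli have uniformly bounded partial sums on K is
    dominated by the basis of c_0, so one looks for a block basis of averages of
    some order with this property.  By Mazur's selection, the projections are
    bounded on the span of a subsequence of f, to which all supports are confined.

    Order the block sequences of averages by "is built from".  Countable chains
    have upper bounds, so some sequence w is stable: over each set of a countable
    base of K, sums of moduli that can be made bounded by passing to averages built
    from w are bounded for w already.  If the set of points near which they are
    unbounded is not empty, then by Baire's theorem sum |f_n| is bounded on a
    nonempty relatively open piece of it.  Averages built from w whose coefficients
    relative to w tend to 0 converge to 0 uniformly on that piece and on the compact
    sets avoiding it, so a gliding subsequence has bounded sums near some point of
    the piece, contradicting stability.

    Such averages exist unless a subsequence of w is already dominated by c_0.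
    Otherwise every average built from w has a coefficient above some delta.  The
    finite sets of indices on which the sum of |w_i| is at most C form a
    well-founded tree; by recursion along it, one finds an order and, along
    ultrafilter-branching choices of the indices (which keep the coefficients of
    one average nearly equal), averages whose index sets all leave the tree.  A
    smallest index set with a large sum of positive parts at a point t, completed
    by indices that are negligible at t, gives an average larger than 1 at t. *)

(** * Scalars *)

(** The obstacle is normalization: the norms of the sums formed at successor and limit orders are
    unknown, so the coefficients of an average cannot be computed. Two estimates stand in for the
    computation. The part of an average lying over one term of [w] is a segment of it, so its
    coefficient is at most 4; a vector inserted at a limit order has a coefficient at most 4/(n+1),
    and [N0] is so sparse that these bounds have a finite sum. The order at which coefficients
    become small cannot be named in advance, hence the argument by contradiction: if some
    coefficient always exceeds delta, the common size of nearly equal coefficients lies between two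
    positive constants. Finitely many cells cover this range, and the ultrafilter selects one cell
    for almost all continuations. The final contradiction compares the contribution of a
    sign-constant set of indices, at least delta/2 times a large sum, with errors bounded
    independently of that sum. Different degrees of smallness may require different orders.
    Countably many orders have an upper bound below omega_1, and building once more from averages
    that are already small reaches one common order. *)

Section Scalars.
Variables (R : realType) (k : scalar_kind).
Local Notation F := (scalars R k).
Implicit Types (x y : F) (r : R).

Lemma modulus_norm x : `|x| = of_real k (modulus x).
Proof. by move: x; case: k => //= x; rewrite normc_def. Qed.

Lemma of_real_is_zmod_morphism : zmod_morphism (of_real k : R -> F).
Proof. by case: k => //= r s; rewrite rmorphB. Qed.
HB.instance Definition _ :=
  GRing.isZmodMorphism.Build R F (of_real k) of_real_is_zmod_morphism.

Lemma of_real_is_monoid_morphism : monoid_morphism (of_real k : R -> F).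
Proof. by case: k => //=; split=> // r s; rewrite rmorphM. Qed.
HB.instance Definition _ :=
  GRing.isMonoidMorphism.Build R F (of_real k) of_real_is_monoid_morphism.

Lemma of_real_le r s : (of_real k r <= of_real k s) = (r <= s).
Proof. by case: k => //=; rewrite lecR. Qed.

Lemma of_real_lt r s : (of_real k r < of_real k s) = (r < s).
Proof. by case: k => //=; rewrite ltcR. Qed.

Lemma of_real_inj : injective (of_real k : R -> F).
Proof. exact: fmorph_inj. Qed.

Lemma modulus_ge0 x : 0 <= modulus x.
Proof. by rewrite -of_real_le -modulus_norm rmorph0. Qed.

Lemma modulus0 : modulus (0 : F) = 0.
Proof. by apply: of_real_inj; rewrite -modulus_norm normr0 rmorph0. Qed.

Lemma modulus_eq0 x : modulus x = 0 -> x = 0.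
Proof. by move=> h; apply/eqP; rewrite -normr_eq0 modulus_norm h rmorph0. Qed.

Lemma modulusD x y : modulus (x + y) <= modulus x + modulus y.
Proof.
by rewrite -of_real_le rmorphD/= -!modulus_norm ler_normD.
Qed.

Lemma modulusM x y : modulus (x * y) = modulus x * modulus y.
Proof. by apply: of_real_inj; rewrite rmorphM/= -!modulus_norm normrM. Qed.

Lemma modulusN x : modulus (- x) = modulus x.
Proof. by apply: of_real_inj; rewrite -!modulus_norm normrN. Qed.

Lemma modulusB x y : modulus (x - y) = modulus (y - x).
Proof. by rewrite -modulusN opprB. Qed.

Lemma modulus_real r : modulus (of_real k r) = `|r|.
Proof.
by move: r; case: k => // r; rewrite /modulus /of_real normc_def/=
  expr0n/= addr0 sqrtr_sqr.
Qed.

Lemma modulus_nat n : modulus (n%:R : F) = n%:R.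
Proof. by rewrite -(rmorph_nat (of_real k)) modulus_real normr_nat. Qed.

Lemma modulus_sum (I : Type) (s : seq I) (P : pred I) (E : I -> F) :
  modulus (\sum_(i <- s | P i) E i) <= \sum_(i <- s | P i) modulus (E i).
Proof.
apply: (big_ind2 (fun a (b : R) => modulus a <= b)) => //; first by rewrite modulus0.
by move=> a b c d ab cd; apply: le_trans (modulusD _ _) (lerD ab cd).
Qed.

(** The real and imaginary parts with both signs; for real scalars the last two are padded by 0.
    They turn a large sum of moduli into a large sum of nonnegative reals, at the price of a factor
    4, and such a sum stays large under positive coefficients bounded below. *)
Definition sgpart (a : 'I_4) : F -> R :=
  match k return scalars R k -> R with
  | RealScalars => fun x : R =>
      if val a == 0%N then x else if val a == 1%N then - x else 0
  | ComplexScalars => fun z : R[i] =>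
      if val a == 0%N then complex.Re z else if val a == 1%N then - complex.Re z
      else if val a == 2%N then complex.Im z else - complex.Im z
  end.

Lemma sgpart_is_zmod_morphism a : zmod_morphism (sgpart a).
Proof.
rewrite /sgpart; case: a => -[|[|[|[|//]]]] /= _; case: k => //= x y; try lra.
all: by case: x y => [x x'] [y y'] /=; lra.
Qed.
HB.instance Definition _ a :=
  GRing.isZmodMorphism.Build F R (sgpart a) (sgpart_is_zmod_morphism a).

Lemma sgpartZ a r x : sgpart a (of_real k r * x) = r * sgpart a x.
Proof.
move: x; rewrite /sgpart; case: a => -[|[|[|[|//]]]] /= _; case: k => //= x; try lra.
all: by case: x => [x x'] /=; lra.
Qed.

Lemma sgpart_le a x : sgpart a x <= modulus x.
Proof.
move: x; rewrite /sgpart /modulus; case: k => x.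
  case: a => -[|[|[|[|//]]]] /= _; rewrite ?ler_norm ?normr_ge0//.
  by rewrite -normrN ler_norm.
case: x => [x y]; rewrite normc_def /=.
have hx : `|x| <= Num.sqrt (x ^+ 2 + y ^+ 2).
  by rewrite -sqrtr_sqr ler_wsqrtr// lerDl sqr_ge0.
have hy : `|y| <= Num.sqrt (x ^+ 2 + y ^+ 2).
  by rewrite -sqrtr_sqr ler_wsqrtr// lerDr sqr_ge0.
case: a => -[|[|[|[|//]]]] /= _.
- exact: le_trans (ler_norm _) hx.
- by apply: le_trans _ hx; rewrite -normrN ler_norm.
- exact: le_trans (ler_norm _) hy.
- by apply: le_trans _ hy; rewrite -normrN ler_norm.
Qed.

Lemma modulus_le_sgpart x : modulus x <= \sum_(a < 4) Num.max (sgpart a x) 0.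
Proof.
have mx (r : R) : `|r| <= Num.max r 0 + Num.max (- r) 0.
  have le1 (y : R) : y <= Num.max y 0 by rewrite le_max lexx.
  have le2 (y : R) : 0 <= Num.max y 0 by rewrite le_max lexx orbT.
  have := (le1 r, le1 (- r), (le2 r, le2 (- r))) => -[[h1 h2] [h3 h4]].
  by rewrite ler_norml; apply/andP; split; lra.
rewrite !big_ord_recl big_ord0; move: x; rewrite /sgpart /modulus; case: k => x.
  by rewrite /=; apply: le_trans (mx _) _; rewrite !maxxx; lra.
case: x => [x y]; rewrite normc_def/= addr0.
apply: (@le_trans _ _ (`|x| + `|y|)).
  have -> : `|x| + `|y| = Num.sqrt ((`|x| + `|y|) ^+ 2).
    by rewrite sqrtr_sqr (@ger0_norm _ (`|x| + `|y|)) ?addr_ge0.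
  rewrite ler_wsqrtr//.
  rewrite sqrrD !real_normK ?num_real// -addrA lerD2l lerDr.
  by rewrite mulrn_wge0// mulr_ge0.
by rewrite addrA; apply: lerD; apply: mx.
Qed.

End Scalars.

(** * Selection of a subsequence with bounded projections *)

Section FiniteCoefficients.
Variables (R : realType) (k : scalar_kind).
Local Notation F := (scalars R k).
Implicit Types u v : nat -> F.

Definition bounded_by N u := forall n, (N <= n)%N -> u n = 0.
Definition fin u := exists N, bounded_by N u.

Definition segm (a b : nat) u : nat -> F :=
  fun n => if (a <= n < b)%N then u n else 0.

Lemma bounded_byW N N' u : (N <= N')%N -> bounded_by N u -> bounded_by N' u.
Proof. by move=> NN' uN n /(leq_trans NN')/uN. Qed.

Lemma fin2 u v : fin u -> fin v -> exists N, bounded_by N u /\ bounded_by N v.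
Proof.
move=> [N uN] [N' vN]; exists (maxn N N').
by split; [apply: bounded_byW uN; rewrite leq_maxl|apply: bounded_byW vN; rewrite leq_maxr].
Qed.

Lemma finP u : fin u <-> finite_set (supp u).
Proof.
split=> [[N uN]|/finite_nat_bound[N NP]].
  apply: sub_finite_set (finite_II N) => n /= un.
  by rewrite ltnNge; apply/negP => /uN E; rewrite /supp/= E eqxx in un.
exists N => n Nn; apply/eqP; rewrite -[_ == _]negbK; apply/negP => /NP.
by rewrite ltnNge Nn.
Qed.

Lemma fin_segm a b u : fin (segm a b u).
Proof. by exists b => n bn; rewrite /segm [(n < b)%N]ltnNge bn andbF. Qed.

Lemma finD u v : fin u -> fin v -> fin (u \+ v).
Proof. by move=> fu /(fin2 fu)[N [uN vN]]; exists N => n Nn /=; rewrite uN ?vN ?addr0. Qed.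

Lemma finZ (c : F) u : fin u -> fin (fun n => c * u n).
Proof. by move=> [N uN]; exists N => n Nn; rewrite uN ?mulr0. Qed.

Lemma fin_unit n : fin (unit_vector R k n).
Proof. by apply/finP; apply: sub_finite_set (@supp_unit _ _ _) (finite_set1 _). Qed.

Section Lincomb.
Variables (T : Type) (x : nat -> T -> F).

Lemma lincombE N u t : bounded_by N u -> lincomb x u t = \sum_(n < N) u n * x n t.
Proof.
move=> uN; rewrite /lincomb (fsbig_ord _ N (fun n => u n * x n t)).
apply: fsbig_widen => [n|n /= [_]] /=.
  rewrite /supp/= => un; rewrite /mkset ltnNge; apply/negP => /uN E.
  by rewrite E eqxx in un.
by rewrite /supp/= => /negP; rewrite negbK => /eqP ->; rewrite mul0r.
Qed.

Lemma lincombD u v t : fin u -> fin v ->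
  lincomb x (u \+ v) t = lincomb x u t + lincomb x v t.
Proof.
move=> fu /(fin2 fu)[N [uN vN]].
rewrite !(@lincombE N)// ?big_split/=; last by move=> n Nn /=; rewrite uN ?vN ?addr0.
by rewrite -big_split; apply: eq_bigr => i _; rewrite /= mulrDl.
Qed.

Lemma lincombZ c u t : fin u -> lincomb x (fun n => c * u n) t = c * lincomb x u t.
Proof.
move=> [N uN]; rewrite !(@lincombE N)// ?mulr_sumr; last first.
  by move=> n Nn; rewrite uN ?mulr0.
by apply: eq_bigr => i _; rewrite mulrA.
Qed.

Lemma lincomb_unit n t : lincomb x (unit_vector R k n) t = x n t.
Proof.
rewrite (@lincombE n.+1) => [|m nm]; last first.
  by rewrite /unit_vector; case: eqP => // E; rewrite E ltnn in nm.
rewrite big_ord_recr/= big1 ?add0r => [|i _]; rewrite /unit_vector.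
  by rewrite eqxx mul1r.
by case: eqP (ltn_ord i) => [->|_]; rewrite ?ltnn// mul0r.
Qed.

End Lincomb.
End FiniteCoefficients.

Section Norm.
Variables (R : realType) (k : scalar_kind) (K : Type).
Local Notation F := (scalars R k).
Variable f : nat -> K -> F.
Hypothesis fnorm : forall n, supnorm (f n) = 1.
Implicit Types u v : nat -> F.

Definition nrm u := supnorm (lincomb f u).

(** A supremum that does not exist has the default value 0, which is not the norm 1. *)
Lemma supnorm_has_sup n : has_sup [set modulus (f n t) | t in [set: K]].
Proof.
apply: contrapT => /sup_out E; have := fnorm n; rewrite /supnorm E.
by move/eqP; rewrite eq_sym oner_eq0.
Qed.

Lemma point_ex : exists t : K, True.
Proof. by have [[_ [t _ _]] _] := supnorm_has_sup 0; exists t. Qed.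

Lemma modulus_f_le1 n t : modulus (f n t) <= 1.
Proof.
rewrite -(fnorm n); apply: ub_le_sup; first exact: (supnorm_has_sup n).2.
by exists t.
Qed.

Lemma supnorm_le (T : Type) (x : T -> F) C : (exists t : T, True) ->
  (forall t, modulus (x t) <= C) -> supnorm x <= C.
Proof.
move=> [t _] xC; apply: ge_sup; first by exists (modulus (x t)), t.
by move=> _ [s _ <-].
Qed.

Lemma modulus_le_supnorm (T : Type) (x : T -> F) C t :
  (forall t, modulus (x t) <= C) -> modulus (x t) <= supnorm x.
Proof.
by move=> xC; apply: ub_le_sup; [exists C => _ [s _ <-]|exists t].
Qed.

Lemma nrm_le u C : (forall t, modulus (lincomb f u t) <= C) -> nrm u <= C.
Proof. exact: supnorm_le point_ex. Qed.

Lemma lincomb_le u t N : bounded_by N u ->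
  modulus (lincomb f u t) <= \sum_(n < N) modulus (u n) * modulus (f n t).
Proof.
move=> uN; rewrite (lincombE _ _ uN); apply: le_trans (modulus_sum _ _ _) _.
by apply: ler_sum => i _; rewrite modulusM.
Qed.

Lemma le_nrm u t : fin u -> modulus (lincomb f u t) <= nrm u.
Proof.
move=> [N uN]; apply: (modulus_le_supnorm (C := \sum_(n < N) modulus (u n))) => s.
apply: le_trans (lincomb_le _ uN) _; apply: ler_sum => i _.
by rewrite ler_piMr ?modulus_ge0 ?modulus_f_le1.
Qed.

Lemma nrm_ge0 u : fin u -> 0 <= nrm u.
Proof. by case: point_ex => t _ fu; apply: le_trans (modulus_ge0 _) (le_nrm t fu). Qed.

Lemma nrmD u v : fin u -> fin v -> nrm (u \+ v) <= nrm u + nrm v.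
Proof.
move=> fu fv; apply: nrm_le => t; rewrite lincombD//.
by apply: le_trans (modulusD _ _) (lerD _ _); exact: le_nrm.
Qed.

Lemma nrmZ c u : fin u -> nrm (fun n => c * u n) = modulus c * nrm u.
Proof.
move=> fu; apply/eqP; rewrite eq_le; apply/andP; split.
  apply: nrm_le => t; rewrite lincombZ// modulusM.
  by rewrite ler_wpM2l ?modulus_ge0 ?le_nrm.
have [->|c0] := eqVneq (modulus c) 0; first by rewrite mul0r nrm_ge0//; exact: finZ.
have cp : 0 < modulus c by rewrite lt_neqAle eq_sym c0 modulus_ge0.
rewrite mulrC -ler_pdivlMr//; apply: nrm_le => t; rewrite ler_pdivlMr//.
by rewrite mulrC -modulusM -lincombZ// le_nrm//; exact: finZ.
Qed.

Lemma nrm_unit n : nrm (unit_vector R k n) = 1.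
Proof.
by rewrite -(fnorm n) /nrm; congr supnorm; apply/funext => t; rewrite lincomb_unit.
Qed.

Lemma nrmB u v : fin u -> fin v -> nrm (u \- v) <= nrm u + nrm v.
Proof.
move=> fu fv; have -> : u \- v = u \+ (fun n => -1 * v n).
  by apply/funext => n /=; rewrite mulN1r.
apply: le_trans (nrmD fu (finZ _ fv)) _.
by rewrite nrmZ// modulusN (_ : modulus 1 = 1) ?mul1r// -[1]/(1%:R) modulus_nat.
Qed.

End Norm.

Lemma series_tail (R : realType) (a : nat -> R) : (forall n, 0 <= a n) ->
  cvgn (series a) -> forall e, 0 < e -> exists n, forall m M, (n <= m)%N ->
  \sum_(m <= j < M) a j <= e.
Proof.
move=> a0 ac e e0; have /cauchy_cvgP/cauchy_seriesP/(_ _ e0) := ac.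
case=> -[A B] /= [[n _ nA] [n' _ n'B]] AB; exists (maxn n n') => m M nm.
have [Mm|mM] := leqP M m; first by rewrite big_geq// ltW.
have /= := AB (m, M); have -> : `|\sum_(m <= j < M) a j| = \sum_(m <= j < M) a j.
  by rewrite ger0_norm// sumr_ge0.
move=> H; apply/ltW/H; split.
  by apply: nA => /=; apply: leq_trans nm; rewrite leq_maxl.
by apply: n'B => /=; apply: leq_trans (ltnW mM); apply: leq_trans nm; rewrite leq_maxr.
Qed.

Lemma bounded_tail (R : realType) (a : nat -> R) (B : R) : (forall n, 0 <= a n) ->
  (forall M, \sum_(n < M) a n <= B) -> forall e, 0 < e ->
  exists n, forall m M, (n <= m)%N -> \sum_(m <= j < M) a j <= e.
Proof.
move=> a0 aB; apply: series_tail => //; apply: nondecreasing_is_cvgn.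
  by apply/nondecreasing_seqP => n; rewrite /series/= big_nat_recr//= lerDl.
by exists B => _ [M _ <-]; rewrite /series/= big_mkord.
Qed.

Section Mazur.
Variables (R : realType) (k : scalar_kind) (K : topologicalType).
Hypothesis Kcompact : compact [set: K].
Local Notation F := (scalars R k).
Variable f : nat -> K -> F.
Hypothesis fcont : forall n, continuous (f n).
Hypothesis fnorm : forall n, supnorm (f n) = 1.
Hypothesis fsum : forall t : K, cvgn (series (fun n => modulus (f n t))).
Implicit Types u v : nat -> F.

Lemma continuous_modulus (h : K -> F) t (e : R) : continuous h -> 0 < e ->
  \forall s \near t, modulus (h s - h t) < e.
Proof.
move=> hc e0; have e1 : 0 < of_real k e by rewrite -(rmorph0 (of_real k)) of_real_lt.
have := hc t; move/cvgrPdist_lt => /(_ _ e1); apply: filterS => s.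
by rewrite modulus_norm of_real_lt modulusB.
Qed.

Lemma continuous_lincomb u : fin u -> continuous (lincomb f u).
Proof.
move=> [N uN]; have -> : lincomb f u = fun t => \sum_(n < N) u n * f n t.
  by apply/funext => t; exact: lincombE.
move=> t; apply: cvg_big => [|i _]; first exact: add_continuous.
by apply: cvgM; [exact: cvg_cst|exact: fcont].
Qed.

Lemma modulus_f_tail t (e : R) : 0 < e -> exists n, forall m M, (n <= m)%N ->
  \sum_(m <= j < M) modulus (f j t) <= e.
Proof. by apply: (series_tail (fun=> modulus_ge0 _) (@fsum t)). Qed.

(** The near-covering form of compactness: [t'] is the centre of a neighbourhood of [t], and the
    finiteness of the net is what makes a single [n'] valid for all centres. *)
Lemma finite_net n (e d : R) : 0 < e -> 0 < d -> exists2 n', (n < n')%N &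
  forall t, exists2 t', forall i, (i <= n)%N -> modulus (f i t - f i t') <= e &
    forall m M, (n' <= m)%N -> \sum_(m <= j < M) modulus (f j t') <= d.
Proof.
move=> e0 d0.
have /compact_near_coveringP/(_ _ \oo) := Kcompact.
move=> /(_ (fun n' t => exists2 t', forall i, (i <= n)%N -> modulus (f i t - f i t') <= e &
    forall m M, (n' <= m)%N -> \sum_(m <= j < M) modulus (f j t') <= d) _) H.
have {H} [|n0 _ n0P] := H.
  move=> t _; have [m mP] := modulus_f_tail t d0.
  exists ([set s | forall i, (i <= n)%N -> modulus (f i s - f i t) < e], [set j | (m <= j)%N]).
    split=> /=; last by exists m.
    have : \forall s \near t, forall i : 'I_n.+1, modulus (f i s - f i t) < e.
      by apply: filter_forall => i; apply: continuous_modulus => //; exact: fcont.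
    by apply: filterS => s sP i; rewrite -ltnS => ilt; exact: (sP (Ordinal ilt)).
  move=> [s j] /= [sP mj]; exists t => [i /sP/ltW//|m' M jm'].
  by apply: mP; exact: leq_trans jm'.
exists (maxn n0 n.+1); first by rewrite leq_max leqnn orbT.
move=> t; have [t' t'1 t'2] := n0P (maxn n0 n.+1) (leq_maxl _ _) t I.
by exists t'.
Qed.

Lemma max_coef u N : exists2 j, (j <= N)%N & forall i, (i <= N)%N -> modulus (u i) <= modulus (u j).
Proof.
elim: N => [|N [j jN jP]]; first by exists 0%N => // -[].
have [h|h] := leP (modulus (u N.+1)) (modulus (u j)).
  exists j; first by lia.
  by move=> i; rewrite leq_eqVlt => /orP[/eqP->//|]; exact: jP.
exists N.+1 => // i; rewrite leq_eqVlt => /orP[/eqP->//|iN].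
by apply: le_trans (jP i iN) (ltW h).
Qed.

(* Mazur's selection: a finite net of K norming the span of the chosen functions
   up to a small error, together with pointwise summability, makes the next
   function almost invisible on that net.  This bounds the projections of the
   subsequence without using that f itself is basic. *)
Lemma basic_subsequence : exists g : nat -> nat,
  [/\ forall i, (g i < g i.+1)%N, forall i, (2 ^ i <= (g i).+1)%N &
  forall u, fin u -> supp u `<=` range g ->
    (forall N, nrm f (segm 0 N u) <= 2 * nrm f u) /\
    forall j, modulus (u j) <= 4 * nrm f u].
Proof.
(* With coefficients at most M, moving from t to t' costs at most (n+1) * M / (8 (n+1)) = M/8, and
   dropping the tail at t' costs another M/8. The growth beyond 2n+1 yields 2^i <= g i + 1. *)
have H n : exists n', (2 * n + 1 < n')%N /\
  forall t, exists2 t', forall i, (i <= n)%N -> modulus (f i t - f i t') <= (8 * n.+1%:R)^-1 &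
    forall m M, (n' <= m)%N -> \sum_(m <= j < M) modulus (f j t') <= (8^-1 : R).
  have [||n' nn' n'P] := @finite_net n (8 * n.+1%:R)^-1 8^-1.
  - by rewrite invr_gt0 mulr_gt0.
  - by rewrite invr_gt0.
  exists (maxn n' (2 * n + 2)); split; first by rewrite leq_max; apply/orP; right; lia.
  move=> t; have [t' h1 h2] := n'P t; exists t' => // m M; rewrite geq_max => /andP[nm _].
  exact: h2.
have [nx nxP] := boolp.choice H.
pose g := fix g i := if i is j.+1 then nx (g j) else 0%N.
have gS i : (2 * g i + 1 < g i.+1)%N by case: (nxP (g i)).
have gm i : (g i < g i.+1)%N by have := gS i; lia.
have gmono i j : (i < j)%N -> (g i < g j)%N.
  elim: j => // j IH; rewrite ltnS leq_eqVlt => /orP[/eqP->//|/IH h].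
  exact: ltn_trans h (gm j).
exists g; split=> //.
  by elim=> // i IH; rewrite expnS; have := gS i; lia.
move=> u fu ug; have [L uL] := fu.
have [j0 j0L j0P] := max_coef u L.
have {j0P} uM i : modulus (u i) <= modulus (u j0).
  have [/j0P//|/ltnW/uL->] := leqP i L; by rewrite modulus0 modulus_ge0.
set M := modulus (u j0) in uM.
have M0 : 0 <= M by exact: modulus_ge0.
(* M is kept on the right for now. Two consecutive cuts differ by one coefficient, which gives M <=
   2 * nrm f u + M/2, so M <= 4 * nrm f u, and only then the bound 2 for the cuts. *)
have main N : nrm f (segm 0 N u) <= nrm f u + M / 4.
  have nuM : 0 <= nrm f u + M / 4 by rewrite addr_ge0 ?nrm_ge0 ?divr_ge0.
  have [[q [gqN qmax]]|nq] := pselect (exists q, (g q < N)%N /\ (N <= g q.+1)%N); last first.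
    apply: nrm_le => // t; rewrite (@lincombE _ _ _ _ 0) ?big_ord0 ?modulus0// => n _.
    rewrite /segm /=; case: ifP => // nN; apply/eqP; rewrite -[_ == _]negbK; apply/negP => /ug.
    case=> i _ gi; have gN : (g i < N)%N by rewrite gi.
    have ib : forall j, (g j < N)%N -> (j <= N)%N.
      move=> j /ltnW; apply: leq_trans; elim: j => // j IHj; exact: leq_ltn_trans IHj (gm j).
    have [q qN qmax] := ex_maxnP (ex_intro (fun j => (g j < N)%N) _ gN) ib.
    apply: nq; exists q; split=> //; rewrite leqNgt; apply/negP => /qmax.
    by rewrite ltnn.
  apply: nrm_le => // t; have [t' h1 h2] := (nxP (g q)).2 t.
  set x := lincomb f (segm 0 N u).
  have cutN : bounded_by (g q).+1 (segm 0 N u).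
    move=> n gn; rewrite /segm /=; case: ifP => // nN.
    apply/eqP; rewrite -[_ == _]negbK; apply/negP => /ug [i _ gi].
    have [iq|] := leqP i q.
      move: iq; rewrite leq_eqVlt => /orP[/eqP iq|/gmono]; last by lia.
      by rewrite -gi iq ltnn in gn.
    by rewrite leq_eqVlt => /orP[/eqP iq|/gmono]; [rewrite -iq in gi; lia|lia].
  have x1 : modulus (x t - x t') <= M / 8.
    rewrite /x !(lincombE _ _ cutN) -sumrB; apply: le_trans (modulus_sum _ _ _) _.
    apply: (@le_trans _ _ (\sum_(n < (g q).+1) M * (8 * (g q).+1%:R)^-1)).
      apply: ler_sum => i _; rewrite -mulrBr modulusM ler_pM ?modulus_ge0//.
        by rewrite /segm; case: ifP => // _; rewrite modulus0.
      by apply: h1; rewrite -ltnS.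
    by rewrite sumr_const card_ord -[leLHS]mulr_natr invfM mulrA mulfVK ?pnatr_eq0.
  have x2 : modulus (lincomb f u t' - x t') <= M / 8.
    set L' := maxn L (nx (g q)).
    have uL' : bounded_by L' u by apply: bounded_byW uL; rewrite leq_maxl.
    have cL' : bounded_by L' (segm 0 N u) by move=> n /uL'; rewrite /segm => ->; rewrite if_same.
    rewrite /x (lincombE _ _ uL') (lincombE _ _ cL') -sumrB.
    rewrite -(big_mkord xpredT (fun i => u i * f i t' - segm 0 N u i * f i t')).
    rewrite (@big_cat_nat _ _ _ (nx (g q)))//=; last by rewrite leq_maxr.
    rewrite [X in X + _]big_nat_cond big1 ?add0r => [|i /andP[/andP[_ ilt] _]].
      apply: le_trans (modulus_sum _ _ _) _.
      apply: (@le_trans _ _ (\sum_(nx (g q) <= i < L') M * modulus (f i t'))).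
        rewrite [leLHS]big_nat_cond [leRHS]big_nat_cond; apply: ler_sum => i /andP[/andP[ilt _] _].
        rewrite /segm /= ltnNge (leq_trans qmax ilt) /= mul0r subr0 modulusM.
        by rewrite ler_wpM2r ?modulus_ge0.
      by rewrite -mulr_sumr ler_wpM2l// h2.
    rewrite /segm /=; case: ifP => [|/negbT]; first by rewrite subrr.
    rewrite -leqNgt => Ni; rewrite mul0r subr0.
    suff -> : u i = 0 by rewrite mul0r.
    apply/eqP; rewrite -[_ == _]negbK; apply/negP => /ug [i' _ gi].
    have [iq|] := leqP i' q.
      have : (g i' <= g q)%N by move: iq; rewrite leq_eqVlt => /orP[/eqP->//|/gmono/ltnW].
      by rewrite gi => h; have := leq_trans gqN (leq_trans Ni h); rewrite ltnn.
    rewrite leq_eqVlt => /orP[/eqP iq|/gmono]; first by rewrite -gi -iq /= ltnn in ilt.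
    by rewrite gi /= => h; have := ltn_trans ilt h; rewrite ltnn.
  have -> : x t = (x t - x t') + (- (lincomb f u t' - x t') + lincomb f u t').
    by rewrite opprB subrK subrK.
  have := @le_nrm _ _ _ f fnorm u t' fu; rewrite -/(modulus _) => h3.
  apply: le_trans (modulusD _ _) _; apply: (le_trans (lerD (lexx _) (modulusD _ _))).
  by rewrite modulusN; lra.
have M4 : M <= 4 * nrm f u.
  have : nrm f (segm 0 j0.+1 u \- segm 0 j0 u) <= 2 * nrm f u + M / 2.
    have h1 := main j0.+1; have h2 := main j0.
    have := @nrmB _ _ _ f fnorm (segm 0 j0.+1 u) (segm 0 j0 u) (fin_segm _ _ _) (fin_segm _ _ _).
    by lra.
  have -> : segm 0 j0.+1 u \- segm 0 j0 u = fun n => u j0 * unit_vector R k j0 n.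
    apply/funext => n /=; rewrite /segm /unit_vector /= ltnS.
    case: (ltngtP n j0) => [h|h|->]; rewrite ?mulr0 ?subrr ?subr0 ?mulr1//.
  rewrite nrmZ ?nrm_unit//; last exact: fin_unit.
  by rewrite mulr1 -/M; lra.
split=> [N|j]; last exact: le_trans (uM j) M4.
by have := main N; lra.
Qed.

End Mazur.

(** * Averages supported in a fixed set *)

Lemma enum_agree (g h : nat -> nat) n :
  (forall i j, (i < j)%N -> (g i < g j)%N) ->
  (forall i j, (i < j)%N -> (h i < h j)%N) ->
  (forall x, (x <= g n)%N -> (range g x <-> range h x)) ->
  forall l, (l <= n)%N -> g l = h l.
Proof.
move=> gm hm gh l; elim/ltn_ind: l => l IH ln.
have le_mono (p : nat -> nat) : (forall i j, (i < j)%N -> (p i < p j)%N) ->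
    forall i j, (i <= j)%N -> (p i <= p j)%N.
  by move=> pm i j; rewrite leq_eqVlt => /orP[/eqP->//|/pm/ltnW].
have gln := le_mono g gm _ _ ln.
case: (ltngtP (g l) (h l)) => // lt.
  have [m _ hmg] : range h (g l) by apply/gh => //; exists l.
  have [lm|ml] := leqP l m; first by have := le_mono h hm _ _ lm; lia.
  by have := IH _ ml; have := gm _ _ ml; lia.
have [m _ gmh] : range g (h l) by apply/gh; [lia|exists l].
have [lm|ml] := leqP l m; first by have := le_mono g gm _ _ lm; lia.
by have := IH _ ml; have := hm _ _ ml; lia.
Qed.

Section Averages.
Variables (R : realType) (k : scalar_kind) (K : Type).
Local Notation F := (scalars R k).
Variable f : nat -> K -> F.
Hypothesis fnorm : forall n, supnorm (f n) = 1.
Variables (W : omega1) (assoc : W -> nat -> W).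
Variable N0 : set nat.
Hypothesis N0_infinite : infinite_set N0.
Hypothesis N0_coef : forall u : nat -> F, fin u -> supp u `<=` N0 ->
  forall j, modulus (u j) <= 4 * nrm f u.
Implicit Types (u v : nat -> F) (M L : set nat).
Local Notation avg := (avg f assoc).

Definition above u : set nat := [set m | forall i, supp u i -> (i < m)%N].

Lemma bounded_byP N u : bounded_by N u <-> forall i, supp u i -> (i < N)%N.
Proof.
split=> [uN i ui|H n Nn].
  by rewrite ltnNge; apply/negP => /uN E; rewrite /supp/= E eqxx in ui.
by apply/eqP; rewrite -[_ == _]negbK; apply/negP => /H; rewrite ltnNge Nn.
Qed.

Lemma infinite_above M u : infinite_set M -> fin u ->
  infinite_set [set m | M m /\ above u m].
Proof.
move=> Mi [N /bounded_byP uN] H; apply: Mi.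
apply: (@sub_finite_set _ _ (`I_N `|` [set m | M m /\ above u m])).
  move=> x Mx; case: (ltnP x N) => xN; [by left|right].
  by split=> // i /uN iN; exact: leq_trans xN.
by rewrite finite_setU.
Qed.

Lemma nrm_gt0 u : fin u -> supp u !=set0 -> supp u `<=` N0 -> 0 < nrm f u.
Proof.
move=> fu [i ui] uN; have := N0_coef fu uN i.
suff : 0 < modulus (u i) by lra.
rewrite lt_neqAle modulus_ge0 andbT eq_sym; apply/eqP => /modulus_eq0 E.
by rewrite /supp/= E eqxx in ui.
Qed.

Lemma normalizeE u : normalize f u = fun j => of_real k (nrm f u)^-1 * u j.
Proof. by apply/funext => j; rewrite /normalize -fmorphV mulrC. Qed.

Lemma supp_scale (c : F) u : c != 0 -> supp (fun j => c * u j) = supp u.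
Proof.
by move=> c0; apply/seteqP; split=> j; rewrite /supp/= mulf_eq0 (negbTE c0).
Qed.

Section Normalize.
Variable u : nat -> F.
Hypotheses (fu : fin u) (u0 : supp u !=set0) (uN : supp u `<=` N0).

Let nu : of_real k (nrm f u)^-1 != 0.
Proof. by rewrite fmorphV invr_eq0 fmorph_eq0 gt_eqF// nrm_gt0. Qed.

Lemma fin_normalize : fin (normalize f u).
Proof. by rewrite normalizeE; exact: finZ. Qed.

Lemma supp_normalize : supp (normalize f u) = supp u.
Proof. by rewrite normalizeE supp_scale. Qed.

Lemma nrm_normalize : nrm f (normalize f u) = 1.
Proof.
have n0 := nrm_gt0 fu u0 uN.
rewrite normalizeE nrmZ// modulus_real ger0_norm ?mulVf ?gt_eqF//.
by rewrite invr_ge0 ltW.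
Qed.

End Normalize.

Section Sums.
Variables (n : nat) (v : nat -> nat -> F).
Hypothesis vlt : forall i, (i.+1 < n)%N -> block_lt (v i) (v i.+1).
Hypothesis v0 : forall i, (i < n)%N -> supp (v i) !=set0.

Lemma block_lt_trans i j : (i < j < n)%N -> block_lt (v i) (v j).
Proof.
elim: j => // j IH /andP[]; rewrite ltnS leq_eqVlt => /orP[/eqP->|ij] jn.
  exact: vlt.
have [x vx] := v0 (ltnW jn) => p q vp vq.
have h1 : (p < x)%N by apply: IH => //; rewrite ij ltnW.
by have := vlt jn vx vq; lia.
Qed.

Lemma sum_successive i x : (i < n)%N -> supp (v i) x -> \sum_(j < n) v j x = v i x.
Proof.
move=> ilt vx; rewrite (bigD1 (Ordinal ilt))//= big1 ?addr0// => -[j jn] /= ji.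
apply/eqP; rewrite -[_ == _]negbK; apply/negP => vjx.
have {ji} : j != i by apply: contraNN ji => /eqP E; apply/eqP/val_inj.
rewrite neq_ltn => /orP[ji|ij].
  by have := @block_lt_trans j i; rewrite ji ilt => /(_ isT _ _ vjx vx); rewrite ltnn.
by have := @block_lt_trans i j; rewrite ij jn => /(_ isT _ _ vx vjx); rewrite ltnn.
Qed.

Lemma supp_sum x : supp (fun y => \sum_(j < n) v j y) x <-> exists2 i, (i < n)%N & supp (v i) x.
Proof.
split=> [|[i ilt vx]]; last by rewrite /supp/= (sum_successive ilt vx).
rewrite /supp/= => sx; apply: contrapT => H; move: sx; rewrite big1 ?eqxx// => -[i ilt] _.
apply/eqP; rewrite -[_ == _]negbK; apply/negP => vx; apply: H; by exists i.
Qed.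

End Sums.

Lemma fin_sum n (v : nat -> nat -> F) : (forall i, (i < n)%N -> fin (v i)) ->
  fin (fun y => \sum_(j < n) v j y).
Proof.
move=> H; have {H} [N NP] : exists N, forall i, (i < n)%N -> bounded_by N (v i).
  elim: n H => [_|n IH H]; first by exists 0%N.
  have [|N NP] := IH; first by move=> i ilt; apply: H; lia.
  have [N' N'P] := H n (ltnSn n); exists (maxn N N') => i.
  rewrite ltnS leq_eqVlt => /orP[/eqP->|/NP h].
    by apply: bounded_byW N'P; rewrite leq_maxr.
  by apply: bounded_byW h; rewrite leq_maxl.
exists N => x Nx; rewrite big1// => -[i ilt] _; exact: NP.
Qed.

(** The clause on x and i says that the successive averages exhaust [M] in order. It makes an
    average depend on an initial segment of [M] only, and it has to be carried through the same
    induction as the other properties. *)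
Lemma avg_facts a M n u : avg a M n u -> infinite_set M -> M `<=` N0 ->
  [/\ fin u, supp u !=set0, supp u `<=` M /\ nrm f u = 1,
    forall x i, M x -> supp u i -> (x <= i)%N ->
      exists l w, [/\ (l <= n)%N, avg a M l w & supp w x] &
    forall n' w, n = n'.+1 -> avg a M n' w -> block_lt w u].
Proof.
elim=> {a M n u}.
- move=> a M g n za gm gM Mi MN; split.
  + exact: fin_unit.
  + by exists (g n); rewrite /supp/= /unit_vector eqxx oner_eq0.
  + split; last exact: nrm_unit.
    by move=> x /supp_unit ->; rewrite -gM; exists n.
  + move=> x i; rewrite -{1}gM => -[l _ <-] /supp_unit -> lgn.
    exists l, (unit_vector R k (g l)); split; [|exact: avg_zero|].
      by rewrite leqNgt; apply/negP => /gm; rewrite ltnNge lgn.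
    by rewrite /supp/= /unit_vector eqxx oner_eq0.
  + move=> n' w E h; subst n.
    rewrite (avg_uniq h (avg_zero _ _ _ za gm gM)) => i j /supp_unit -> /supp_unit ->.
    exact: gm.
- move=> a b M m v sb mM h IH Mi MN.
  have vfin i : (i < m.+1)%N -> fin (v i) by move=> im; have [] := IH _ im Mi MN.
  have v0 i : (i < m.+1)%N -> supp (v i) !=set0 by move=> im; have [] := IH _ im Mi MN.
  have vlt i : (i.+1 < m.+1)%N -> block_lt (v i) (v i.+1).
    by move=> im; have [_ _ _ _] := IH _ im Mi MN; apply; [done | apply: h; lia].
  set s := fun j => \sum_(i < m.+1) v i j.
  have fs : fin s by exact: fin_sum.
  have sP := supp_sum vlt v0.
  have s0 : supp s !=set0 by have [x vx] := v0 0%N isT; exists x; apply/sP; exists 0%N.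
  have sM : supp s `<=` M by move=> x /sP[i ilt vx]; have [_ _ [+ _] _ _] := IH _ ilt Mi MN; apply.
  have sN : supp s `<=` N0 by exact: subset_trans MN.
  rewrite supp_normalize//; split; [exact: fin_normalize | done | | | done].
    by split=> //; exact: nrm_normalize.
  move=> x i Mx /sP[j jm vi] xi; exists 0%N, (normalize f s); split=> //.
    exact: avg_succ sb mM h.
  rewrite supp_normalize//; apply/sP.
  have [_ _ _ /(_ _ _ Mx vi xi)[l [w [lj hw wx]]] _] := IH _ jm Mi MN.
  exists l; first by lia.
  by rewrite -(avg_uniq hw (h _ _))//; lia.
- move=> a M la m0 Mi MN; split; [exact: fin_unit | | | | done].
  + by exists 0%N; rewrite /supp/= /unit_vector eqxx oner_eq0.
  + by split; [move=> x /supp_unit ->; case: m0|exact: nrm_unit].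
  + move=> x i Mx /supp_unit ->; rewrite leqn0 => /eqP ->.
    exists 0%N, (unit_vector R k 0); split=> //; first exact: avg_lim1.
    by rewrite /supp/= /unit_vector eqxx oner_eq0.
- move=> a M m v la mM m0 h IH Mi MN.
  have [||fv [y vy] [vM nv] vinit _] := IH.
  + by apply: infinite_setD => //.
  + by apply: subset_trans MN => x [].
  set s := fun j => m.+1%:R^-1 * unit_vector R k m j + v j.
  have sP x : supp s x <-> x = m \/ supp v x.
    rewrite /supp/= /s /unit_vector; have [->|xm] /= := eqVneq x m.
      split=> _; first by left.
      suff -> : v m = 0 by rewrite addr0 mulr1 invr_eq0 pnatr_eq0.
      apply/eqP; rewrite -[_ == _]negbK; apply/negP => /vM [_]; exact.
    rewrite mulr0 add0r; split; first by right.
    by case=> // E; rewrite E eqxx in xm.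
  have fs : fin s by apply: finD fv; apply: finZ; exact: fin_unit.
  have s0 : supp s !=set0 by exists m; apply/sP; left.
  have sM : supp s `<=` M by move=> x /sP[->|/vM[]//]; case: mM.
  have sN : supp s `<=` N0 by exact: subset_trans MN.
  rewrite supp_normalize//; split; [exact: fin_normalize | done | | | done].
    by split=> //; exact: nrm_normalize.
  move=> x i Mx si xi; exists 0%N, (normalize f s); split=> //.
    exact: avg_lim la mM m0 h.
  rewrite supp_normalize//; apply/sP; have [->|xm] := eqVneq x m; [by left|right].
  have mx : (m < x)%N by rewrite ltn_neqAle eq_sym xm; case: mM => _; apply.
  case/sP: si => [E|vi]; first by lia.
  have [|l [w [+ hw wx]]] := vinit x i _ vi xi; first by split=> //; apply/eqP.
  by rewrite leqn0 => /eqP l0; rewrite l0 in hw; rewrite -(avg_uniq hw h).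
- move=> a M n u v nz hu IHu hv IHv Mi MN.
  have [//|//|fu u0 [uM nu] uinit ult] := IHu.
  have [||fv v0 [vM nv] vinit vlt] := IHv.
  + exact: infinite_above.
  + by move=> x [/MN].
  split=> //.
  + by split=> // x /vM[].
  + move=> x i Mx vi xi; have [xu|] := pselect (above u x).
      have [//|l [w [+ hw wx]]] := vinit x i _ vi xi.
      rewrite leqn0 => /eqP l0; rewrite l0 in hw; exists n.+1, w; split=> //.
      exact: avg_next hu hw.
    move=> /existsNP[j /not_implyP[uj /negP]]; rewrite -leqNgt => xj.
    have [l [w [ln hw wx]]] := uinit x j Mx uj xj.
    by exists l, w; split=> //; lia.
  + move=> n' w [<-] hw; rewrite (avg_uniq hw hu) => i j ui /vM[_]; exact.
Qed.

(** The recursion inspects [M] only up to the last point of the support, so the rest of [M] may be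
    exchanged. This allows averages along different sets to be glued. *)
Lemma avg_agree a M n u : avg a M n u -> infinite_set M -> M `<=` N0 ->
  forall M', infinite_set M' -> M' `<=` N0 ->
  (forall i x, supp u i -> (x <= i)%N -> (M x <-> M' x)) -> avg a M' n u.
Proof.
elim=> {a M n u}.
- move=> a M g n za gm gM Mi MN M' Mi' MN' MM'.
  have [h [hm hM]] := infinite_nat_enum Mi'.
  rewrite (@enum_agree g h n)//; first exact: avg_zero.
  move=> x xg; rewrite gM hM; apply: (MM' (g n)) => //.
  by rewrite /supp/= /unit_vector eqxx oner_eq0.
- move=> a b M m v sb mM h IH Mi MN M' Mi' MN' MM'.
  have H i : (i < m.+1)%N -> _ := fun ilt => avg_facts (h i ilt) Mi MN.
  have vfin i : (i < m.+1)%N -> fin (v i) by move=> /H[].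
  have v0 i : (i < m.+1)%N -> supp (v i) !=set0 by move=> /H[].
  have vlt i : (i.+1 < m.+1)%N -> block_lt (v i) (v i.+1).
    by move=> im; have [_ _ _ _] := H _ im; apply; [done | apply: h; lia].
  have sP := supp_sum vlt v0.
  have sN : supp (fun j => \sum_(i < m.+1) v i j) `<=` N0.
    by move=> x /sP[i ilt vx]; have [_ _ [+ _] _ _] := H _ ilt; move/(_ _ vx)/MN.
  have agree i y x : (i < m.+1)%N -> supp (v i) y -> (x <= y)%N -> (M x <-> M' x).
    move=> im vy xy; apply: (MM' y) => //; rewrite supp_normalize//.
    - by apply/sP; exists i.
    - exact: fin_sum.
    - by exists y; apply/sP; exists i.
  apply: avg_succ (sb) _ _ => [|i im]; last first.
    by apply: IH => // y x; exact: agree.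
  have [y vy] := v0 0%N isT; have my : (m <= y)%N.
    by have [_ _ [+ _] _ _] := H 0%N isT; move=> /(_ _ vy); case: mM => _; apply.
  split; first by apply/(agree 0%N y); case: mM.
  move=> j Mj; have [//|jm] := leqP m j.
  have : M j by apply/(agree 0%N y) => //; lia.
  by case: mM => _ /[apply]; rewrite leqNgt jm.
- move=> a M la m0 Mi MN M' Mi' MN' MM'; apply: avg_lim1 => //; split=> //.
  apply/(MM' 0%N) => //; last by case: m0.
  by rewrite /supp/= /unit_vector eqxx oner_eq0.
- move=> a M m v la mM m0 h IH Mi MN M' Mi' MN' MM'.
  have Mi1 : infinite_set (M `\ m) by exact: infinite_setD.
  have MN1 : M `\ m `<=` N0 by move=> x [/MN].
  have [fv [y vy] [vM nv] vinit _] := avg_facts h Mi1 MN1.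
  set s := fun j => m.+1%:R^-1 * unit_vector R k m j + v j.
  have sP x : supp v x -> supp s x.
    move=> vx; rewrite /supp/= /s /unit_vector; have [xm|xm] /= := eqVneq x m.
      by have := vM _ vx; rewrite xm => -[_]; case.
    by rewrite mulr0 add0r.
  have sN : supp s `<=` N0.
    move=> x; rewrite /supp/= /s /unit_vector; have [->|xm] /= := eqVneq x m.
      by move=> _; apply: MN; case: mM.
    by rewrite mulr0 add0r => /vM[/MN].
  have fs : fin s by apply: finD fv; apply: finZ; exact: fin_unit.
  have agree z x : supp v z -> (x <= z)%N -> (M x <-> M' x).
    move=> vz xz; apply: (MM' z) => //; rewrite supp_normalize//; first exact: sP.
    by exists z; exact: sP.
  have my : (m <= y)%N by have [My _] := vM _ vy; case: mM => _; apply.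
  apply: avg_lim => //.
    split; first by apply/(agree y); case: mM.
    move=> j Mj; have [//|jm] := leqP m j.
    have : M j by apply/(agree y) => //; lia.
    by case: mM => _ /[apply]; rewrite leqNgt jm.
  apply: IH => //; [exact: infinite_setD | by move=> x [/MN'] |].
  by move=> z x vz xz; split=> -[Mx xm]; split=> //; apply/(agree z).
- move=> a M n u v nz hu IHu hv IHv Mi MN M' Mi' MN' MM'.
  have [fu u0 _ _ _] := avg_facts hu Mi MN.
  have Mi1 : infinite_set [set m | M m /\ above u m] by exact: infinite_above.
  have MN1 : [set m | M m /\ above u m] `<=` N0 by move=> x [/MN].
  have [_ [y vy] [vM _] _ _] := avg_facts hv Mi1 MN1.
  apply: avg_next (nz) (IHu _ _ _ _ _ _) (IHv _ _ _ _ _ _) => //.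
  + move=> i x ui xi; apply: (MM' y) => //.
    by have [_ /(_ _ ui)] := vM _ vy; lia.
  + exact: infinite_above.
  + by move=> x [/MN'].
  + by move=> i x vi xi; split=> -[Mx ux]; split=> //; apply/(MM' i).
Qed.

(** The constructor [avg_next] excludes order 0. There the same rule holds because removing the
    first n+1 elements of [M] shifts its enumeration. *)
Lemma avg_next_any a M n u v : infinite_set M -> M `<=` N0 -> avg a M n u ->
  avg a [set m | M m /\ above u m] 0 v -> avg a M n.+1 v.
Proof.
move=> Mi MN hu hv; have [za|nz] := pselect (is_zero a); last exact: avg_next hu hv.
have [g [gm gM]] := infinite_nat_enum Mi.
have {hu} uE := avg_uniq hu (avg_zero _ _ n za gm gM).
have au m : above u m <-> (g n < m)%N.
  split=> [|gnm i]; last by rewrite uE => /supp_unit ->.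
  by apply; rewrite uE /supp/= /unit_vector eqxx oner_eq0.
rewrite (avg_uniq hv (@avg_zero _ _ _ f _ assoc _ _ (fun i => g (i + n.+1)%N) 0 za _ _)).
- by rewrite add0n; exact: avg_zero.
- by move=> i j ij; apply: gm; rewrite ltn_add2r.
- apply/seteqP; split=> [_ [i _ <-]|x].
    by split; [rewrite -gM; exists (i + n.+1)%N|apply/au/gm; lia].
  rewrite /= -{1}gM => -[[i _ <-] /au gni]; exists (i - n.+1)%N => //.
  rewrite subnK//; have [//|] := leqP n.+1 i.
  by rewrite ltnS leq_eqVlt => /orP[/eqP E|/gm]; [rewrite E in gni|]; lia.
Qed.

Definition avgN a v := exists L, [/\ infinite_set L, L `<=` N0 & avg a L 0 v].

Lemma avgN_facts a v : avgN a v ->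
  [/\ fin v, supp v !=set0, supp v `<=` N0 & nrm f v = 1].
Proof.
move=> [L [Li LN h]]; have [fv v0 [vL nv] _ _] := avg_facts h Li LN.
by split=> //; exact: subset_trans LN.
Qed.

Lemma avgN_average a v : avgN a v -> is_average f assoc a v.
Proof. by move=> [L [Li LN h]]; exists L. Qed.

(** A first average exhausts an initial segment of its set, so up to the end of the support both
    sets consist of the support alone. *)
Lemma avgN_on a v M : avgN a v -> infinite_set M -> M `<=` N0 ->
  supp v `<=` M -> (forall x i, M x -> supp v i -> (x <= i)%N -> supp v x) ->
  avg a M 0 v.
Proof.
move=> [L [Li LN h]] Mi MN vM vinit.
have [fv v0 [vL nv] Linit _] := avg_facts h Li LN.
apply: (avg_agree h) => // i x vi xi; split=> [Lx|Mx]; last first.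
  exact/vL/(vinit x i).
have [l [w [+ hw wx]]] := Linit x i Lx vi xi.
by rewrite leqn0 => /eqP l0; rewrite l0 in hw; apply: vM; rewrite -(avg_uniq hw h).
Qed.

Lemma avgN_zero a n : is_zero a -> N0 n -> avgN a (unit_vector R k n).
Proof.
move=> za Nn; exists [set x | N0 x /\ (n <= x)%N].
have Li : infinite_set [set x | N0 x /\ (n <= x)%N].
  move=> H; apply: N0_infinite; apply: (@sub_finite_set _ _ (`I_n `|` [set x | N0 x /\ (n <= x)%N])).
    by move=> x Nx; have [|] := ltnP x n; [left|right].
  by rewrite finite_setU.
split=> //; first by move=> x [].
have [g [gm gL]] := infinite_nat_enum Li.
suff E : g 0%N = n by have := @avg_zero _ _ _ f _ assoc _ _ g 0%N za gm gL; rewrite E.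
have : range g n by rewrite gL.
case=> i _ gi; have [_ +] : [set x | N0 x /\ (n <= x)%N] (g 0%N) by rewrite -gL; exists 0%N.
by case: i gi => [//|i gi]; have := gm 0%N i.+1 isT; lia.
Qed.

Lemma avgN_succ a b m (v : nat -> nat -> F) : is_succ b a ->
  (forall i, (i <= m)%N -> avgN b (v i)) ->
  (forall i, (i < m)%N -> block_lt (v i) (v i.+1)) ->
  is_min (supp (v 0%N)) m ->
  avgN a (normalize f (fun j => \sum_(i < m.+1) v i j)).
Proof.
move=> sb va vlt vm.
have H i : (i <= m)%N -> _ := fun im => avgN_facts (va i im).
have v0 i : (i < m.+1)%N -> supp (v i) !=set0 by move=> /H[].
have lt := @block_lt_trans m.+1 v vlt v0.
(* All the supports, continued by the elements of [N0] above the last one. Along this set [v i] is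
   the block with index i of order [b]. *)
pose M := [set x | N0 x /\ ((exists2 i, (i <= m)%N & supp (v i) x) \/ above (v m) x)].
have Mi : infinite_set M.
  have [fv _ _ _] := H m (leqnn m).
  move=> Mf; apply: (infinite_above N0_infinite fv); apply: sub_finite_set Mf.
  by move=> x [Nx vx]; split=> //; right.
have MN : M `<=` N0 by move=> x [].
have vM i : (i <= m)%N -> supp (v i) `<=` M.
  by move=> im x vx; split; [have [_ _ + _] := H i im; apply|left; exists i].
have Mgt i x y : (i <= m)%N -> M x -> supp (v i) y -> (x <= y)%N ->
    exists2 l, (l <= i)%N & supp (v l) x.
  move=> im [_ [[l lm vx]|vx]] vy xy; last first.
    move: im; rewrite leq_eqVlt => /orP[/eqP E|im].
      by rewrite E in vy; have := vx _ vy; rewrite ltnNge xy.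
    have [z vz] := v0 m (ltnSn m); have := lt i m; rewrite im ltnSn => /(_ isT _ _ vy vz).
    by have := vx _ vz; lia.
  have [li|il] := leqP l i; first by exists l.
  by have := lt i l; rewrite il ltnS lm => /(_ isT _ _ vy vx); rewrite ltnNge xy.
have vh i : (i <= m)%N -> avg b M i (v i).
  elim: i => [_|i IH im].
    apply: (avgN_on (va _ _)) => //; first exact: vM.
    by move=> x y Mx vy xy; have [//|l] := Mgt 0%N x y _ Mx vy xy; rewrite leqn0 => /eqP ->.
  have vi := IH (ltnW im); apply: (avg_next_any Mi MN vi).
  have [fi [z vz] _ _] := H i (ltnW im).
  apply: avgN_on; [exact: va | exact: infinite_above | by move=> x [/MN] | |].
    move=> x vx; split; first exact: vM vx.
    by move=> j vj; apply: vlt vj vx.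
  move=> x y [Mx ax] vy xy; have [l] := Mgt i.+1 x y im Mx vy xy.
  rewrite leq_eqVlt => /orP[/eqP->//|]; rewrite ltnS leq_eqVlt => /orP[/eqP->|li] vx.
    by have := ax _ vx; rewrite ltnn.
  by have := lt l i; rewrite li ltnS ltnW// => /(_ isT _ _ vx vz); have := ax _ vz; lia.
exists M; split=> //; apply: avg_succ (sb) _ _ => [|i]; last by rewrite ltnS; exact: vh.
split; first by apply: (vM 0%N) => //; case: vm.
move=> j Mj; have [//|jm] := leqP m j.
have [//|l] := Mgt 0%N j m _ Mj vm.1 (ltnW jm).
by rewrite leqn0 => /eqP -> vj; have := vm.2 _ vj; rewrite leqNgt jm.
Qed.

Lemma avgN_lim a m v : is_limit a -> N0 m -> (0 < m)%N ->
  avgN (assoc a m) v -> (forall i, supp v i -> (m < i)%N) ->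
  avgN a (normalize f (fun j => m.+1%:R^-1 * unit_vector R k m j + v j)).
Proof.
move=> la Nm m0 [L [Li LN h]] mv.
have [fv [y vy] [vL nv] Linit _] := avg_facts h Li LN.
(* A point of [L] at or below the support would be in the support, by exhaustion, and the support
   lies above m. *)
have mL x : L x -> (m < x)%N.
  move=> Lx; have [xy|yx] := leqP x y; last by have := mv _ vy; lia.
  have [l [w [+ hw wx]]] := Linit x y Lx vy xy.
  by rewrite leqn0 => /eqP l0; rewrite l0 in hw; apply: mv; rewrite -(avg_uniq hw h).
exists (m |` L); split.
- by move=> H; apply: Li; apply: sub_finite_set H => x; right.
- by move=> x [->|/LN].
apply: avg_lim => //; first by split=> [|j [->//|/mL/ltnW//]]; left.
have -> // : (m |` L) `\ m = L.
apply/seteqP; split=> x; first by move=> [[->|//] []].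
by move=> Lx; split; [right|move=> /= E; have := mL _ Lx; rewrite E ltnn].
Qed.

End Averages.

(** * Averages built from averages of lower order *)

Section OrdinalFacts.
Variable W : omega1.
Implicit Types a b c : W.

Definition leo a b := a = b \/ olt a b.

Lemma leo_trans a b c : leo a b -> leo b c -> leo a c.
Proof.
by case=> [->//|ab] [<-|bc]; right=> //; exact: olt_trans bc.
Qed.

Lemma leo_succ a b c : is_succ b a -> olt c a -> leo c b.
Proof.
by move=> [ba H] ca; have [|[|bc]] := olt_total c b; [right|left|case: (H c ca)].
Qed.

(** A largest element would make the whole of [W] countable. *)
Lemma succ_exists b : exists a, is_succ b a.
Proof.
have [z bz zmin] : exists2 z, olt b z & forall x, olt b x -> ~ olt x z.
  apply: (@wf_min W [set x | olt b x]); apply: contrapT => H.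
  have bmax c : leo c b.
    by have [|[|bc]] := olt_total c b; [right|left|case: H; exists c].
  have /countable_injP[g ginj] := olt_countable b.
  apply: (@ord_uncountable W); apply/countable_injP.
  exists (fun c => if `[< c = b >] then 0%N else (g c).+1) => c d _ _.
  case: asboolP => [->|cb]; case: asboolP => [->//|db] // -[]; apply: ginj;
    rewrite inE /=; [by case: (bmax c)|by case: (bmax d)].
by exists z; split=> // c cz bc; exact: zmin bc cz.
Qed.

(** Otherwise countably many countable initial segments would cover [W]. *)
Lemma countable_bound (b : nat -> W) : exists a, forall n, leo (b n) a.
Proof.
apply: contrapT => H; apply: (@ord_uncountable W).
apply: (@sub_countable _ _ _ (\bigcup_n [set c | olt c (b n)])); last first.
  by apply: bigcup_countable => // n _; exact: olt_countable.
apply: subset_card_le => c _; apply: contrapT => Hc; apply: H; exists c => n.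
have [|[|cb]] := olt_total (b n) c; [by right|by left|].
by case: Hc; exists n.
Qed.

Lemma limit_assoc (assoc : W -> nat -> W) a b : associated_sequences assoc ->
  is_limit a -> olt b a -> exists n, forall m, (n <= m)%N ->
    leo b (assoc a m) /\ olt (assoc a m) a.
Proof.
move=> [_ H] la ba; have [s [s1 s2 s3 s4]] := H a la.
have [n bn] := s4 b ba; exists n => m nm; split; last exact: olt_trans (s1 m).1 (s3 m).
apply: (leo_succ (s1 m)); move: nm; rewrite leq_eqVlt => /orP[/eqP<-//|/s2].
exact: olt_trans.
Qed.

End OrdinalFacts.

Section Built.
Variables (R : realType) (k : scalar_kind) (K : Type).
Local Notation F := (scalars R k).
Variable f : nat -> K -> F.
Hypothesis fnorm : forall n, supnorm (f n) = 1.
Variables (W : omega1) (assoc : W -> nat -> W).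
Hypothesis Hassoc : associated_sequences assoc.
Variable N0 : set nat.
Hypothesis N0_infinite : infinite_set N0.
Hypothesis N0_coef : forall u : nat -> F, fin u -> supp u `<=` N0 ->
  forall j, modulus (u j) <= 4 * nrm f u.
Hypothesis N0_segm : forall u : nat -> F, fin u -> supp u `<=` N0 ->
  forall a b, nrm f (segm a b u) <= 4 * nrm f u.
Implicit Types (u v : nat -> F).
Local Notation avgN := (avgN f assoc N0).

Definition beyond n v := forall i, supp v i -> (n < i)%N.

(** The recursion restarted at order [xi], with members of [A] as its starting vectors. The vector
    inserted at a limit order comes from [N0] and not from [A]; it is the source of the remainder
    [rho] in [rep]. *)
Inductive built (xi : W) (A : set (nat -> F)) : W -> (nat -> F) -> Prop :=
| built_base v : A v -> built xi A xi v
| built_succ a b m (v : nat -> nat -> F) : is_succ b a ->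
    (forall i, (i <= m)%N -> built xi A b (v i)) ->
    (forall i, (i < m)%N -> block_lt (v i) (v i.+1)) ->
    is_min (supp (v 0%N)) m ->
    built xi A a (normalize f (fun j => \sum_(i < m.+1) v i j))
| built_lim a m v : is_limit a -> N0 m -> (0 < m)%N ->
    built xi A (assoc a m) v -> beyond m v ->
    built xi A a (normalize f (fun j => m.+1%:R^-1 * unit_vector R k m j + v j)).

Lemma built_avgN xi A b v : A `<=` avgN xi -> built xi A b v -> avgN b v.
Proof.
move=> AN; elim=> {b v} [v /AN//|a b m v sb _ IH vlt vm|a m v la Nm m0 _ IH mv].
  exact: (avgN_succ fnorm N0_infinite N0_coef sb IH vlt vm).
exact: (avgN_lim fnorm N0_coef la Nm m0 IH mv).
Qed.

Lemma built_mono xi A A' b v : A `<=` A' -> built xi A b v -> built xi A' b v.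
Proof.
move=> AA'; elim=> {b v} [v /AA'|a b m v sb _ IH vlt vm|a m v la Nm m0 _ IH mv].
- exact: built_base.
- exact: built_succ sb IH vlt vm.
- exact: built_lim.
Qed.

Lemma built_trans xi xi' A A' b v : built xi' A' b v ->
  (forall u, A' u -> built xi A xi' u) -> built xi A b v.
Proof.
move=> h H; elim: h => {b v} [v /H//|a b m v sb _ IH vlt vm|a m v la Nm m0 _ IH mv].
- exact: built_succ sb IH vlt vm.
- exact: built_lim.
Qed.

Lemma succ_block b m (v : nat -> nat -> F) (s := fun j => \sum_(i < m.+1) v i j) :
  (forall i, (i <= m)%N -> avgN b (v i)) ->
  (forall i, (i < m)%N -> block_lt (v i) (v i.+1)) ->
  [/\ fin s, supp s !=set0, supp s `<=` N0 &
      forall x, supp s x <-> exists2 i, (i <= m)%N & supp (v i) x].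
Proof.
move=> va vlt.
have H i im := avgN_facts fnorm N0_coef (va i im).
have v0 i : (i < m.+1)%N -> supp (v i) !=set0 by move=> /H[].
have sP := @supp_sum R k m.+1 v vlt v0; split=> //.
- by apply: fin_sum => j /H[].
- by have [x vx] := v0 0%N isT; exists x; apply/sP; exists 0%N.
- by move=> y /sP[j /H[_ _ + _]]; apply.
Qed.

Lemma lim_block m v (s := fun j => m.+1%:R^-1 * unit_vector R k m j + v j) :
  N0 m -> fin v -> supp v `<=` N0 -> beyond m v ->
  [/\ fin s, supp s !=set0, supp s `<=` N0 & forall x, supp s x <-> x = m \/ supp v x].
Proof.
move=> Nm fv vN mv.
have sP x : supp s x <-> x = m \/ supp v x.
  rewrite /supp/= /s /unit_vector; have [->|xm] /= := eqVneq x m.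
    split=> _; first by left.
    suff -> : v m = 0 by rewrite addr0 mulr1 invr_eq0 pnatr_eq0.
    by apply/eqP; rewrite -[_ == _]negbK; apply/negP => /mv; rewrite ltnn.
  rewrite mulr0 add0r; split; first by right.
  by case=> // E; rewrite E eqxx in xm.
split=> //.
- by apply: finD fv; apply: finZ; exact: fin_unit.
- by exists m; apply/sP; left.
- by move=> x /sP[->//|/vN].
Qed.

(** Supports only grow along the construction, so every member of [A] that enters lies inside the
    final support. A late average is thus built from late terms, which makes [refines]
    transitive. *)
Lemma built_restrict xi A b v : A `<=` avgN xi -> built xi A b v ->
  built xi [set u | A u /\ supp u `<=` supp v] b v.
Proof.
move=> AN; elim=> {b v} [v Av|a b m v sb h IH vlt vm|a m v la Nm m0 h IH mv].
- by apply: built_base; split.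
- have va i : (i <= m)%N -> avgN b (v i) by move=> /h/(built_avgN AN).
  have [fs s0 sN sP] := succ_block va vlt.
  apply: (built_succ sb _ vlt vm) => i im; apply: built_mono (IH i im).
  move=> u [Au uv]; split=> // x /uv vx; rewrite (@supp_normalize _ _ _ _ N0)//.
  by apply/sP; exists i.
- have [fv v0 vN _] := avgN_facts fnorm N0_coef (built_avgN AN h).
  have [fs s0 sN sP] := lim_block Nm fv vN mv.
  apply: built_lim => //; apply: built_mono IH => u [Au uv]; split=> // x /uv vx.
  by rewrite (@supp_normalize _ _ _ _ N0)//; apply/sP; right.
Qed.

Lemma N0_large n : exists2 m, N0 m & (n < m)%N.
Proof.
apply: contrapT => H; apply: N0_infinite; apply: sub_finite_set (finite_II n.+1) => x Nx /=.
by rewrite ltnS leqNgt; apply/negP => nx; apply: H; exists x.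
Qed.

Lemma built_exists xi A b : A `<=` avgN xi ->
  (forall n, exists2 u, A u & beyond n u) -> leo xi b ->
  forall n, exists2 v, built xi A b v & beyond n v.
Proof.
move=> AN Aunb; move: b; apply: (well_founded_ind (@olt_wf W)) => b IH [<-|xb] n.
  by have [u Au un] := Aunb n; exists u => //; exact: built_base.
have [zb|[[c sc]|lb]] := zero_succ_or_limit b; first by case: (zb xi).
  have {}IH := IH c sc.1 (leo_succ sc xb).
  have IH' p : exists v, built xi A c v /\ beyond p v by have [v] := IH p; exists v.
  have [nx nxP] := boolp.choice IH'.
  have nxb p : exists N, bounded_by N (nx p).
    by have [] := avgN_facts fnorm N0_coef (built_avgN AN (nxP p).1).
  have [bd bdP] := boolp.choice nxb.
  pose q := fix q i := if i is j.+1 then bd (q j) else n.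
  pose v i := nx (q i).
  have vlt i : block_lt (v i) (v i.+1).
    move=> x y vx; move: (bdP (q i)) => /bounded_byP/(_ _ vx) xb' vy.
    by have := (nxP (q i.+1)).2 _ vy; rewrite /=; lia.
  have vb i : built xi A c (v i) by exact: (nxP _).1.
  have [_ v0 _ _] := avgN_facts fnorm N0_coef (built_avgN AN (vb 0%N)).
  have [m mP] := min_ex v0.
  have h := built_succ sc (fun i (_ : (i <= m)%N) => vb i) (fun i _ => vlt i) mP.
  eexists; first exact: h.
  have H i := avgN_facts fnorm N0_coef (built_avgN AN (vb i)).
  have [fs s0 sN sP] := succ_block (fun i (_ : (i <= m)%N) => built_avgN AN (vb i))
    (fun i _ => vlt i).
  have bey i : beyond n (v i).
    elim: i => [|i IHi]; first exact: (nxP n).2.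
    move=> x vx; have [_ [y vy] _ _] := H i.
    by have := IHi _ vy; have := vlt i _ _ vy vx; lia.
  rewrite /beyond (@supp_normalize _ _ _ _ N0)//.
  by move=> x /sP[i _ /bey].
(* For large m the order [assoc b m] is at or above [xi], so that the induction hypothesis applies
   to it. *)
have [n0 n0P] := limit_assoc Hassoc lb xb.
have [m Nm] := N0_large (maxn n n0); rewrite gtn_max => /andP[nm n0m].
have [xm mb] := n0P m (ltnW n0m).
have [v vb vm] := IH _ mb xm m.
have m0 : (0 < m)%N by lia.
have [fv v0 vN _] := avgN_facts fnorm N0_coef (built_avgN AN vb).
have h := built_lim lb Nm m0 vb vm; eexists; first exact: h.
have [fs s0 sN sP] := lim_block Nm fv vN vm.
rewrite /beyond (@supp_normalize _ _ _ _ N0)// => y /sP[->//|/vm]; lia.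
Qed.

End Built.

(** * Coefficients of built averages *)

Section Representation.
Variables (R : realType) (k : scalar_kind) (K : Type).
Local Notation F := (scalars R k).
Variable f : nat -> K -> F.
Hypothesis fnorm : forall n, supnorm (f n) = 1.
Variable N0 : set nat.
Hypothesis N0_coef : forall u : nat -> F, fin u -> supp u `<=` N0 ->
  forall j, modulus (u j) <= 4 * nrm f u.
Hypothesis N0_segm : forall u : nat -> F, fin u -> supp u `<=` N0 ->
  forall a b, nrm f (segm a b u) <= 4 * nrm f u.
Implicit Types (u v : nat -> F) (lam rho : nat -> R) (s : seq nat).

Definition unit_block v := [/\ fin v, supp v !=set0, supp v `<=` N0 & nrm f v = 1].

Variable w : nat -> nat -> F.
Hypothesis w_unit : forall i, unit_block (w i).

(* The clauses on [segm] are homogeneous in v, so that they survive the successive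
   normalizations; the projections on segments then bound the coefficients. *)
Definition rep v s lam rho :=
  [/\ v = (fun n => \sum_(i <- s) of_real k (lam i) * w i n + of_real k (rho n)),
      forall i, i \in s -> 0 < lam i /\
        exists a b, segm a b v = fun n => of_real k (lam i) * w i n,
      forall i, i \notin s -> lam i = 0,
      forall n, [/\ 0 <= rho n, rho n != 0 -> supp v n &
        exists a b, rho n * n.+1%:R <= nrm f (segm a b v)]
    & uniq s].

Lemma segm_all v N a : bounded_by N v -> (forall n, (n < a)%N -> v n = 0) -> segm a N v = v.
Proof.
move=> vN va; apply/funext => n; rewrite /segm; case: ifP => // /negbT.
by rewrite negb_and -leqNgt -ltnNge => /orP[/va|/vN] ->.
Qed.

Lemma segmZ c a b v : segm a b (fun n => c * v n) = fun n => c * segm a b v n.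
Proof. by apply/funext => n; rewrite /segm; case: ifP; rewrite ?mulr0. Qed.

Lemma segm0_nrm v : nrm f (segm 0 0 v) = 0.
Proof.
apply/eqP; rewrite eq_le; apply/andP; split; last first.
  exact: (nrm_ge0 fnorm (fin_segm _ _ _)).
apply: nrm_le => // t; rewrite (@lincombE _ _ _ _ 0) ?big_ord0 ?modulus0//.
Qed.

Lemma rep_base i : rep (w i) [:: i] (fun j => (j == i)%:R) (fun=> 0).
Proof.
split=> //.
- by apply/funext => n; rewrite big_seq1 eqxx rmorph0 rmorph1 mul1r addr0.
- move=> j; rewrite inE => /eqP ->; rewrite eqxx; split=> //.
  have [[N wN] _ _ _] := w_unit i; exists 0%N, N; rewrite segm_all//.
  by apply/funext => n; rewrite rmorph1 mul1r.
- by move=> j; rewrite inE => /negbTE ->.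
- move=> n; split=> //; first by rewrite eqxx.
  by exists 0%N, 0%N; rewrite segm0_nrm mul0r.
Qed.

Lemma rep_scale c v s lam rho : 0 < c -> fin v -> rep v s lam rho ->
  rep (fun n => of_real k c * v n) s (fun i => c * lam i) (fun n => c * rho n).
Proof.
move=> c0 fv [vE ls l0 rP us].
have cF : of_real k c != 0 by rewrite fmorph_eq0 gt_eqF.
split=> //.
- apply/funext => n; rewrite {1}vE mulrDr mulr_sumr rmorphM; congr (_ + _).
  by apply: eq_bigr => i _; rewrite rmorphM mulrA.
- move=> i /ls[li [a [b E]]]; split; first exact: mulr_gt0.
  by exists a, b; rewrite segmZ E; apply/funext => n; rewrite rmorphM mulrA.
- by move=> i /l0 ->; rewrite mulr0.
- move=> n; have [r0 rs [a [b E]]] := rP n; split.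
  + by rewrite mulr_ge0// ltW.
  + by rewrite mulf_eq0 gt_eqF//= => /rs; rewrite supp_scale.
  + exists a, b; rewrite segmZ nrmZ; last exact: fin_segm; last by [].
    by rewrite modulus_real gtr0_norm// -mulrA ler_wpM2l// ltW.
Qed.

Lemma separate u v : fin u -> block_lt u v ->
  exists N, bounded_by N u /\ forall n, (n < N)%N -> v n = 0.
Proof.
move=> fu uv; have [[x vx]|v0] := pselect (supp v !=set0); last first.
  have [N uN] := fu; exists N; split=> // n _; apply/eqP; rewrite -[_ == _]negbK.
  by apply/negP => vn; apply: v0; exists n.
have [N [vN Nmin]] := min_ex (ex_intro _ x vx); exists N; split.
  by apply/bounded_byP => i ui; exact: uv.
move=> n nN; apply/eqP; rewrite -[_ == _]negbK; apply/negP => /Nmin.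
by rewrite leqNgt nN.
Qed.

Lemma rep_supp v s lam rho i : rep v s lam rho -> i \in s -> supp (w i) `<=` supp v.
Proof.
move=> [_ ls _ _ _] /ls[li [a [b E]]] n wn.
have : segm a b v n != 0 by rewrite E mulf_neq0// fmorph_eq0 gt_eqF.
by rewrite /segm; case: ifP => //; rewrite eqxx.
Qed.

Lemma rep_add u v s s' lam lam' rho rho' : fin u -> block_lt u v ->
  rep u s lam rho -> rep v s' lam' rho' ->
  rep (fun n => u n + v n) (s ++ s') (fun i => lam i + lam' i) (fun n => rho n + rho' n).
Proof.
move=> fu uv ru rv.
have disj i : i \in s -> i \in s' -> False.
  move=> /(rep_supp ru) h1 /(rep_supp rv) h2; have [_ [x wx] _ _] := w_unit i.
  by have := uv _ _ (h1 _ wx) (h2 _ wx); rewrite ltnn.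
have [N [uN vN]] := separate fu uv.
move: ru rv => [uE ls l0 rP us] [vE ls' l0' rP' us'].
(* Cutting at N separates the two supports, so that a segment of either summand is a segment of the
   sum. *)
have segl a b : segm a (minn b N) (fun n => u n + v n) = segm a b u.
  apply/funext => n; rewrite /segm leq_min; case: (ltnP n N) => nN.
    by rewrite andbT (vN _ nN) addr0.
  by rewrite (uN _ nN) !andbF if_same.
have segr a b : segm (maxn a N) b (fun n => u n + v n) = segm a b v.
  apply/funext => n; rewrite /segm geq_max; case: (leqP N n) => nN.
    by rewrite andbT (uN _ nN) add0r.
  by rewrite (vN _ nN) andbF /= if_same.
split.
- apply/funext => n; rewrite big_cat/= {1}uE {1}vE rmorphD addrACA; congr (_ + _ + _).
    rewrite big_seq [RHS]big_seq; apply: eq_bigr => i si.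
    by rewrite (l0' i) ?addr0//; apply/negP => /(disj i si).
  rewrite big_seq [RHS]big_seq; apply: eq_bigr => i si.
  by rewrite (l0 i) ?add0r//; apply/negP => /disj/(_ si).
- move=> i; rewrite mem_cat => /orP[si|si].
    have -> : lam' i = 0 by apply: l0'; apply/negP => /(disj i si).
    rewrite addr0; have [li [a [b E]]] := ls _ si; split=> //.
    by exists a, (minn b N); rewrite segl.
  have -> : lam i = 0 by apply: l0; apply/negP => /disj/(_ si).
  rewrite add0r; have [li [a [b E]]] := ls' _ si; split=> //.
  by exists (maxn a N), b; rewrite segr.
- by move=> i; rewrite mem_cat negb_or => /andP[/l0 -> /l0' ->]; rewrite addr0.
- move=> n; have [r0 rs [a [b E]]] := rP n; have [r0' rs' [a' [b' E']]] := rP' n.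
  have [nN|nN] := ltnP n N.
    have v0 := vN _ nN; have -> : rho' n = 0.
      by apply/eqP; rewrite -[_ == _]negbK; apply/negP => /rs'; rewrite /supp/= v0 eqxx.
    rewrite addr0; split=> //; first by rewrite /supp/= v0 addr0.
    by exists a, (minn b N); rewrite segl.
  have u0 := uN _ nN; have -> : rho n = 0.
    by apply/eqP; rewrite -[_ == _]negbK; apply/negP => /rs; rewrite /supp/= u0 eqxx.
  rewrite add0r; split=> //; first by rewrite /supp/= u0 add0r.
  by exists (maxn a' N), b'; rewrite segr.
- rewrite cat_uniq us us' andbT /=; apply/hasPn => i si'; apply/negP => si.
  exact: (disj i).
Qed.

Lemma rep_single m v s lam rho : fin v -> nrm f v = 1 -> beyond m v ->
  rep v s lam rho ->
  rep (fun n => m.+1%:R^-1 * unit_vector R k m n + v n) s lam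
      (fun n => (n == m)%:R / m.+1%:R + rho n).
Proof.
move=> [N vN] nv mv [vE ls l0 rP us].
have vm n : (n <= m)%N -> v n = 0.
  move=> nm; apply/eqP; rewrite -[_ == _]negbK; apply/negP => /mv; by rewrite ltnNge nm.
have seg a b : segm (maxn a m.+1) b (fun n => m.+1%:R^-1 * unit_vector R k m n + v n) =
    segm a b v.
  apply/funext => n; rewrite /segm geq_max /unit_vector; case: (leqP n m) => nm.
    by rewrite (vm _ nm) andbF /= if_same.
  by rewrite andbT gtn_eqF// mulr0 add0r.
have rm : rho m = 0.
  have [_ rs _] := rP m; apply/eqP; rewrite -[_ == _]negbK; apply/negP => /rs.
  by rewrite /supp/= vm ?eqxx.
split=> //.
- apply/funext => n; rewrite {1}vE addrCA rmorphD; congr (_ + (_ + _)).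
  by rewrite rmorphM fmorphV !rmorph_nat mulrC.
- move=> i /ls[li [a [b E]]]; split=> //.
  by exists (maxn a m.+1), b; rewrite seg.
- move=> n; have [r0 rs [a [b E]]] := rP n; have [->|nm] := eqVneq n m.
    rewrite rm addr0 mul1r; split; first by rewrite invr_ge0.
      by rewrite /supp/= vm// addr0 /unit_vector eqxx mulr1 invr_eq0 pnatr_eq0.
    (* At m the remainder times its label is 1, the norm of [v], and [v] is the segment of the sum
       beyond m. *)
    exists (maxn 0 m.+1), N; rewrite seg segm_all// ?nv ?mulVf//.
  rewrite mul0r add0r; split=> //.
    by rewrite /supp/= /unit_vector (negbTE nm) mulr0 add0r.
  by exists (maxn a m.+1), b; rewrite seg.
Qed.

(** The vector [lam i * w i] is a segment of the unit vector [v], and segments have norm at most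
    4. *)
Lemma rep_lam_le v s lam rho i : unit_block v -> rep v s lam rho -> lam i <= 4.
Proof.
move=> [fv v0 vN nv] [_ ls l0 _ _]; have [/ls[li [a [b E]]]|/l0->//] := boolP (i \in s).
have := N0_segm fv vN a b; rewrite E nv mulr1; have [fw _ _ nw] := w_unit i.
by rewrite nrmZ// nw mulr1 modulus_real gtr0_norm.
Qed.

(** Up to the factor 4, these reciprocals of labels bound the remainders left by limit orders; the
    sparseness of [N0] keeps their total at most 2. *)
Definition weight n : R := if `[< N0 n >] then n.+1%:R^-1 else 0.

Lemma weight_ge0 n : 0 <= weight n.
Proof. by rewrite /weight; case: ifP => // _; rewrite invr_ge0. Qed.

Lemma rep_rho_le v s lam rho n : unit_block v -> rep v s lam rho ->
  rho n <= 4 * ((v n != 0)%:R * weight n).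
Proof.
move=> [fv v0 vN nv] [_ _ _ rP _]; have [r0 rs [a [b E]]] := rP n.
have [->|rn] := eqVneq (rho n) 0; first by rewrite !mulr_ge0// weight_ge0.
have vn := rs rn; rewrite [v n != 0]vn mul1r /weight; case: asboolP => [_|]; last first.
  by case; exact: vN.
rewrite ler_pdivlMr//; apply: le_trans E _.
by have := N0_segm fv vN a b; rewrite nv mulr1.
Qed.

Lemma lincomb_sumw s (c : nat -> F) t :
  lincomb f (fun n => \sum_(i <- s) c i * w i n) t = \sum_(i <- s) c i * lincomb f (w i) t.
Proof.
elim: s => [|i s IH].
  rewrite big_nil (@lincombE _ _ _ _ 0) ?big_ord0// => n _; exact: big_nil.
have -> : (fun n => \sum_(j <- i :: s) c j * w j n) =
    (fun n => c i * w i n) \+ (fun n => \sum_(j <- s) c j * w j n).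
  by apply/funext => n; rewrite big_cons.
have [fw _ _ _] := w_unit i.
have fs : fin (fun n => \sum_(j <- s) c j * w j n).
  elim: s {IH} => [|j s IH]; first by exists 0%N => n _; exact: big_nil.
  have [[N wN] _ _ _] := w_unit j; have [N' N'P] := IH; exists (maxn N N') => n.
  by rewrite geq_max => /andP[Nn N'n]; rewrite big_cons wN// mulr0 add0r N'P.
rewrite lincombD//; last exact: finZ.
by rewrite lincombZ// IH big_cons.
Qed.

Lemma rep_fin_rho v s lam rho N : bounded_by N v -> rep v s lam rho ->
  bounded_by N (fun n => of_real k (rho n)).
Proof.
move=> vN [_ _ _ rP _] n Nn; have [_ rs _] := rP n.
suff -> : rho n = 0 by rewrite rmorph0.
by apply/eqP; rewrite -[_ == _]negbK; apply/negP => /rs; rewrite /supp/= vN ?eqxx.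
Qed.

Lemma rep_lincomb v s lam rho t : fin v -> rep v s lam rho ->
  lincomb f v t = \sum_(i <- s) of_real k (lam i) * lincomb f (w i) t
    + lincomb f (fun n => of_real k (rho n)) t.
Proof.
move=> [N vN] rv; have fr := rep_fin_rho vN rv.
have fr' : fin (fun n => of_real k (rho n)) by exists N.
case: (rv) => vE _ _ _ _.
rewrite {1}vE -lincomb_sumw -lincombD//.
exists N => n Nn; have := vN n Nn; rewrite {1}vE (fr n Nn) addr0//.
Qed.

Definition tail_weight N v := \sum_(n < N) (v n != 0)%:R * weight n.

Lemma rep_rho_lincomb v s lam rho t N : unit_block v -> bounded_by N v ->
  rep v s lam rho ->
  modulus (lincomb f (fun n => of_real k (rho n)) t) <= 4 * tail_weight N v.
Proof.
move=> uv vN rv; apply: le_trans (lincomb_le f t (rep_fin_rho vN rv)) _.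
rewrite /tail_weight mulr_sumr; apply: ler_sum => i _.
have r0 : 0 <= rho i by case: rv => _ _ _ /(_ i)[].
rewrite modulus_real ger0_norm//; apply: le_trans (rep_rho_le i uv rv).
by rewrite ler_piMr// modulus_f_le1.
Qed.

Lemma rep_le v s lam rho t N eta : unit_block v -> bounded_by N v ->
  rep v s lam rho -> (forall i, lam i <= eta) ->
  modulus (lincomb f v t) <=
    eta * \sum_(i <- s) modulus (lincomb f (w i) t) + 4 * tail_weight N v.
Proof.
move=> uv vN rv le; have fv : fin v by case: uv.
rewrite (rep_lincomb t fv rv); apply: le_trans (modulusD _ _) (lerD _ (rep_rho_lincomb t uv vN rv)).
apply: le_trans (modulus_sum _ _ _) _; rewrite mulr_sumr big_seq [leRHS]big_seq.
apply: ler_sum => i si; rewrite modulusM modulus_real ler_wpM2r ?modulus_ge0//.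
by case: rv => _ /(_ i si)[li _] _ _ _; rewrite gtr0_norm.
Qed.

End Representation.

(** * Ultrafilter-branching bars *)

Lemma nonprincipal_ultrafilter : exists2 U : set_system nat,
  UltraFilter U & forall n, U [set j | (n < j)%N].
Proof.
have [U [UU sub]] := @ultraFilterLemma nat \oo _.
by exists U => // n; apply: sub; exists n.+1.
Qed.

Section Bar.
Variable U : set_system nat.
Context {UU : UltraFilter U}.
Hypothesis U_tail : forall n, U [set j | (n < j)%N].
Implicit Types (P Q : seq nat -> Prop) (s : seq nat) (A : set nat).

Lemma ultra_or A B : U (A `|` B) -> U A \/ U B.
Proof.
move=> UAB; have [|nA] := pselect (U A); [by left|right].
(* The sets that belong to [U] after [A] is added form a filter, proper since [A] is not in [U]. By
   maximality it equals [U], and [B] is one of its members. *)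
pose G : set_system nat := [set C | U (C `|` A)].
have UG : U `<=` G by move=> C UC; apply: filterS UC => x; left.
have PG : ProperFilter G.
  split; first by rewrite /G /= set0U.
  split; first exact: (UG _ filterT).
  - move=> C D GC GD; have {GC GD} h : U ((C `|` A) `&` (D `|` A)) by exact: filterI.
    rewrite /G /=; apply: filterS h => x.
    by move=> [[Cx|Ax] [Dx|Ax']]; [left|right|right|right].
  - move=> C D CD GC; have {GC} h : U (C `|` A) by [].
    by rewrite /G /=; apply: filterS h => x [/CD|]; [left|right].
rewrite -(max_filter PG UG) /G /=; apply: filterS UAB => x [Ax|Bx]; by [right|left].
Qed.

Lemma ultra_fin L (X : nat -> set nat) :
  U [set j | exists2 l, (l < L)%N & X l j] -> exists2 l, (l < L)%N & U (X l).
Proof.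
elim: L => [H|L IH H].
  have /filter_ex [j [l]] // := H.
have : U ([set j | exists2 l, (l < L)%N & X l j] `|` X L).
  apply: filterS H => j [l]; rewrite ltnS leq_eqVlt => /orP[/eqP->|lL]; first by right.
  by left; exists l.
by case/ultra_or => [/IH[l lL]|UX]; [exists l => //; lia|exists L].
Qed.

(** A well-founded tree of finite sequences: each inner node branches over a set of [U], and [P]
    holds at the leaves. The inductive form replaces an ordinal rank. *)
Inductive bar P : seq nat -> Prop :=
| bar_now s : P s -> bar P s
| bar_later s A : U A -> (forall j, A j -> bar P (rcons s j)) -> bar P s.

Lemma bar_bind P Q s : bar P s -> (forall s', P s' -> bar Q s') -> bar Q s.
Proof.
by move=> h H; elim: h => {s} [s /H//|s A UA _ IH]; exact: bar_later UA IH.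
Qed.

Lemma bar_mono P Q s : (forall s', P s' -> Q s') -> bar P s -> bar Q s.
Proof. by move=> PQ h; apply: bar_bind h _ => s' /PQ; exact: bar_now. Qed.

Lemma bar_shift P s0 s : bar (fun s' => P (s0 ++ s')) s -> bar P (s0 ++ s).
Proof.
elim=> {s} [s|s A UA _ IH]; first exact: bar_now.
by apply: bar_later UA _ => j /IH; rewrite rcons_cat.
Qed.

Lemma bar_seq P Q : bar P [::] ->
  (forall s, P s -> bar (fun s' => Q (s ++ s')) [::]) -> bar Q [::].
Proof.
by move=> h H; apply: bar_bind h _ => s /H/bar_shift; rewrite cats0.
Qed.

(** A finite colouring of the leaves becomes constant after shrinking the branching sets: from the
    leaves down, one colour occurs for [U]-almost all successors of a node. *)
Lemma bar_fin L (Q : nat -> seq nat -> Prop) s :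
  bar (fun s => exists2 l, (l < L)%N & Q l s) s -> exists2 l, (l < L)%N & bar (Q l) s.
Proof.
elim=> {s} [s [l lL h]|s A UA _ IH]; first by exists l => //; exact: bar_now.
have : U [set j | exists2 l, (l < L)%N & [set i | bar (Q l) (rcons s i)] j].
  by apply: filterS UA => j /IH.
by move/ultra_fin => [l lL h]; exists l => //; exact: bar_later h _.
Qed.

Lemma bar_prefix P s : bar P s -> bar (fun s' => P s' /\ prefix s s') s.
Proof.
elim=> {s} [s Ps|s A UA _ IH]; first by apply: bar_now; split=> //; exact: prefix_refl.
apply: bar_later UA _ => j /IH; apply: bar_mono => s' [Ps' h]; split=> //.
by apply: prefix_trans h; exact: prefix_rcons.
Qed.

(** Since the root is not a leaf, its branching set can be intersected with [A]. *)
Lemma bar_head P A : bar P [::] -> ~ P [::] -> U A ->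
  bar (fun s => P s /\ exists j s', s = j :: s' /\ A j) [::].
Proof.
move=> h nP UA; case: {-1}[::] / h (erefl ([::] : seq nat)) => [s Ps E|s B UB H E].
  by rewrite E in nP.
subst s; apply: bar_later (filterI UA UB) _ => j [Aj /H/bar_prefix].
apply: bar_mono => s [Ps /prefixP[s' E]]; split=> //.
by exists j, s'; rewrite E.
Qed.

(** The tree is traded for a map from finite sequences to sets of [U], so that a diagonal argument
    can meet finitely many of these sets at once. Sequences outside the tree get the full set. *)
Lemma bar_branch P s : bar P s -> exists2 A : seq nat -> set nat, forall s', U (A s') &
  forall J : nat -> nat, (forall n, A (mkseq J n) (J n)) -> exists n, P (s ++ mkseq J n).
Proof.
elim=> {s} [s Ps|s A UA _ IH].
  by exists (fun=> setT) => [s'|J _]; [exact: filterT|exists 0%N; rewrite cats0].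
have IH' j : exists B : seq nat -> set nat, (forall s', U (B s')) /\ (A j ->
  forall J : nat -> nat, (forall n, B (mkseq J n) (J n)) -> exists n, P (rcons s j ++ mkseq J n)).
  have [Aj|nA] := pselect (A j); first by have [B h1 h2] := IH j Aj; exists B.
  by exists (fun=> setT); split=> // s'; exact: filterT.
have [B BP] := boolp.choice IH'.
exists (fun s' => if s' is j :: s'' then B j s'' else A) => [[|j s']//|J JP].
  exact: (BP j).1.
have A0 : A (J 0%N) := JP 0%N.
have mkE n : mkseq J n.+1 = J 0%N :: mkseq (J \o succn) n.
  by rewrite /mkseq/= -[1%N]addn0 iotaDl -map_comp.
have [|n Pn] := (BP _).2 A0 (J \o succn).
  by move=> n; have [E] := mkE n; have := JP n.+1; rewrite -E.
by exists n.+1; rewrite mkE -cat_rcons.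
Qed.

Fixpoint sublists s : seq (seq nat) :=
  if s is x :: s' then sublists s' ++ map (cons x) (sublists s') else [:: [::]].

Lemma mem_sublists s s' : subseq s' s -> s' \in sublists s.
Proof.
elim: s s' => [|x s IH] [|y s'] //=; rewrite mem_cat.
  by move=> _; rewrite IH ?sub0seq.
case: eqP => [->|_] h; last by rewrite IH.
by apply/orP; right; apply/mapP; exists s' => //; exact: IH.
Qed.

Lemma subseq_mkseq (h g : nat -> nat) n : (forall i j, (i < j)%N -> (g i < g j)%N) ->
  subseq (mkseq (h \o g) n) (mkseq h (g n)).
Proof.
move=> gm; have mono m p : (m <= p)%N -> subseq (mkseq h m) (mkseq h p).
  move=> mp; rewrite /mkseq -(subnK mp) addnC iotaD map_cat; exact: prefix_subseq.
elim: n => [|n IH]; first exact: sub0seq.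
rewrite mkseqS; apply: subseq_trans (mono _ _ (gm n n.+1 (ltnSn n))).
by rewrite mkseqS -!cats1; apply: cat_subseq.
Qed.

(** Each new value of [h] is taken in the branching sets of all subsequences of the earlier values,
    which are finitely many. Hence every subsequence of [h] follows the tree down to a leaf. *)
Lemma bar_extract P : bar P [::] -> exists2 h : nat -> nat,
  forall i j, (i < j)%N -> (h i < h j)%N &
  forall g : nat -> nat, (forall i j, (i < j)%N -> (g i < g j)%N) ->
    exists n, P (mkseq (h \o g) n).
Proof.
move=> /bar_branch[A UA AP].
have Uall (S : seq (seq nat)) : U [set j | forall s, s \in S -> A s j].
  elim: S => [|s S IH]; first by apply: filterS (@filterT _ U _) => j _ s.
  apply: filterS (filterI (UA s) IH) => j [Aj H] s'.
  by rewrite inE => /orP[/eqP->//|/H].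
(* [sumn s] bounds every entry of [s], so the values chosen increase. *)
have H s : exists j, (sumn s < j)%N /\ forall s', subseq s' s -> A s' j.
  have [j [h1 h2]] := filter_ex (filterI (U_tail (sumn s)) (Uall (sublists s))).
  by exists j; split=> // s' /mem_sublists/h2.
have [nx nxP] := boolp.choice H.
pose hl := fix hl n := if n is m.+1 then rcons (hl m) (nx (hl m)) else [::].
pose h n := nx (hl n).
have hlE n : mkseq h n = hl n by elim: n => // n IH; rewrite mkseqS IH.
have hS n : (h n < h n.+1)%N.
  have h1 : (h n <= sumn (hl n.+1))%N by rewrite /= -cats1 sumn_cat /= addn0 leq_addl.
  exact: leq_ltn_trans h1 (nxP (hl n.+1)).1.
exists h.
  move=> i; elim=> // j IH; rewrite ltnS leq_eqVlt => /orP[/eqP->//|/IH lt].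
  exact: ltn_trans lt (hS j).
move=> g gm; have [|n] := AP (h \o g); last by exists n.
by move=> n; apply: (nxP (hl (g n))).2; rewrite -hlE; exact: subseq_mkseq.
Qed.

End Bar.

(** * Sums over disjoint supports *)

Lemma sum_subseq (R : numDomainType) (phi : nat -> R) (s s' : seq nat) :
  (forall i, 0 <= phi i) -> subseq s s' ->
  \sum_(i <- s) phi i <= \sum_(i <- s') phi i.
Proof.
move=> phi0; elim: s' s => [|y s' IH] [|x s] //=.
  by move=> _; rewrite big_nil sumr_ge0.
case: eqP => [->|_] /IH h; first by rewrite !big_cons lerD2l.
by rewrite [leRHS]big_cons; apply: le_trans h _; rewrite lerDr.
Qed.

Lemma sum_uniq_sub (R : numDomainType) (phi : nat -> R) (s s' : seq nat) :
  (forall i, 0 <= phi i) -> uniq s -> {subset s <= s'} ->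
  \sum_(i <- s) phi i <= \sum_(i <- s') phi i.
Proof.
move=> phi0; elim: s s' => [|x s IH] s' /=.
  by move=> _ _; rewrite big_nil sumr_ge0.
move=> /andP[xs us] sub; rewrite big_cons [leRHS](big_rem x)/=; last by apply: sub; rewrite mem_head.
rewrite lerD2l; apply: IH => // y ys.
have yx : y != x by apply: contraNneq xs => <-.
have : y \in s' by apply: sub; rewrite inE ys orbT.
rewrite (perm_mem (perm_to_rem (_ : x \in s'))); last by apply: sub; rewrite mem_head.
by rewrite inE (negbTE yx).
Qed.

(** After exchanging the sums, each [phi i] is counted at most once, and only if [lo <= i]. *)
Lemma disjoint_sum (R : numDomainType) (phi : nat -> R) (p : nat -> nat -> bool) m M lo B :
  (forall i, 0 <= phi i) ->
  (forall j j' i, p j i -> p j' i -> j = j') ->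
  (forall j i, (m <= j)%N -> p j i -> (lo <= i)%N) ->
  \sum_(m <= j < M) \sum_(i < B) (p j i)%:R * phi i <= \sum_(lo <= i < B) phi i.
Proof.
move=> phi0 pu plo.
have one i : \sum_(m <= j < M) (p j i)%:R <= (lo <= i)%N%:R :> R.
  have [[j0 mj0 pj0]|no] := pselect (exists2 j, (m <= j)%N & p j i); last first.
    rewrite big_nat_cond big1 ?ler0n// => j /andP[/andP[mj _] _].
    by case pj: (p j i) => //; case: no; exists j.
  rewrite (plo _ _ mj0 pj0).
  have -> : \sum_(m <= j < M) (p j i)%:R = \sum_(m <= j < M) (j == j0)%:R :> R.
    apply: eq_bigr => j _; congr (_%:R); congr nat_of_bool.
    by apply/idP/eqP => [pj|->//]; exact: pu pj pj0.
  rewrite (eq_bigr (fun j => if j == j0 then 1 else 0)); last by move=> j _; case: eqP.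
  rewrite -big_mkcond /= big_const_seq.
  have : (count (pred1 j0) (index_iota m M) <= 1)%N.
    by rewrite count_uniq_mem ?iota_uniq// leq_b1.
  by case: count => [|[|//]] /= _; rewrite ?ler01// addr0.
rewrite exchange_big /=.
have -> : \sum_(lo <= i < B) phi i = \sum_(i < B) (lo <= i)%N%:R * phi i.
  rewrite -(big_mkord xpredT (fun i => (lo <= i)%N%:R * phi i)).
  have [loB|Blo] := leqP lo B; last first.
    rewrite [LHS]big_geq; last exact: ltnW.
    rewrite big_nat_cond big1// => i /andP[/andP[_ iB] _].
    by rewrite leqNgt (ltn_trans iB Blo) mul0r.
  rewrite [RHS](@big_cat_nat _ _ _ lo)//= [X in _ = X + _]big_nat_cond [X in _ = X + _]big1 ?add0r.
    rewrite big_nat_cond [RHS]big_nat_cond; apply: eq_bigr => i /andP[/andP[h _] _].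
    by rewrite h mul1r.
  by move=> i /andP[/andP[_ h] _]; rewrite leqNgt h mul0r.
by apply: ler_sum => i _; rewrite -mulr_suml ler_wpM2r.
Qed.

Section Blocks.
Variables (R : realType) (k : scalar_kind) (K : Type).
Local Notation F := (scalars R k).
Variable f : nat -> K -> F.
Hypothesis fnorm : forall n, supnorm (f n) = 1.
Variable N0 : set nat.
Hypothesis N0_coef : forall u : nat -> F, fin u -> supp u `<=` N0 ->
  forall j, modulus (u j) <= 4 * nrm f u.
Variable w : nat -> nat -> F.
Hypothesis w_unit : forall i, unit_block f N0 (w i).
Hypothesis w_lt : forall i, block_lt (w i) (w i.+1).

Lemma blocks_lt i j : (i < j)%N -> block_lt (w i) (w j).
Proof.
move=> ij; apply: (@block_lt_trans _ _ j.+1 w) => [l _|l _|]; last by rewrite ij ltnSn.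
  exact: w_lt.
by have [] := w_unit l.
Qed.

Lemma blocks_le i x : supp (w i) x -> (i <= x)%N.
Proof.
elim: i x => // i IH x wx; have [_ [y wy] _ _] := w_unit i.
by have := IH _ wy; have := w_lt wy wx; lia.
Qed.

Lemma blocks_disjoint i j x : supp (w i) x -> supp (w j) x -> i = j.
Proof.
move=> wi wj; case: (ltngtP i j) => // /blocks_lt h.
  by have := h _ _ wi wj; rewrite ltnn.
by have := h _ _ wj wi; rewrite ltnn.
Qed.

Lemma blocks_bound M : exists B, forall i, (i < M)%N -> bounded_by B (w i).
Proof.
elim: M => [|M [B BP]]; first by exists 0%N.
have [[B' B'P] _ _ _] := w_unit M; exists (maxn B B') => i.
rewrite ltnS leq_eqVlt => /orP[/eqP->|/BP h].
  by apply: bounded_byW B'P; rewrite leq_maxr.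
by apply: bounded_byW h; rewrite leq_maxl.
Qed.

Lemma blocks_sum m M t B : (forall i, (i < M)%N -> bounded_by B (w i)) ->
  \sum_(m <= i < M) modulus (lincomb f (w i) t) <= 4 * \sum_(m <= n < B) modulus (f n t).
Proof.
move=> BP; apply: (@le_trans _ _ (4 * \sum_(m <= i < M) \sum_(n < B)
    (w i n != 0)%:R * modulus (f n t))).
  rewrite mulr_sumr big_nat_cond [leRHS]big_nat_cond; apply: ler_sum => i /andP[/andP[_ iM] _].
  apply: le_trans (lincomb_le f t (BP _ iM)) _; rewrite mulr_sumr; apply: ler_sum => n _.
  rewrite mulrA ler_wpM2r ?modulus_ge0//; have [->|wn] := eqVneq (w i n) 0.
    by rewrite modulus0 mulr0.
  by rewrite mulr1; have [fw _ wN nw] := w_unit i; have := N0_coef fw wN n; rewrite nw mulr1.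
rewrite ler_wpM2l//; apply: (disjoint_sum (p := fun i n => w i n != 0)).
- by move=> n; exact: modulus_ge0.
- by move=> j j' i; exact: blocks_disjoint.
- by move=> j i mj /blocks_le; exact: leq_trans.
Qed.

Lemma tail_weights_sum m M B : \sum_(m <= i < M) tail_weight N0 B (w i) <=
  \sum_(m <= n < B) weight R N0 n.
Proof.
apply: (disjoint_sum (p := fun i n => w i n != 0)).
- by move=> n; exact: weight_ge0.
- by move=> j j' i; exact: blocks_disjoint.
- by move=> j i mj /blocks_le; exact: leq_trans.
Qed.

End Blocks.

(** * Systems of averages with nearly equal coefficients *)

Section Systems.
Variables (R : realType) (k : scalar_kind) (K : Type).
Local Notation F := (scalars R k).
Variable f : nat -> K -> F.
Hypothesis fnorm : forall n, supnorm (f n) = 1.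
Variables (W : omega1) (assoc : W -> nat -> W).
Hypothesis Hassoc : associated_sequences assoc.
Variable N0 : set nat.
Hypothesis N0_infinite : infinite_set N0.
Hypothesis N0_coef : forall u : nat -> F, fin u -> supp u `<=` N0 ->
  forall j, modulus (u j) <= 4 * nrm f u.
Hypothesis N0_segm : forall u : nat -> F, fin u -> supp u `<=` N0 ->
  forall a b, nrm f (segm a b u) <= 4 * nrm f u.
Variables (xi : W) (w : nat -> nat -> F).
Hypothesis w_avg : forall i, avgN f assoc N0 xi (w i).
Hypothesis w_lt : forall i, block_lt (w i) (w i.+1).

Let w_unit i : unit_block f N0 (w i).
Proof. exact: (avgN_facts fnorm N0_coef (w_avg i)). Qed.

Local Notation built := (built f assoc N0 xi (range w)).
Local Notation rep := (rep f w).
Implicit Types (v : nat -> F) (s r : seq nat) (Phi : seq nat -> Prop).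

Let range_avgN : range w `<=` avgN f assoc N0 xi.
Proof. by move=> _ [i _ <-]; exact: w_avg. Qed.

Lemma built_avgN_w b v : built b v -> avgN f assoc N0 b v.
Proof. exact: (built_avgN fnorm N0_infinite N0_coef range_avgN). Qed.

Lemma built_unit b v : built b v -> unit_block f N0 v.
Proof. by move/built_avgN_w/(avgN_facts fnorm N0_coef). Qed.

Variable delta : R.
Hypothesis delta_gt0 : 0 < delta.
Hypothesis large_coef : forall b, leo xi b -> exists n, forall v s lam rho,
  built b v -> rep v s lam rho -> beyond n v -> exists2 i, i \in s & delta < lam i.

Variable U : set_system nat.
Context {UU : UltraFilter U}.
Hypothesis U_tail : forall n, U [set j | (n < j)%N].
Local Notation bar := (bar U).

(** Averages whose coefficients over [s] agree up to the factor [th]. Here c is prescribed and is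
    the same for all leaves of a bar; in [presystem] each leaf has its own c, because normalization
    alters it. *)
Definition system b n c th Phi s := exists v lam rho,
  [/\ built b v, rep v s lam rho, beyond n v,
      forall i, i \in s -> c <= lam i <= th * c & Phi s].

Definition presystem b n th Phi s := exists2 c, 0 < c & system b n c th Phi s.

Lemma beyondW n n' v : (n <= n')%N -> beyond n' v -> beyond n v.
Proof. by move=> nn' vn i /vn; exact: leq_ltn_trans. Qed.

Lemma systemW b n n' c th Phi Phi' s : (n <= n')%N -> (forall s, Phi s -> Phi' s) ->
  system b n' c th Phi s -> system b n c th Phi' s.
Proof.
move=> nn' PP [v [lam [rho [h1 h2 h3 h4 h5]]]]; exists v, lam, rho; split=> //.
  exact: beyondW h3.
exact: PP.
Qed.

(* The normalizing factors take values in a compact interval, so that they can be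
   made nearly constant by cutting it into finitely many cells. *)
Lemma system_cells b th : leo xi b -> 1 < th -> exists L (cs : nat -> R),
  (forall l, 0 < cs l) /\
  forall Phi, (forall n, bar (presystem b n th Phi) [::]) ->
    exists2 l, (l < L)%N & forall n, bar (system b n (cs l) (th * th) Phi) [::].
Proof.
move=> xib th1; have [nb nbP] := large_coef xib.
have th0 : 0 < th by lra.
(* Some coefficient exceeds delta and is at most th * c, so c > delta / th; also c is at most 4.
   Cells of width (th - 1) * a have endpoints with quotient at most th. *)
pose a := delta / th; have a0 : 0 < a by exact: divr_gt0.
pose h := (th - 1) * a; have h0 : 0 < h by rewrite mulr_gt0// subr_gt0.
pose cs l : R := a + l%:R * h.
have csa l : a <= cs l by rewrite lerDl mulr_ge0// ltW.
have [L LP] : exists L : nat, 4 < cs L.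
  exists (Num.truncn (4 / h)).+1.
  have := truncnS_gt (4 / h); rewrite ltr_pdivrMr// /cs; lra.
(* The cells are fixed before [Phi], so that infinitely many conditions can later be distributed
   over the same finitely many cells. *)
exists L, cs; split=> [l|Phi H]; first exact: lt_le_trans (csa l).
have step n : exists2 l, (l < L)%N & bar (system b n (cs l) (th * th) Phi) [::].
  apply: bar_fin; apply: bar_mono (H (maxn n nb)) => s [c c0].
  move=> [v [lam [rho [bv rv vn lc Ps]]]].
  have vnb : beyond nb v by apply: beyondW vn; rewrite leq_maxr.
  have [i si di] := nbP _ _ _ _ bv rv vnb.
  have /andP[ci cth] := lc _ si.
  have l4 := rep_lam_le fnorm N0_segm w_unit i (built_unit bv) rv.
  have ac : a < c by rewrite ltr_pdivrMr// mulrC; lra.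
  have q0 : 0 <= (c - a) / h by rewrite divr_ge0 ?subr_ge0 ?ltW.
  have := truncn_itv q0; rewrite ler_pdivlMr// ltr_pdivrMr//.
  set l := Num.truncn _ => /andP[l1 l2].
  have lc1 : cs l <= c by rewrite /cs; lra.
  have lc2 : c <= th * cs l.
    have E : l.+1%:R = l%:R + 1 :> R by rewrite natr1.
    have : h <= (th - 1) * cs l by rewrite /h ler_wpM2l// subr_ge0 ltW.
    rewrite E mulrDl mul1r in l2; rewrite /cs in lc1 * => hh; lra.
  exists l.
    rewrite ltnNge; apply/negP => Ll; have : cs L <= cs l.
      by rewrite /cs lerD2l ler_wpM2r ?ler_nat// ltW.
    by lra.
  exists v, lam, rho; split=> //; first by apply: beyondW vn; rewrite leq_maxl.
  move=> j /lc/andP[h1 h2]; apply/andP; split; first exact: le_trans h1.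
  by apply: le_trans h2 _; rewrite -mulrA ler_wpM2l// ltW.
(* The cell found depends on n. One cell serves [U]-almost all n, hence arbitrarily large n, hence
   every n. *)
have : U [set n | exists2 l, (l < L)%N & [set m | bar (system b m (cs l) (th * th) Phi) [::]] n].
  by apply: filterS (@filterT _ U _) => n _; exact: step.
move=> /ultra_fin[l lL Ul]; exists l => // n.
have [m [nm hm]] := filter_ex (filterI (U_tail n) Ul).
by apply: bar_mono hm => s; apply: systemW => //; exact: ltnW.
Qed.

(** All summands have coefficients near the same c, so the coefficients of the normalized sum are
    still nearly equal. The first summand determines both the number m+1 of summands and the
    condition [Phi1 s0] for the second; the others only complete the count. *)
Lemma presystem_succ b a c th (Phi0 : seq nat -> Prop) (Phi1 : seq nat -> seq nat -> Prop) :
  leo xi b -> is_succ b a -> 0 < c ->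
  (forall n, bar (system b n c th Phi0) [::]) ->
  (forall s0, Phi0 s0 -> forall n, bar (system b n c th (Phi1 s0)) [::]) ->
  forall n, bar (presystem a n th (fun s => exists s0 s1 s2,
    [/\ s = s0 ++ s1 ++ s2, Phi0 s0 & Phi1 s0 s1])) [::].
Proof.
move=> xib sba c0 H0 H1 n.
apply: bar_seq (H0 n) _ => s0 [v0 [lam0 [rho0 [bv0 rv0 v0n lc0 P0]]]].
have [fv0 ne0 v0N nv0] := built_unit bv0.
have [m mP] := min_ex ne0.
(* There are m+1 summands, so at least two, and [Phi1] gets its turn. *)
have m0 : (0 < m)%N by have := v0n _ mP.1; lia.
pose acc l s' := exists (vs : nat -> nat -> F) lam rho,
  [/\ vs 0%N = v0, forall i, (i < l)%N -> built b (vs i),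
      forall i, (i.+1 < l)%N -> block_lt (vs i) (vs i.+1),
      rep (fun x => \sum_(i < l) vs i x) (s0 ++ s') lam rho &
      (forall i, i \in s0 ++ s' -> c <= lam i <= th * c) /\
      ((l = 1%N /\ s' = [::]) \/ exists s1 s2, s' = s1 ++ s2 /\ Phi1 s0 s1)].
have accP l : (0 < l)%N -> bar (acc l) [::].
  elim: l => // -[_ _|l IH _].
    apply: bar_now; exists (fun=> v0), lam0, rho0; split=> //.
    - by rewrite cats0; have -> : (fun x => \sum_(i < 1) v0 x) = v0
        by apply/funext => x; rewrite big_ord1.
    - by split; [move=> i; rewrite cats0; exact: lc0|left].
  apply: bar_seq (IH isT) _ => s' [vs [lam [rho [vs0 vb vlt rv [lc Ps]]]]].
  have vf i : (i < l.+1)%N -> fin (vs i) by move=> /vb/built_unit[].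
  have vne i : (i < l.+1)%N -> supp (vs i) !=set0 by move=> /vb/built_unit[].
  have fS := fin_sum vf; have [N SN] := fS.
  have sP := supp_sum vlt vne.
  apply: bar_mono (H1 _ P0 N) => s'' [v [lam' [rho' [bv rv' vN lc' P1]]]].
  have below i x : (i < l.+1)%N -> supp (vs i) x -> (x < N)%N.
    by move=> il vx; move/bounded_byP: SN; apply; apply/sP; exists i.
  exists (fun i => if (i < l.+1)%N then vs i else v).
  exists (fun i => lam i + lam' i), (fun n => rho n + rho' n); split.
  - by rewrite vs0.
  - by move=> i; case: ifP => [/vb//|_ _].
  - move=> i; rewrite ltnS => il; rewrite il; case: ifP => [|il']; first exact: vlt.
    by move=> x y /(below _ _ il) xN /vN; exact: ltn_trans.
  - have -> : (fun x => \sum_(i < l.+2) (if (i < l.+1)%N then vs i else v) x) =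
        fun x => (\sum_(i < l.+1) vs i x) + v x.
      apply/funext => x; rewrite big_ord_recr /= ltnn; congr (_ + _).
      by apply: eq_bigr => i _; rewrite ltn_ord.
    rewrite catA; apply: (rep_add w_unit) => //.
    by move=> x y /(proj1 (bounded_byP _ _) SN) xN /vN; exact: ltn_trans.
  - have dis i : i \in s0 ++ s' -> i \in s'' -> False.
      move=> /(rep_supp rv) h1 /(rep_supp rv') h2; have [_ [x wx] _ _] := w_unit i.
      have := vN _ (h2 _ wx); have := (proj1 (bounded_byP _ _) SN) _ (h1 _ wx).
      by lia.
    split.
      move=> i; rewrite catA mem_cat => /orP[si|si].
        have -> : lam' i = 0.
          by case: rv' => _ _ l0 _ _; apply: l0; apply/negP => /(dis i si).
        by rewrite addr0; exact: lc.
      have -> : lam i = 0.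
        by case: rv => _ _ l0 _ _; apply: l0; apply/negP => /dis/(_ si).
      by rewrite add0r; exact: lc'.
    right; case: Ps => [[_ ->]|[s1 [s2 [-> P1']]]].
      by exists s'', [::]; rewrite cats0.
    by exists s1, (s2 ++ s''); rewrite catA.
apply: bar_mono (accP m.+1 isT) => s' [vs [lam [rho [vs0 vb vlt rv [lc Ps]]]]].
have mP' : is_min (supp (vs 0%N)) m by rewrite vs0.
have bu := @built_succ _ _ _ f _ assoc N0 xi (range w) a b m vs sba vb vlt mP'.
have vav i : (i <= m)%N -> avgN f assoc N0 b (vs i) by move=> /vb/built_avgN_w.
have := succ_block fnorm N0_coef vav vlt; move: bu rv.
set S := (fun j : nat => \sum_(i < m.+1) vs i j) => bu rv [fS S0 SN0 SP].
have nS := nrm_gt0 N0_coef fS S0 SN0.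
have [s1 [s2 [s'E P1]]] : exists s1 s2, s' = s1 ++ s2 /\ Phi1 s0 s1.
  by case: Ps => [[] /eqP|//]; rewrite eqSS => /eqP E; rewrite E in m0.
exists ((nrm f S)^-1 * c); first by rewrite mulr_gt0 ?invr_gt0.
exists (normalize f S), (fun i => (nrm f S)^-1 * lam i), (fun i => (nrm f S)^-1 * rho i).
split=> //.
- by rewrite normalizeE; apply: rep_scale => //; rewrite invr_gt0.
- rewrite /beyond (supp_normalize N0_coef fS S0 SN0) => x /SP[[|i] im vx].
    by apply: v0n; rewrite -vs0.
  have [y vy] := ne0; have vy' : supp (vs 0%N) y by rewrite vs0.
  have vne j : (j < m.+1)%N -> supp (vs j) !=set0 by move=> /vb/built_unit[].
  have i1 : (0 < i.+1 < m.+1)%N by lia.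
  by have := block_lt_trans vlt vne i1 vy' vx; have := v0n _ vy; lia.
- have n0 : 0 <= (nrm f S)^-1 by rewrite invr_ge0 ltW.
  by move=> i /lc/andP[h1 h2]; rewrite [th * _]mulrCA; apply/andP; split; exact: ler_wpM2l.
- by exists s0, s1, s2; rewrite s'E.
Qed.

(** The inserted vector enters [rho] only, so the index set and the ratio of the coefficients are
    unchanged. *)
Lemma presystem_lim a th Phi : is_limit a ->
  (forall n, exists m, [/\ N0 m, (n < m)%N &
    forall n', bar (presystem (assoc a m) n' th Phi) [::]]) ->
  forall n, bar (presystem a n th Phi) [::].
Proof.
move=> la H n; have [m [Nm nm Hm]] := H n.
apply: bar_mono (Hm m) => s [c c0 [v [lam [rho [bv rv vm lc Ps]]]]].
have m0 : (0 < m)%N by lia.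
have [fv ne vN nv] := built_unit bv.
have bu := built_lim la Nm m0 bv vm.
have rS := rep_single fv nv vm rv.
have := lim_block Nm fv vN vm; move: bu rS.
set S := (fun j : nat => m.+1%:R^-1 * unit_vector R k m j + v j) => bu rS [fS S0 SN0 SP].
have nS := nrm_gt0 N0_coef fS S0 SN0.
exists ((nrm f S)^-1 * c); first by rewrite mulr_gt0 ?invr_gt0.
exists (normalize f S), (fun i => (nrm f S)^-1 * lam i).
eexists; split; [exact: bu| | | |by []].
- by rewrite normalizeE; apply: rep_scale rS => //; rewrite invr_gt0.
- rewrite /beyond (supp_normalize N0_coef fS S0 SN0) => x /SP[->//|/vm].
  exact: ltn_trans.
- have n0 : 0 <= (nrm f S)^-1 by rewrite invr_ge0 ltW.
  by move=> i /lc/andP[h1 h2]; rewrite [th * _]mulrCA; apply/andP; split; exact: ler_wpM2l.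
Qed.

Lemma sqrt_gt1 (th : R) : 1 < th -> 1 < Num.sqrt th /\ Num.sqrt th * Num.sqrt th = th.
Proof.
move=> th1; split; last by rewrite -expr2 sqr_sqrtr//; lra.
by rewrite -[ltLHS]sqrtr1 ltr_sqrt//; lra.
Qed.

(** At a successor the passage to cells squares the ratio, which starting from the square root of
    [th] compensates. The lifted index set contains a leaf of [Phi], whence the monotonicity of
    [Phi]. *)
Lemma presystem_lift b b' Phi : leo xi b -> leo b b' ->
  (forall s s', subseq s s' -> Phi s -> Phi s') ->
  (forall th n, 1 < th -> bar (presystem b n th Phi) [::]) ->
  forall th n, 1 < th -> bar (presystem b' n th Phi) [::].
Proof.
move=> xib + sub H; move: b'; apply: (well_founded_ind (@olt_wf W)) => b' IH [<-//|bb'] th n th1.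
have [zb|[[c sc]|lb]] := zero_succ_or_limit b'; first by case: (zb b).
  have bc := leo_succ sc bb'; have xic := leo_trans xib bc.
  have [r1 rth] := sqrt_gt1 th1.
  have [L [cs [cs0 csP]]] := system_cells xic r1.
  have [l _ lP] := csP _ (fun n => IH c sc.1 bc _ n r1).
  rewrite rth in lP.
  have := presystem_succ (Phi1 := fun=> Phi) xic sc (cs0 l) lP (fun _ _ => lP) n.
  apply: bar_mono => s [c1 c10 [v [lam [rho [h1 h2 h3 h4 [s0 [s1 [s2 [E P0 _]]]]]]]]].
  exists c1 => //; exists v, lam, rho; split=> //.
  by apply: sub P0; rewrite E; exact: prefix_subseq.
have [n0 n0P] := limit_assoc Hassoc lb bb'.
apply: presystem_lim => // p; have [m Nm] := N0_large N0_infinite (maxn p n0).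
rewrite gtn_max => /andP[pm n0m]; have [bm mb] := n0P m (ltnW n0m).
by exists m; split=> // n'; exact: IH.
Qed.

Variable C : R.

Definition bounded_on s := forall t, \sum_(i <- s) modulus (lincomb f (w i) t) <= C.

Lemma bounded_on_sub s s' : subseq s s' -> bounded_on s' -> bounded_on s.
Proof.
move=> ss' h t; apply: le_trans (h t); apply: sum_subseq => // i.
exact: modulus_ge0.
Qed.

(** At some order, averages leave the tree of bounded index sets above [r]. All ratios [th > 1] are
    demanded because each step of the recursion spoils the ratio. *)
Definition escapes r := exists2 b, leo xi b &
  forall th n, 1 < th -> bar (presystem b n th (fun s => ~ bounded_on (r ++ s))) [::].

Lemma escapes_sub r s s' : subseq s s' -> ~ bounded_on (r ++ s) -> ~ bounded_on (r ++ s').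
Proof.
by move=> ss' h /(bounded_on_sub (cat_subseq (subseq_refl r) ss')).
Qed.

Lemma escapes_base r : ~ bounded_on r -> escapes r.
Proof.
move=> nr; exists xi; first by left.
move=> th n th1; apply: bar_later (U_tail n) _ => j nj; apply: bar_now.
exists 1 => //; exists (w j), (fun i => (i == j)%:R), (fun=> 0); split.
- by apply: built_base; exists j.
- exact: rep_base.
- by move=> x /(blocks_le w_unit w_lt); exact: leq_trans.
- by move=> i; rewrite inE => /eqP ->; rewrite eqxx lexx mulr1 ltW.
- by move=> h; apply: nr; apply: bounded_on_sub h; exact: prefix_subseq.
Qed.

(** The orders belonging to the successors of [r] have a common upper bound [b0], and one cell
    serves [U]-almost all successors. At order [b0 + 1] the first summand has an index list starting
    with such a successor j, and the second summand escapes from [rcons r j]. *)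
Lemma escapes_step r : U [set i | escapes (rcons r i)] -> escapes r.
Proof.
move=> Ue.
have bex i : exists b, leo xi b /\ (escapes (rcons r i) ->
    forall th n, 1 < th -> bar (presystem b n th (fun s => ~ bounded_on (rcons r i ++ s))) [::]).
  have [[b xb H]|ne] := pselect (escapes (rcons r i)); first by exists b.
  by exists xi; split; [left|].
have [bb bbP] := boolp.choice bex.
have [b0 b0P] := countable_bound bb.
have xb0 : leo xi b0 := leo_trans (bbP 0%N).1 (b0P 0%N).
have [b sb] := succ_exists b0; exists b.
  by right; case: sb => + _; case: xb0 => [->|/olt_trans h /h].
move=> th n th1; have [r1 rth] := sqrt_gt1 th1.
have [L [cs [cs0 csP]]] := system_cells xb0 r1; rewrite rth in csP.
pose X l := [set i | forall n, bar (system b0 n (cs l) th (fun s => ~ bounded_on (rcons r i ++ s))) [::]].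
have [l _ Ul] : exists2 l, (l < L)%N & U (X l).
  apply: ultra_fin; apply: filterS Ue => i ei; apply: csP => m.
  apply: (presystem_lift (bbP i).1 (b0P i)) => //; last exact: (bbP i).2.
  by move=> s s'; exact: escapes_sub.
(* Any member of [X l] supplies first summands with coefficients in the right cell; their first
   index is then forced into [X l]. *)
have [i0 Xi0] := filter_ex Ul.
have [nb nbP] := large_coef xb0.
pose Phi0 s := exists j s', s = j :: s' /\ X l j.
have H0 m : bar (system b0 m (cs l) th Phi0) [::].
  (* A late average has a large coefficient, so its index list is nonempty and the root of the bar
     can be restricted. *)
  have nonil : ~ system b0 (maxn m nb) (cs l) th (fun s => ~ bounded_on (rcons r i0 ++ s)) [::].
    move=> [v [lam [rho [bv rv vn _ _]]]]; have [|//] := nbP _ _ _ _ bv rv.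
    by apply: beyondW vn; rewrite leq_maxr.
  apply: bar_mono (bar_head (Xi0 (maxn m nb)) nonil Ul) => s.
  move=> [[v [lam [rho [h1 h2 h3 h4 h5]]]] hs]; exists v, lam, rho; split=> //.
  by apply: beyondW h3; rewrite leq_maxl.
pose Phi1 s s' := ~ bounded_on (rcons r (head 0%N s) ++ s').
have H1 s0 : Phi0 s0 -> forall m, bar (system b0 m (cs l) th (Phi1 s0)) [::].
  by move=> [j [s' [-> Xj]]] m; exact: Xj.
have := presystem_succ xb0 sb (cs0 l) H0 H1 n.
apply: bar_mono => s [c1 c10 [v [lam [rho [h1 h2 h3 h4 [s0 [s1 [s2 [E P0 P1]]]]]]]]].
exists c1 => //; exists v, lam, rho; split=> //.
move: P0 P1 => [j [s' [s0E _]]]; rewrite /Phi1 s0E /= => nb1 h; apply: nb1.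
apply: bounded_on_sub h; rewrite E s0E cat_rcons; apply: cat_subseq => //=.
rewrite eqxx; apply: subseq_trans (suffix_subseq _ _); exact: prefix_subseq.
Qed.

(** By [escapes_step], a node that does not escape has such a successor with an arbitrarily large
    last index; by [escapes_base], all nodes of the resulting branch are bounded. *)
Lemma not_escapes_branch : ~ escapes [::] -> exists2 h : nat -> nat,
  forall i, (h i < h i.+1)%N & forall n, bounded_on (mkseq h n).
Proof.
move=> ne.
have H r : exists i, (sumn r < i)%N /\ (~ escapes r -> ~ escapes (rcons r i)).
  have [er|nr] := pselect (escapes r); first by exists (sumn r).+1.
  apply: contrapT => Hn; apply: nr; apply: escapes_step.
  apply: filterS (U_tail (sumn r)) => i ri; apply: contrapT => nei; apply: Hn.
  by exists i.
have [nx nxP] := boolp.choice H.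
pose hl := fix hl n := if n is m.+1 then rcons (hl m) (nx (hl m)) else [::].
pose h n := nx (hl n).
have hlE n : mkseq h n = hl n by elim: n => // n IH; rewrite mkseqS IH.
exists h.
  move=> n; have h1 : (h n <= sumn (hl n.+1))%N by rewrite /= -cats1 sumn_cat /= addn0 leq_addl.
  exact: leq_ltn_trans h1 (nxP (hl n.+1)).1.
move=> n; rewrite hlE; apply: contrapT => /escapes_base.
by elim: n => [|n IH]; [exact: ne|exact: (nxP (hl n)).2 IH].
Qed.

End Systems.

(** * Averages with small coefficients *)

Section SmallCoefficients.
Variables (R : realType) (k : scalar_kind) (K : Type).
Local Notation F := (scalars R k).
Variable f : nat -> K -> F.
Hypothesis fnorm : forall n, supnorm (f n) = 1.
Hypothesis ftail : forall t (e : R), 0 < e -> exists n, forall m M, (n <= m)%N ->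
  \sum_(m <= j < M) modulus (f j t) <= e.
Variables (W : omega1) (assoc : W -> nat -> W).
Hypothesis Hassoc : associated_sequences assoc.
Variable N0 : set nat.
Hypothesis N0_infinite : infinite_set N0.
Hypothesis N0_coef : forall u : nat -> F, fin u -> supp u `<=` N0 ->
  forall j, modulus (u j) <= 4 * nrm f u.
Hypothesis N0_segm : forall u : nat -> F, fin u -> supp u `<=` N0 ->
  forall a b, nrm f (segm a b u) <= 4 * nrm f u.
Hypothesis N0_weight : forall M, \sum_(n < M) weight R N0 n <= 2.
Variables (xi : W) (w : nat -> nat -> F).
Hypothesis w_avg : forall i, avgN f assoc N0 xi (w i).
Hypothesis w_lt : forall i, block_lt (w i) (w i.+1).

Let w_unit i : unit_block f N0 (w i).
Proof. exact: (avgN_facts fnorm N0_coef (w_avg i)). Qed.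

Local Notation built := (built f assoc N0 xi (range w)).
Local Notation rep := (rep f w).
Local Notation x i := (lincomb f (w i)).

Lemma tail_weight_le N (v : nat -> F) : tail_weight N0 N v <= 2.
Proof.
apply: le_trans (N0_weight N); apply: ler_sum => n _.
by rewrite ler_piMl ?weight_ge0// lern1 leq_b1.
Qed.

Lemma blocks_tail t (e : R) : 0 < e -> exists n, forall m M, (n <= m)%N ->
  \sum_(m <= i < M) modulus (x i t) <= e.
Proof.
move=> e0; have [|n nP] := ftail t (e := e / 4); first by rewrite divr_gt0.
exists n => m M nm; have [B BP] := blocks_bound w_unit M.
apply: le_trans (blocks_sum N0_coef w_unit w_lt m t BP) _.
by have := nP m B nm; lra.
Qed.

Lemma sgpart_ge a (z : F) : - modulus z <= sgpart a z.
Proof. by rewrite lerNl -modulusN -raddfN sgpart_le. Qed.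

Lemma small_coefficients (delta : R) : 0 < delta ->
  (forall h : nat -> nat, (forall i, (h i < h i.+1)%N) ->
    ~ exists C : R, forall n t, \sum_(i < n) modulus (x (h i) t) <= C) ->
  exists2 b, leo xi b & forall n, exists v s lam rho,
    [/\ built b v, rep v s lam rho, beyond n v & forall i, lam i <= delta].
Proof.
move=> d0 noc0; apply: contrapT => Hn.
(* The negation of the claim is the standing hypothesis of the recursion. *)
have large b : leo xi b -> exists n, forall v s lam rho,
    built b v -> rep v s lam rho -> beyond n v -> exists2 i, i \in s & delta < lam i.
  move=> xib; apply: contrapT => Hb; apply: Hn; exists b => // n.
  apply: contrapT => Hv; apply: Hb; exists n => v s lam rho bv rv vn.
  apply: contrapT => Hi; apply: Hv; exists v, s, lam, rho; split=> // i.
  rewrite leNgt; apply/negP => di; apply: Hi; exists i => //.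
  by apply: contraTT di => si; case: rv => _ _ -> // _ _; rewrite -leNgt ltW.
have [U UU Utail] := nonprincipal_ultrafilter.
(* The chosen indices will contribute at least delta/2 * C1 = 15 at a point, the negligible ones at
   least -4 and the remainder [rho] at least -8. What is left, 3, exceeds the norm 1. *)
pose C1 := 30 / delta.
have [esc|nesc] := pselect (escapes f assoc N0 xi w U (4 * C1) [::]); last first.
  have [h hm hb] := not_escapes_branch fnorm Hassoc N0_infinite N0_coef N0_segm
    w_avg w_lt d0 large Utail nesc.
  apply: (noc0 h hm); exists (4 * C1) => n t; have := hb n t.
  rewrite /mkseq big_map -(big_mkord xpredT (fun i => modulus (x (h i) t))).
  by rewrite /index_iota subn0.
case: esc => b xib H.
have [nb nbP] := large b xib.
have {}H := H 2 nb _; have {H} [|h hm hP] := bar_extract Utail (H _); first by lra.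
pose bad (I : seq nat) := sorted ltn I /\ exists a t,
  (forall i, i \in I -> 0 <= sgpart a (x (h i) t)) /\
  C1 < \sum_(i <- I) sgpart a (x (h i) t).
(* One of the four signed parts carries more than [C1]; the indices at which it is nonnegative are
   kept. *)
have badsub I : sorted ltn I -> ~ bounded_on f w (4 * C1) (map h I) ->
    exists2 J, bad J & (size J <= size I)%N.
  move=> sI /existsNP[t /negP]; rewrite -ltNge big_map => ht.
  have [a aP] : exists a, C1 < \sum_(i <- I) Num.max (sgpart a (x (h i) t)) 0.
    apply: contrapT => na; move: ht; rewrite ltNge => /negP; apply.
    apply: (@le_trans _ _ (\sum_(i <- I) \sum_(a < 4) Num.max (sgpart a (x (h i) t)) 0)).
      by apply: ler_sum => i _; exact: modulus_le_sgpart.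
    rewrite exchange_big /= (_ : 4 * C1 = \sum_(a < 4) C1); last first.
      by rewrite sumr_const card_ord mulr_natl.
    apply: ler_sum => a _; rewrite leNgt; apply/negP => h1; apply: na; by exists a.
  pose J := [seq i <- I | 0 <= sgpart a (x (h i) t)].
  exists J; last by rewrite size_filter count_size.
  split; first by apply: sorted_filter sI; exact: ltn_trans.
  exists a, t; split; first by move=> i; rewrite mem_filter => /andP[].
  rewrite big_filter; apply: lt_le_trans aP _; rewrite [leRHS]big_mkcond.
  by apply: ler_sum => i _; case: (leP 0 (sgpart a (x (h i) t))).
have [p [I0 [badI0 szI0]]] : exists n I, bad I /\ size I = n.
  have [n [c c0 [v [lam [rho [_ _ _ _ nT]]]]]] := hP id (fun _ _ => id).
  have [J bJ _] := badsub (iota 0 n) (iota_ltn_sorted 0 n) nT.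
  by exists (size J), J.
have [I [badI Imin]] : exists I, bad I /\ forall J, bad J -> (size I <= size J)%N.
  have ex : exists n, `[< exists I, bad I /\ size I = n >] by exists p; apply/asboolP; exists I0.
  have [n /asboolP[I [bI sI]] nmin] := ex_minnP ex.
  by exists I; split=> // J bJ; rewrite sI; apply: nmin; apply/asboolP; exists J.
case: (badI) => sI [a [t [Ipos IC]]].
have [n1 n1P] := blocks_tail t (@ltr01 R).
(* B exceeds every element of [I], and since [h i >= i] the indices [h i] with i >= B lie beyond
   [n1], where the moduli at t sum to at most 1. *)
pose B := (n1 + sumn I + 1)%N.
have IB i : i \in I -> (i < B)%N.
  move=> iI; have : (i <= sumn I)%N; last by rewrite /B; lia.
  elim: I {badI Imin sI Ipos IC B} iI => // y I IH; rewrite inE => /orP[/eqP->|/IH] /=; lia.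
pose g i := if (i < size I)%N then nth 0%N I i else (B + i)%N.
have gm i j : (i < j)%N -> (g i < g j)%N.
  move=> ij; rewrite /g; case: (ltnP j (size I)) => jI.
    rewrite (ltn_trans ij jI); apply: (sorted_ltn_nth ltn_trans) => //.
    by rewrite inE (ltn_trans ij).
  case: ifP => iI; last by rewrite ltn_add2l.
  exact: leq_trans (IB _ (mem_nth 0%N iI)) (leq_addr _ _).
have [n [c c0 [v [lam [rho [bv rv vn lc nT]]]]]] := hP g gm.
(* A leaf reached before [I] is used up would give a bad set smaller than [I]. *)
have [nI|In] := ltnP n (size I).
  have E : mkseq (h \o g) n = map h (take n I).
    apply: (@eq_from_nth _ 0%N) => [|i].
      by rewrite size_mkseq size_map size_take nI.
    rewrite size_mkseq => ilt; rewrite nth_mkseq// (nth_map 0%N) ?size_take ?nI//.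
    by rewrite /= /g (ltn_trans ilt nI) nth_take.
  rewrite E in nT; have [|J bJ] := badsub (take n I) _ nT.
    exact: take_sorted.
  rewrite size_take nI => Jn; have := Imin _ bJ; by lia.
pose FF := mkseq (fun i => h (B + (size I + i))%N) (n - size I).
have E : mkseq (h \o g) n = map h I ++ FF.
  apply: (@eq_from_nth _ 0%N) => [|i].
    by rewrite size_mkseq size_cat size_map size_mkseq subnKC.
  rewrite size_mkseq => ilt; rewrite nth_mkseq//= nth_cat size_map /g.
  case: ltnP => iI; first by rewrite (nth_map 0%N).
  by rewrite nth_mkseq ?subnKC// ltn_sub2r//; apply: leq_trans ilt.
rewrite E in rv lc; have uv := built_unit fnorm N0_infinite N0_coef w_avg bv.
have [i0 i0s di0] := nbP _ _ _ _ bv rv vn.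
(* The ratio 2 spreads the single coefficient above delta to all of them. *)
have cd : delta / 2 < c by have /andP[_ h2] := lc _ i0s; rewrite ltr_pdivrMr//; lra.
have [[N vN] _ _ nv] := uv.
have fv : fin v by exists N.
have := sgpart_le a (lincomb f v t); rewrite (rep_lincomb w_unit t fv rv) raddfD raddf_sum /=.
have := le_nrm fnorm t fv; rewrite nv (rep_lincomb w_unit t fv rv).
set z := (X in modulus X) => z1 z2.
have {z1 z2} := le_trans z2 z1; rewrite big_cat /= big_map.
have r1 : - 8 <= sgpart a (lincomb f (fun n => of_real k (rho n)) t).
  apply: le_trans (sgpart_ge _ _); rewrite lerN2.
  apply: le_trans (rep_rho_lincomb fnorm N0_segm t uv vN rv) _.
  by have := tail_weight_le N v; lra.
have r2 : - 4 <= \sum_(i <- FF) sgpart a (of_real k (lam i) * x i t).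
  apply: (@le_trans _ _ (\sum_(i <- FF) - (4 * modulus (x i t)))).
    rewrite sumrN lerN2 -mulr_sumr -[leRHS]mulr1 ler_wpM2l//.
    have uF : uniq FF.
      rewrite map_inj_in_uniq ?iota_uniq// => i j _ _ ij.
      by case: (ltngtP i j) => // ij'; have := hm (B + (size I + i))%N (B + (size I + j))%N;
        have := hm (B + (size I + j))%N (B + (size I + i))%N; lia.
    have hge m : (m <= h m)%N by elim: m => // m IH; have := hm m m.+1 (ltnSn m); lia.
    apply: (@le_trans _ _ (\sum_(n1 <= i < (\max_(i <- FF) i).+1) modulus (x i t))); last exact: n1P.
    apply: sum_uniq_sub => // [i|i iF]; first exact: modulus_ge0.
    rewrite mem_index_iota ltnS leq_bigmax_seq// andbT.
    move/mapP: iF => [j _ ->]; apply: leq_trans (hge _); rewrite /B; lia.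
  apply: ler_sum => i _; rewrite sgpartZ.
  have l4 := rep_lam_le fnorm N0_segm w_unit i uv rv.
  have l0 : 0 <= lam i.
    case: rv => _ ls l0 _ _; have [/ls[/ltW//]|/l0->//] := boolP (i \in map h I ++ FF).
  have h1 : lam i * modulus (x i t) <= 4 * modulus (x i t) by rewrite ler_wpM2r// modulus_ge0.
  have h2 : lam i * - modulus (x i t) <= lam i * sgpart a (x i t).
    by rewrite ler_wpM2l// sgpart_ge.
  by rewrite mulrN in h2; lra.
have r3 : delta / 2 * C1 <= \sum_(i <- I) sgpart a (of_real k (lam (h i)) * x (h i) t).
  apply: (@le_trans _ _ (\sum_(i <- I) delta / 2 * sgpart a (x (h i) t))).
    by rewrite -mulr_sumr ler_wpM2l ?divr_ge0 ?ltW.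
  rewrite big_seq [leRHS]big_seq; apply: ler_sum => i iI; rewrite sgpartZ ler_wpM2r ?Ipos//.
  have hiI : h i \in map h I ++ FF by rewrite mem_cat map_f.
  by have /andP[h1 _] := lc _ hiI; apply: le_trans h1; exact: ltW.
have r4 : C1 * delta = 30 by rewrite divfK// gt_eqF.
by lra.
Qed.

End SmallCoefficients.

(** * Refinement of block sequences of averages *)

Lemma disjoint_lists_sum (R : numDomainType) (phi : nat -> R) (s : nat -> seq nat) m M B :
  (forall i, 0 <= phi i) -> (forall j, uniq (s j)) ->
  (forall j j' i, (m <= j)%N -> (m <= j')%N -> i \in s j -> i \in s j' -> j = j') ->
  (forall N, \sum_(i < N) phi i <= B) ->
  \sum_(m <= j < M) \sum_(i <- s j) phi i <= B.
Proof.
move=> phi0 us ds BP.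
pose N := (\max_(m <= j < M) \max_(i <- s j) i).+1.
have iN i j : (m <= j < M)%N -> i \in s j -> (i < N)%N.
  move=> jM ij; rewrite ltnS; apply: (@leq_trans (\max_(i <- s j) i)).
    exact: leq_bigmax_seq.
  by apply: (@leq_bigmax_seq _ _ _ (fun j => \max_(i <- s j) i) j); rewrite ?mem_index_iota.
apply: le_trans (BP N); rewrite -(big_mkord xpredT).
pose p j i := (m <= j)%N && (i \in s j).
apply: le_trans (@disjoint_sum _ phi p m M 0 N phi0 _ _) => //; last first.
  by move=> j j' i /andP[h1 h2] /andP[h3 h4]; exact: ds h2 h4.
rewrite big_nat_cond [leRHS]big_nat_cond; apply: ler_sum => j /andP[jM _].
rewrite -(big_mkord xpredT (fun i => (p j i)%:R * phi i)) /p.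
case/andP: (jM) => -> _ /=.
have -> : \sum_(0 <= i < N) (i \in s j)%:R * phi i = \sum_(i <- [seq i <- index_iota 0 N | i \in s j]) phi i.
  by rewrite big_filter [RHS]big_mkcond; apply: eq_bigr => i _; case: ifP; rewrite ?mul1r ?mul0r.
apply: sum_uniq_sub => // i ij; rewrite mem_filter ij mem_index_iota /=.
exact: iN ij.
Qed.

Section Poset.
Variables (R : realType) (k : scalar_kind) (K : Type).
Local Notation F := (scalars R k).
Variable f : nat -> K -> F.
Hypothesis fnorm : forall n, supnorm (f n) = 1.
Variables (W : omega1) (assoc : W -> nat -> W).
Hypothesis Hassoc : associated_sequences assoc.
Variable N0 : set nat.
Hypothesis N0_infinite : infinite_set N0.
Hypothesis N0_coef : forall u : nat -> F, fin u -> supp u `<=` N0 ->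
  forall j, modulus (u j) <= 4 * nrm f u.
Hypothesis N0_segm : forall u : nat -> F, fin u -> supp u `<=` N0 ->
  forall a b, nrm f (segm a b u) <= 4 * nrm f u.
Hypothesis N0_weight : forall M, \sum_(n < M) weight R N0 n <= 2.

Definition level : Type := (W * (nat -> nat -> F))%type.
Implicit Types (p q : level).

Definition average_blocks q :=
  (forall i, avgN f assoc N0 q.1 (q.2 i)) /\ (forall i, block_lt (q.2 i) (q.2 i.+1)).

Definition from q b v := built f assoc N0 q.1 (range q.2) b v.

(** Finitely many terms are exempt, so that a diagonal sequence can bound a countable chain. *)
Definition refines q q' := exists j0, forall j, (j0 <= j)%N -> from q q'.1 (q'.2 j).

Definition abs_bounded q (V : set K) := exists C : R, forall n t, V t ->
  \sum_(i < n) modulus (lincomb f (q.2 i) t) <= C.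

Lemma average_blocks_unit q : average_blocks q -> forall i, unit_block f N0 (q.2 i).
Proof. by move=> [qa _] i; exact: (avgN_facts fnorm N0_coef (qa i)). Qed.

Lemma range_averages q : average_blocks q -> range q.2 `<=` avgN f assoc N0 q.1.
Proof. by move=> [qa _] _ [i _ <-]. Qed.

Lemma from_avgN q b v : average_blocks q -> from q b v -> avgN f assoc N0 b v.
Proof. by move=> /range_averages h; exact: (built_avgN fnorm N0_infinite N0_coef h). Qed.

Lemma from_unit q b v : average_blocks q -> from q b v -> unit_block f N0 v.
Proof. by move=> qq /(from_avgN qq)/(avgN_facts fnorm N0_coef). Qed.

Lemma blocks_beyond q : average_blocks q -> forall n, exists2 u, range q.2 u & beyond n u.
Proof.
move=> qq n; exists (q.2 n.+1); first by exists n.+1.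
by move=> x /(blocks_le (average_blocks_unit qq) qq.2).
Qed.

Lemma from_rep q b v : average_blocks q -> from q b v ->
  exists s lam rho, rep f q.2 v s lam rho.
Proof.
move=> qq; have qu := average_blocks_unit qq; have ra := range_averages qq.
elim=> {b v} [_ [i _ <-]|a b m v sb h IH vlt vm|a m v la Nm m0 h IH mv].
- by exists [:: i], (fun j => (j == i)%:R), (fun=> 0); exact: rep_base.
- have vu i : (i <= m)%N -> unit_block f N0 (v i).
    by move=> /h/(from_unit qq).
  have H l : (l <= m)%N -> exists s lam rho, rep f q.2 (fun x => \sum_(i < l.+1) v i x) s lam rho.
    elim: l => [_|l IHl lm].
      have [s [lam [rho r]]] := IH 0%N isT; exists s, lam, rho.
      suff -> : (fun x => \sum_(i < 1) v i x) = v 0%N by [].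
      by apply/funext => x; rewrite big_ord1.
    have [s [lam [rho r]]] := IHl (ltnW lm); have [s' [lam' [rho' r']]] := IH _ lm.
    exists (s ++ s'), (fun i => lam i + lam' i), (fun n => rho n + rho' n).
    have -> : (fun x => \sum_(i < l.+2) v i x) = fun x => \sum_(i < l.+1) v i x + v l.+1 x.
      by apply/funext => x; rewrite big_ord_recr.
    have vlt' i : (i.+1 < l.+2)%N -> block_lt (v i) (v i.+1) by move=> il; apply: vlt; lia.
    have ne i : (i < l.+2)%N -> supp (v i) !=set0.
      move=> il; have im : (i <= m)%N by lia.
      by have [] := vu i im.
    apply: (rep_add qu) => //.
      apply: fin_sum => i il; have im : (i <= m)%N by lia.
      by have [] := vu i im.
    move=> x y.
    move/(@supp_sum _ _ l.+1 v (fun i il => vlt' i (ltnW il)) (fun i il => ne i (ltnW il))).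
    move=> [i il vx] vy; apply: (block_lt_trans vlt' ne _ vx vy); lia.
  have [s [lam [rho r]]] := H m (leqnn m).
  have vav i : (i <= m)%N -> avgN f assoc N0 b (v i) by move=> /h/(from_avgN qq).
  have [fS S0 SN0 _] := succ_block fnorm N0_coef vav vlt.
  have nS := nrm_gt0 N0_coef fS S0 SN0.
  by do 3 eexists; rewrite normalizeE; apply: rep_scale r => //; rewrite invr_gt0.
- have [fv ne vN nv] := from_unit qq h.
  have [s [lam [rho r]]] := IH.
  have [fS S0 SN0 _] := lim_block Nm fv vN mv.
  have nS := nrm_gt0 N0_coef fS S0 SN0.
  do 3 eexists; rewrite normalizeE; apply: rep_scale (rep_single fv nv mv r) => //.
  by rewrite invr_gt0.
Qed.

Lemma refines_trans p q r : average_blocks q -> average_blocks r ->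
  refines p q -> refines q r -> refines p r.
Proof.
move=> qq rr [j0 pq] [j1 qr].
have qu := average_blocks_unit qq; have ru := average_blocks_unit rr.
have [B BP] := blocks_bound qu j0.
(* From B on, the terms of [r] have supports beyond the first [j0] terms of [q], the ones that may
   fail to be built from [p]. *)
exists (maxn j1 B) => j; rewrite geq_max => /andP[j1j Bj].
have := built_restrict fnorm N0_infinite N0_coef (range_averages qq) (qr j j1j).
move/built_trans; apply => _ [[i _ <-] sub]; apply: pq.
rewrite leqNgt; apply/negP => ij0; have [_ [x qx] _ _] := qu i.
have := blocks_le ru rr.2 (sub _ qx); move/bounded_byP: (BP _ ij0) => /(_ _ qx); lia.
Qed.

Lemma refines_refl q : refines q q.
Proof. by exists 0%N => j _; apply: built_base; exists j. Qed.

Lemma modulus_unit_le1 v t : unit_block f N0 v -> modulus (lincomb f v t) <= 1.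
Proof. by move=> [fv _ _ <-]; exact: le_nrm. Qed.

Lemma refines_bounded q q' V : average_blocks q -> average_blocks q' -> refines q q' ->
  abs_bounded q V -> abs_bounded q' V.
Proof.
move=> qq qq' [j0 rf] [C CP].
have qu := average_blocks_unit qq; have qu' := average_blocks_unit qq'.
have ex j : exists s, uniq s /\ ((j0 <= j)%N -> exists lam rho, rep f q.2 (q'.2 j) s lam rho).
  have [jj|jj] := leqP j0 j; last by exists [::].
  have [s [lam [rho r]]] := from_rep qq (rf j jj).
  by exists s; split; [case: r|move=> _; exists lam, rho].
have [s sP] := boolp.choice ex.
(* The exempt terms contribute at most 1 each. The others have coefficients at most 4 over disjoint
   index sets, and their remainders add at most 4 * 2. *)
exists (j0%:R + (4 * C + 8)) => n t Vt.
have C0 : 0 <= C by have := CP 0%N t Vt; rewrite big_ord0.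
rewrite -(big_mkord xpredT (fun i => modulus (lincomb f (q'.2 i) t))).
have first M : (M <= j0)%N -> \sum_(0 <= i < M) modulus (lincomb f (q'.2 i) t) <= j0%:R.
  move=> Mj; apply: (@le_trans _ _ (\sum_(0 <= i < M) 1)).
    by apply: ler_sum => i _; exact: modulus_unit_le1.
  by rewrite sumr_const_nat subn0 ler_nat.
have [nj|jn] := leqP n j0; first by apply: le_trans (first n nj) _; rewrite lerDl; lra.
rewrite (@big_cat_nat _ _ _ j0)//=; last exact: ltnW.
apply: lerD; first exact: first.
have [B BP] := blocks_bound qu' n.
apply: (@le_trans _ _ (\sum_(j0 <= j < n) (4 * \sum_(i <- s j) modulus (lincomb f (q.2 i) t)
    + 4 * tail_weight N0 B (q'.2 j)))).
  rewrite big_nat_cond [leRHS]big_nat_cond; apply: ler_sum => j /andP[/andP[j0j jn'] _].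
  have [lam [rho r]] := (sP j).2 j0j.
  apply: (rep_le fnorm N0_segm qu t (qu' j) (BP j jn') r) => i.
  exact: (rep_lam_le fnorm N0_segm qu i (qu' j) r).
rewrite big_split /= -!mulr_sumr; apply: lerD.
  rewrite ler_wpM2l//; apply: disjoint_lists_sum => [i|j|j j' i h1 h2 h3 h4|N].
  - exact: modulus_ge0.
  - exact: (sP j).1.
  - have [lam [rho r]] := (sP j).2 h1; have [lam' [rho' r']] := (sP j').2 h2.
    have [_ [y qy] _ _] := qu i.
    exact: (blocks_disjoint qu' qq'.2 (rep_supp r h3 qy) (rep_supp r' h4 qy)).
  - exact: CP.
have := tail_weights_sum qu' qq'.2 j0 n B.
suff : \sum_(j0 <= i < B) weight R N0 i <= 2 by lra.
apply: le_trans (N0_weight B); rewrite -(big_mkord xpredT).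
by apply: sum_uniq_sub => [i||i]; [exact: weight_ge0|exact: iota_uniq|];
  rewrite !mem_index_iota; lia.
Qed.

(** A diagonal at a common order [b]: the term with index n is built from those terms of [q n] that
    are themselves built from all of [q 0], ..., [q n]. *)
Lemma refines_bound (q : nat -> level) : (forall n, average_blocks (q n)) ->
  (forall n, refines (q n) (q n.+1)) -> exists2 r, average_blocks r & forall n, refines (q n) r.
Proof.
move=> qq qr.
have le m n : (m <= n)%N -> refines (q m) (q n).
  elim: n => [|n IH]; first by rewrite leqn0 => /eqP ->; exact: refines_refl.
  rewrite leq_eqVlt => /orP[/eqP->|/IH h]; first exact: refines_refl.
  exact: refines_trans h (qr n).
have [b bP] := countable_bound (fun n => (q n).1).
pose A n := [set u | range (q n).2 u /\ forall l, (l <= n)%N -> from (q l) (q n).1 u].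
have AN n : A n `<=` avgN f assoc N0 (q n).1 by move=> u [] /(range_averages (qq n)).
have Aunb n m : exists2 u, A n u & beyond m u.
  have [j0 j0P] : exists j0, forall l j, (l <= n)%N -> (j0 <= j)%N -> from (q l) (q n).1 ((q n).2 j).
    suff H N : (N <= n.+1)%N -> exists j0, forall l j, (l < N)%N -> (j0 <= j)%N ->
        from (q l) (q n).1 ((q n).2 j) by have [//|j0 h] := H n.+1; exists j0.
    elim: N => [_|N IH Nn]; first by exists 0%N.
    have [j0 j0P] := IH (ltnW Nn); have [j1 j1P] := le N n Nn.
    exists (maxn j0 j1) => l j; rewrite geq_max ltnS leq_eqVlt => /orP[/eqP->|lN] /andP[h1 h2].
      exact: j1P.
    exact: j0P.
  exists ((q n).2 (maxn j0 m.+1)).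
    split; first by exists (maxn j0 m.+1).
    by move=> l ln; apply: j0P => //; rewrite leq_maxl.
  move=> x /(blocks_le (average_blocks_unit (qq n)) (qq n).2).
  by apply: leq_trans; rewrite leq_maxr.
have ex n m : exists v, (built f assoc N0 (q n).1 (A n) b v /\ beyond m v) /\ fin v.
  have [v h1 h2] := built_exists fnorm Hassoc N0_infinite N0_coef (AN n) (Aunb n) (bP n) m.
  exists v; split=> //.
  by have [] := avgN_facts fnorm N0_coef (built_avgN fnorm N0_infinite N0_coef (AN n) h1).
have ex1 n : exists h : nat -> nat -> F, forall m,
    (built f assoc N0 (q n).1 (A n) b (h m) /\ beyond m (h m)) /\ fin (h m).
  by have [h hP] := boolp.choice (ex n); exists h.
have [nx nxP] := boolp.choice ex1.
have ex2 n : exists h : nat -> nat, forall m, bounded_by (h m) (nx n m).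
  by have [h hP] := boolp.choice (fun m => (nxP n m).2); exists h.
have [bd bdP] := boolp.choice ex2.
pose pos := fix pos n := if n is m.+1 then bd m (pos m) else 0%N.
exists (b, fun n => nx n (pos n)).
  split=> [i|i] /=.
    exact: (built_avgN fnorm N0_infinite N0_coef (AN i) (nxP i (pos i)).1.1).
  move=> x y /(proj1 (bounded_byP _ _) (bdP i (pos i))) h1.
  by move=> /(nxP i.+1 (bd i (pos i))).1.2; exact: ltn_trans.
move=> n; exists n => j nj; rewrite /from /=.
apply: built_trans (nxP j (pos j)).1.1 _ => u [_]; exact.
Qed.

End Poset.

(** * Enlarging the set of good points *)

Section Improve.
Variables (R : realType) (k : scalar_kind) (K : uniformType).
Hypothesis Kcompact : compact [set: K].
Local Notation F := (scalars R k).
Variable f : nat -> K -> F.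
Hypothesis fcont : forall n, continuous (f n).
Hypothesis fnorm : forall n, supnorm (f n) = 1.
Hypothesis ftail : forall t (e : R), 0 < e -> exists n, forall m M, (n <= m)%N ->
  \sum_(m <= j < M) modulus (f j t) <= e.
Variables (W : omega1) (assoc : W -> nat -> W).
Hypothesis Hassoc : associated_sequences assoc.
Variable N0 : set nat.
Hypothesis N0_infinite : infinite_set N0.
Hypothesis N0_coef : forall u : nat -> F, fin u -> supp u `<=` N0 ->
  forall j, modulus (u j) <= 4 * nrm f u.
Hypothesis N0_segm : forall u : nat -> F, fin u -> supp u `<=` N0 ->
  forall a b, nrm f (segm a b u) <= 4 * nrm f u.
Hypothesis N0_weight : forall M, \sum_(n < M) weight R N0 n <= 2.

Variable q : level R k W.
Hypothesis qq : average_blocks f assoc N0 q.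
Hypothesis noc0 : forall h : nat -> nat, (forall i, (h i < h i.+1)%N) ->
  ~ exists C : R, forall n t, \sum_(i < n) modulus (lincomb f (q.2 (h i)) t) <= C.
Local Notation from := (from f assoc N0 q).
Local Notation bounded := (abs_bounded f q).

Let qu := average_blocks_unit fnorm N0_coef qq.

(** Coefficients at most e = 1/(n+1) may require an order depending on n. A common order is reached
    by building once more, from a block sequence [v] of such averages. The second construction has
    coefficients at most 4, and the remainders of both are small beyond [p0], whence 4 * (e * C + 4
    * e) + 4 * e. *)
Lemma vanishing_averages : exists b, forall n p, exists u,
  [/\ from b u, beyond p u & forall t (C : R),
    (forall M, \sum_(j < M) modulus (lincomb f (q.2 j) t) <= C) ->
    modulus (lincomb f u t) <= (4 * C + 20) / n.+1%:R].
Proof.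
have small n : exists b, leo q.1 b /\ forall m, exists v s lam rho,
    [/\ from b v, rep f q.2 v s lam rho, beyond m v & forall i, lam i <= n.+1%:R^-1].
  have d0 : 0 < n.+1%:R^-1 :> R by rewrite invr_gt0.
  have [b qb H] := small_coefficients fnorm ftail Hassoc N0_infinite N0_coef N0_segm
    N0_weight qq.1 qq.2 d0 noc0.
  by exists b.
have [bb bbP] := boolp.choice small.
have [b bP] := countable_bound bb; exists b => n p.
set e : R := n.+1%:R^-1.
have e0 : 0 < e by rewrite invr_gt0.
have [p0 p0P] := bounded_tail (@weight_ge0 R N0) N0_weight e0.
pose p' := maxn p p0.
have ex m : exists v s, [/\ from (bb n) v, beyond m v, uniq s,
    forall i, i \in s -> supp (q.2 i) `<=` supp v &
    forall t N, bounded_by N v -> modulus (lincomb f v t) <=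
      e * \sum_(i <- s) modulus (lincomb f (q.2 i) t) + 4 * tail_weight N0 N v].
  have [v [s [lam [rho [h1 h2 h3 h4]]]]] := (bbP n).2 m.
  exists v, s; split=> //; first by case: h2.
    by move=> i si; exact: rep_supp h2 si.
  move=> t N vN; apply: (rep_le fnorm N0_segm qu t _ vN h2) => //.
  exact: (from_unit fnorm N0_infinite N0_coef qq h1).
have [nx nxP] := boolp.choice ex.
have ex' m : exists N, bounded_by N (nx m).
  have [s [h1 _ _ _ _]] := nxP m.
  by have [] := from_unit fnorm N0_infinite N0_coef qq h1.
have [bd bdP] := boolp.choice ex'.
pose pos := fix pos i := if i is j.+1 then maxn p' (bd (pos j)) else p'.
have pos_ge i : (p' <= pos i)%N by case: i => //= i; rewrite leq_maxl.
pose v i := nx (pos i).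
have ex2 i : exists s, [/\ from (bb n) (v i), beyond (pos i) (v i), uniq s,
    forall j, j \in s -> supp (q.2 j) `<=` supp (v i) &
    forall t N, bounded_by N (v i) -> modulus (lincomb f (v i) t) <=
      e * \sum_(i <- s) modulus (lincomb f (q.2 i) t) + 4 * tail_weight N0 N (v i)].
  exact: nxP.
have [s sP] := boolp.choice ex2.
pose q1 : level R k W := (bb n, v).
have q1q : average_blocks f assoc N0 q1.
  split=> [i|i] /=.
    have [h _ _ _ _] := sP i; exact: (from_avgN fnorm N0_infinite N0_coef qq h).
  move=> x y /(proj1 (bounded_byP _ _) (bdP (pos i))) h1.
  by have [_ /(_ y) h _ _ _] := sP i.+1 => /h /=; rewrite gtn_max => /andP[_]; exact: ltn_trans.
have q1u := average_blocks_unit fnorm N0_coef q1q.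
have [u ub up] := built_exists fnorm Hassoc N0_infinite N0_coef
  (range_averages q1q) (blocks_beyond fnorm N0_coef q1q) (bP n) p'.
have uu := from_unit fnorm N0_infinite N0_coef q1q ub.
exists u; split.
- by apply: built_trans ub _ => _ [i _ <-]; have [h _ _ _ _] := sP i.
- by apply: beyondW up; rewrite leq_maxl.
move=> t C CP; have C0 : 0 <= C by have := CP 0%N; rewrite big_ord0.
have [S [lam [rho r]]] := from_rep fnorm N0_infinite N0_coef q1q ub.
have fu : fin u by case: uu.
have [N uN] := fu.
have := rep_le fnorm N0_segm q1u t uu uN r (fun i => rep_lam_le fnorm N0_segm q1u i uu r).
have tailp (u' : nat -> F) : beyond p' u' -> tail_weight N0 N u' <= e.
  move=> up'; apply: le_trans (p0P p'.+1 N _); last by rewrite leqW// leq_maxr.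
  have := @disjoint_sum R (weight R N0) (fun j n => (j == 0%N) && (u' n != 0)) 0 1 p'.+1 N
    (@weight_ge0 R N0).
  rewrite big_nat1 => H; apply: H => [j j' i /andP[/eqP-> _] /andP[/eqP-> _]//|j i _].
  by move=> /andP[_ /up'].
have hu := tailp u up.
pose M := (\max_(i <- S) i).+1.
have SM i : i \in S -> (i < M)%N by move=> iS; rewrite ltnS; exact: leq_bigmax_seq.
have [B BP] := blocks_bound q1u M.
have S1 : \sum_(i <- S) modulus (lincomb f (v i) t) <=
    \sum_(0 <= i < M) modulus (lincomb f (v i) t).
  apply: sum_uniq_sub => [i||i /SM]; [exact: modulus_ge0|by case: r|].
  by rewrite mem_index_iota.
have S2 : \sum_(0 <= i < M) modulus (lincomb f (v i) t) <= e * C + 4 * e.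
  apply: (@le_trans _ _ (\sum_(0 <= i < M) (e * \sum_(j <- s i) modulus (lincomb f (q.2 j) t)
      + 4 * tail_weight N0 B (v i)))).
    rewrite big_nat_cond [leRHS]big_nat_cond; apply: ler_sum => i /andP[/andP[_ iM] _].
    by have [_ _ _ _ H] := sP i; apply: H; exact: BP.
  rewrite big_split /= -!mulr_sumr; apply: lerD; apply: ler_wpM2l => //; first exact: ltW.
    apply: disjoint_lists_sum => [i|j|j j' i _ _ h3 h4|N'].
    - exact: modulus_ge0.
    - by have [] := sP j.
    - have [_ [y qy] _ _] := qu i; have [_ _ _ H1 _] := sP j; have [_ _ _ H2 _] := sP j'.
      exact: (blocks_disjoint q1u q1q.2 (H1 _ h3 _ qy) (H2 _ h4 _ qy)).
    - exact: CP.
  apply: le_trans (p0P p'.+1 B _); last by rewrite leqW// leq_maxr.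
  apply: (disjoint_sum (p := fun i n => v i n != 0)).
  - exact: weight_ge0.
  - by move=> j j' i; exact: (blocks_disjoint q1u q1q.2).
  - by move=> j i _ vi; have [_ H _ _ _] := sP j; apply: leq_ltn_trans (H _ vi).
rewrite -/e /= => h; have -> : (4 * C + 20) / n.+1%:R = 4 * (e * C) + 20 * e by rewrite -/e mulrDl -mulrA (mulrC C).
by lra.
Qed.

(** Otherwise there are nested closed neighbourhoods of points of [D] on which partial sums are at
    least n. A cluster point of their centres may lie outside [D], but the series converges there
    too, a contradiction. *)
Lemma baire_bounded (D : set K) : D !=set0 -> exists x V (C : R),
  [/\ D x, nbhs x V & forall t, V t -> D t -> forall n, \sum_(i < n) modulus (f i t) <= C].
Proof.
move=> [x0 Dx0]; apply: contrapT => H.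
have step (n : nat) (xV : K * set K) : exists yZ : K * set K, D xV.1 -> nbhs xV.1 xV.2 ->
    [/\ D yZ.1, nbhs yZ.1 yZ.2, closed yZ.2, yZ.2 `<=` xV.2 &
     exists m, forall t, yZ.2 t -> n%:R <= \sum_(i < m) modulus (f i t)].
  have [[Dx xV1]|no] := pselect (D xV.1 /\ nbhs xV.1 xV.2); last by exists xV => h1 h2; case: no.
  have [t [Vt Dt [m tm]]] : exists t, [/\ (xV.2)° t, D t &
      exists m, n.+1%:R < \sum_(i < m) modulus (f i t)].
    apply: contrapT => no; apply: H; exists xV.1, (xV.2)°, n.+1%:R; split=> //.
      exact: nbhs_interior.
    move=> t Vt Dt m; rewrite leNgt; apply/negP => h; apply: no; exists t; split=> //.
    by exists m.
  have Vt' : nbhs t xV.2 by [].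
  (* By continuity of finitely many terms, passing to nearby points loses at most 1; hence n+1 at
     t. *)
  have near_t : \forall s \near t, n%:R <= \sum_(i < m) modulus (f i s).
    have m0 : 0 < m.+1%:R^-1 :> R by rewrite invr_gt0.
    have : \forall s \near t, forall i : 'I_m, modulus (f i s - f i t) < m.+1%:R^-1.
      by apply: filter_forall => i; apply: continuous_modulus => //; exact: fcont.
    apply: filterS => s sP.
    have : \sum_(i < m) modulus (f i t) <= \sum_(i < m) (modulus (f i s) + m.+1%:R^-1).
      apply: ler_sum => i _; have := sP i; rewrite modulusB => /ltW h.
      by rewrite -{1}(subrK (f i s) (f i t)) addrC; apply: le_trans (modulusD _ _) _;
        rewrite lerD2l.
    rewrite big_split /=.
    have : \sum_(i < m) m.+1%:R^-1 <= 1 :> R.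
      by rewrite sumr_const card_ord -[leLHS]mulr_natr ler_pdivrMl// mulr1 ler_nat.
    by rewrite -natr1 in tm; lra.
  have [Z tZ Zsub] := uniform_regular (filterI Vt' near_t).
  exists (t, closure Z) => _ _; split=> //=.
  - by apply: filterS tZ; exact: subset_closure.
  - exact: closed_closure.
  - by move=> s /Zsub[].
  - by exists m => s /Zsub[].
have ex1 n : exists nx : K * set K -> K * set K, forall xV, D xV.1 -> nbhs xV.1 xV.2 ->
    [/\ D (nx xV).1, nbhs (nx xV).1 (nx xV).2, closed (nx xV).2, (nx xV).2 `<=` xV.2 &
     exists m, forall t, (nx xV).2 t -> n%:R <= \sum_(i < m) modulus (f i t)].
  by have [nx nxP] := boolp.choice (step n); exists nx.
have [nx nxP] := boolp.choice ex1.
pose z := fix z n := if n is m.+1 then nx m (z m) else (x0, setT).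
have zD n : D (z n).1 /\ nbhs (z n).1 (z n).2.
  elim: n => [|n [h1 h2]]; first by split=> //; exact: filterT.
  by have [] := nxP n _ h1 h2.
have zS n := nxP n _ (zD n).1 (zD n).2.
have zdec n m : (n <= m)%N -> (z m).2 `<=` (z n).2.
  elim: m => [|m IH]; first by rewrite leqn0 => /eqP ->.
  rewrite leq_eqVlt => /orP[/eqP->//|/IH h].
  by apply: subset_trans h; have [] := zS m.
have PF : ProperFilter ((fun n => (z n).1) @ \oo) by exact: fmap_proper_filter.
have [y [_ yc]] := Kcompact PF filterT.
have yz n : (z n.+1).2 y.
  have [_ _ cl _ _] := zS n; apply: cl => B yB.
  have : ((fun n => (z n).1) @ \oo) (z n.+1).2.
    exists n.+1 => // m /= nm; apply: (zdec _ _ nm); apply: nbhs_singleton.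
    exact: (zD m).2.
  by move=> /yc/(_ yB)[s [h1 h2]]; exists s.
have [n nP] := ftail y (@ltr01 R).
have ybound m : \sum_(i < m) modulus (f i y) <= n%:R + 1.
  rewrite -(big_mkord xpredT (fun i => modulus (f i y))).
  have first l : (l <= n)%N -> \sum_(0 <= i < l) modulus (f i y) <= n%:R.
    move=> ln; apply: (@le_trans _ _ (\sum_(0 <= i < l) 1)).
      by apply: ler_sum => i _; exact: modulus_f_le1.
    by rewrite sumr_const_nat subn0 ler_nat.
  have [mn|nm] := leqP m n; first by apply: le_trans (first m mn) _; rewrite lerDl.
  rewrite (@big_cat_nat _ _ _ n)//=; last exact: ltnW.
  by apply: lerD; [exact: first|exact: nP].
have [_ _ _ _ [m mP]] := zS n.+2.
have := mP y (yz n.+2); have := ybound m.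
by rewrite -[n.+2%:R]natr1 -[n.+1%:R]natr1; lra.
Qed.

Definition bad_point (x : K) := forall V, nbhs x V -> ~ bounded V.

Lemma locally_bounded (S : set K) :
  (forall x : K, exists2 V, nbhs x V & bounded (V `&` S)) -> bounded S.
Proof.
move=> loc; have /compact_near_coveringP/(_ nat \oo) := Kcompact.
move=> /(_ (fun n t => S t -> forall M,
  \sum_(i < M) modulus (lincomb f (q.2 i) t) <= n%:R) _) H.
have {H} [x _|n _ nP] := H.
  have [V xV [C CP]] := loc x; exists (V, [set n | ((Num.truncn C).+1 <= n)%N]).
    by split=> //; exists (Num.truncn C).+1.
  move=> [t n] /= [Vt Cn] St M; apply: le_trans (CP M t _) _ => //.
  by apply: le_trans (ltW (truncnS_gt C)) _; rewrite ler_nat.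
by exists n%:R => M t St; exact: (nP n (leqnn n) t I St M).
Qed.

Let c (i : nat) : R := 2^-1 ^+ i.
Let c_gt0 i : 0 < c i. Proof. by rewrite exprn_gt0// invr_gt0. Qed.

Lemma sum_half n : \sum_(i < n) c i <= 2.
Proof.
suff -> : \sum_(i < n) c i = 2 - 2 * c n by have := c_gt0 n; lra.
elim: n => [|n IH]; first by rewrite big_ord0 /c expr0; lra.
by rewrite big_ord_recr /= IH /c exprS; lra.
Qed.

Lemma improve : (exists x, bad_point x) -> exists q', [/\ average_blocks f assoc N0 q',
  refines f assoc N0 q q' & exists x V, [/\ bad_point x, nbhs x V & abs_bounded f q' V]].
Proof.
move=> bad0; have [x0 [V0 [C0 [bx0 xV0 C0P]]]] := baire_bounded bad0.
have [Z xZ ZV] := uniform_regular xV0.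
pose X := closure Z.
have XC t : X t -> bad_point t -> forall M,
    \sum_(j < M) modulus (lincomb f (q.2 j) t) <= 4 * C0.
  move=> Xt bt M; have [B BP] := blocks_bound qu M.
  rewrite -(big_mkord xpredT (fun j => modulus (lincomb f (q.2 j) t))).
  apply: le_trans (blocks_sum N0_coef qu qq.2 0 t BP) _; rewrite big_mkord.
  by rewrite ler_wpM2l//; apply: C0P => //; exact: ZV.
have [b bP] := vanishing_averages.
pose good (L : seq (nat -> F)) := forall i, (i < size L)%N ->
  fin (nth (fun=> 0) L i) /\ forall t, X t -> bad_point t ->
    modulus (lincomb f (nth (fun=> 0) L i) t) <= c i.
(* The points of [X] where an earlier term reaches twice its bound. At bad points of [X] that term
   is at most [c i], so continuity keeps [Y L] away from them. The sums of moduli are therefore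
   bounded on [Y L], and the next term can be made small there as well. *)
pose Y (L : seq (nat -> F)) := [set t | X t /\ exists2 i, (i < size L)%N &
  2 * c i <= modulus (lincomb f (nth (fun=> 0) L i) t)].
have step L : exists u, good L -> [/\ from b u,
    exists2 p, forall i, (i < size L)%N -> bounded_by p (nth (fun=> 0) L i) & beyond p u &
    forall t, (X t /\ bad_point t) \/ Y L t -> modulus (lincomb f u t) <= c (size L)].
  have [gL|ng] := pselect (good L); last by exists (fun=> 0).
  have [p pP] : exists p, forall i, (i < size L)%N -> bounded_by p (nth (fun=> 0) L i).
    suff H N : (N <= size L)%N -> exists p, forall i, (i < N)%N ->
        bounded_by p (nth (fun=> 0) L i) by exact: (H (size L)).
    elim: N => [_|N IH NL]; first by exists 0%N.
    have [p pP] := IH (ltnW NL); have [[p' p'P] _] := gL N NL.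
    exists (maxn p p') => i; rewrite ltnS leq_eqVlt => /orP[/eqP->|/pP h].
      by apply: bounded_byW p'P; rewrite leq_maxr.
    by apply: bounded_byW h; rewrite leq_maxl.
  have [C1 C1P] : bounded (Y L).
    apply: locally_bounded => x.
    have [bx|/existsNP[V /not_implyP[xV /contrapT [C CP]]]] := pselect (bad_point x); last first.
      by exists V => //; exists C => n t [Vt _]; exact: CP.
    suff [V xV VY] : exists2 V, nbhs x V & V `&` Y L = set0.
      by exists V => //; exists 0 => n t; rewrite VY.
    have [Xx|nXx] := pselect (X x); last first.
      exists (~` X); first by apply: open_nbhs_nbhs; split=> //; exact/closed_openC/closed_closure.
      by apply/seteqP; split=> // t [nXt [Xt _]].
    exists [set s | forall i : 'I_(size L),
        modulus (lincomb f (nth (fun=> 0) L i) s - lincomb f (nth (fun=> 0) L i) x) < c i].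
      apply: filter_forall => i; apply: continuous_modulus => //.
      by apply: continuous_lincomb => //; exact: (gL i (ltn_ord i)).1.
    apply/seteqP; split=> // t [tP [_ [i iL]]].
    have := tP (Ordinal iL) => /=; have := (gL i iL).2 x Xx bx.
    set a := lincomb f _ x; set d := lincomb f _ t => h1 h2.
    have := modulusD (d - a) a; rewrite subrK; lra.
  pose C := Num.max (4 * C0) C1.
  have [u [h1 h2 h3]] := bP (Num.truncn ((4 * C + 20) / c (size L))) p.
  exists u => _; split=> //; first by exists p.
  move=> t tP; apply: le_trans (h3 t C _) _.
    move=> M; rewrite /C le_max; apply/orP.
    by case: tP => [[Xt bt]|Yt]; [left; exact: XC|right; exact: C1P].
  rewrite ler_pdivrMr// [leRHS]mulrC -ler_pdivrMr//.
  exact/ltW/truncnS_gt.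
have [nx nxP] := boolp.choice step.
pose hl := fix hl n := if n is m.+1 then rcons (hl m) (nx (hl m)) else [::].
pose u n := nx (hl n).
have hlE n : hl n = mkseq u n by elim: n => // n IH; rewrite mkseqS -IH.
have szl n : size (hl n) = n by rewrite hlE size_mkseq.
have nthl n i : (i < n)%N -> nth (fun=> 0) (hl n) i = u i by move=> h; rewrite hlE nth_mkseq.
have gl n : good (hl n).
  elim: n => [|n IH] i; first by rewrite szl.
  rewrite szl => iln; rewrite nthl//; have [h1 _ h3] := nxP _ IH.
  move: iln; rewrite ltnS leq_eqVlt => /orP[/eqP->|ilt].
    split; first by have [] := from_unit fnorm N0_infinite N0_coef qq h1.
    by move=> t Xt bt; have := h3 t; rewrite szl; apply; left.
  by have := IH i; rewrite szl nthl//; apply.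
have uP n := nxP _ (gl n).
pose q' : level R k W := (b, u).
have ufrom n : from b (u n) by have [] := uP n.
have q'q : average_blocks f assoc N0 q'.
  split=> [i|i] /=; first exact: (from_avgN fnorm N0_infinite N0_coef qq (ufrom i)).
  have [_ [p pP up] _] := uP i.+1; move=> x y ux /up.
  have := pP i; rewrite szl nthl// => /(_ (ltnSn i))/bounded_byP/(_ _ ux).
  exact: ltn_trans.
exists q'; split=> //; first by exists 0%N.
exists x0, X; split=> //; first by apply: filterS xZ; exact: subset_closure.
(* At t at most one term exceeds [2 * c i], since the first that reaches this value forces all later
   ones to be small. Hence 2 * 2 from the geometric series, plus 1 for the exceptional unit
   vector. *)
exists 5 => n t Xt.
have later i j : (i < j)%N -> 2 * c i <= modulus (lincomb f (u i) t) ->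
    modulus (lincomb f (u j) t) <= c j.
  move=> ij ui; have [_ _ /(_ t)] := uP j; rewrite szl; apply; right; split=> //.
  by exists i; rewrite ?szl// nthl.
have [l lP] : exists l, forall i, modulus (lincomb f (u i) t) <= 2 * c i + (i == l)%:R.
  have [ex|no] := pselect (exists i, 2 * c i <= modulus (lincomb f (u i) t)); last first.
    exists 0%N => i; apply: (@le_trans _ _ (2 * c i)); last by rewrite lerDl.
    by rewrite leNgt; apply/negP => /ltW h; apply: no; exists i.
  have [l lbig lmin] := ex_minnP ex; exists l => i.
  case: (ltngtP i l) => il; rewrite ?addr0.
  - by rewrite leNgt; apply/negP => /ltW/lmin; rewrite leqNgt il.
  - by have := later _ _ il lbig; have := c_gt0 i; lra.
  - have := modulus_unit_le1 fnorm t (average_blocks_unit fnorm N0_coef q'q i).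
    by have := c_gt0 i; rewrite /= mulr1n; lra.
apply: (@le_trans _ _ (\sum_(i < n) (2 * c i + (val i == l)%:R))).
  by apply: ler_sum => i _; exact: lP.
rewrite big_split /= -mulr_sumr; have := sum_half n.
suff : \sum_(i < n) (val i == l)%:R <= 1 :> R by lra.
have := @disjoint_sum R (fun=> 1) (fun i j => (j == 0%N) && (i == l)) 0 n 0 1.
rewrite big_mkord big_nat1 => H; apply: le_trans (H _ _ _) => //.
- by apply: ler_sum => i _; rewrite big_ord1 mulr1.
- by move=> j j' i /andP[_ /eqP->] /andP[_ /eqP->].
Qed.

End Improve.

(** * Equivalence with the basis of c_0 *)

Lemma countable_base (R : realType) (K : metricType R) (t0 : K) :
  compact [set: K] -> exists V : nat -> set K,
  (forall n, open (V n)) /\ forall x A, nbhs x A -> exists n, V n x /\ V n `<=` A.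
Proof.
move=> Kc.
pose K' : pseudoPMetricType R := HB.pack (K : Type) (isPointed.Build K t0) (PseudoMetric.on K).
have [B Bc [Bo Bb]] := @compact_second_countable R K' Kc.
have /countable_injP[g ginj] := Bc.
(* Since [g] is injective on the base, each union has at most one member; a number that codes no
   base set gives the empty set. *)
exists (fun n => \bigcup_(A in [set A | B A /\ g A = n]) A); split.
  by move=> n; apply: bigcup_open => A [BA _]; exact: (Bo A BA).
move=> x A xA; have [D [BD Dx] DA] := Bb x A xA.
exists (g D); split; first by exists D.
move=> y [D' [BD' E] D'y]; apply: DA; suff <- : D' = D by [].
by apply: ginj => //; rewrite inE.
Qed.

(** The label of [g i] is at least 2^i, so a geometric series dominates. *)
Lemma range_weight (R : realType) (g : nat -> nat) :
  (forall i, (g i < g i.+1)%N) -> (forall i, (2 ^ i <= (g i).+1)%N) ->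
  forall M, \sum_(n < M) weight R (range g) n <= 2.
Proof.
move=> gm g2 M; have gi i : (i <= g i)%N by elim: i => // i IH; exact: leq_ltn_trans IH (gm i).
have c0 i : 0 <= 2^-1 ^+ i :> R by rewrite exprn_ge0// invr_ge0.
apply: le_trans (sum_half R M); rewrite -[leRHS](big_mkord xpredT (fun i => 2^-1 ^+ i)).
apply: le_trans (@disjoint_sum R (fun i => 2^-1 ^+ i) (fun n i => g i == n) 0 M 0 M c0 _ _) => //.
  rewrite big_mkord; apply: ler_sum => n _; rewrite /weight.
  case: asboolP => [[i _ gin]|_]; last by apply: sumr_ge0 => i _; rewrite mulr_ge0.
  have iM : (i < M)%N by apply: leq_ltn_trans (gi i) _; rewrite gin.
  rewrite (bigD1 (Ordinal iM)) //= gin eqxx mul1r.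
  apply: (@le_trans _ _ (2^-1 ^+ i)).
    rewrite exprVn -natrX lef_pV2 ?posrE ?ltr0n ?expn_gt0// ler_nat.
    by rewrite -gin; exact: g2.
  by rewrite lerDl; apply: sumr_ge0 => j _; rewrite mulr_ge0.
by move=> j j' i /eqP <- /eqP <-.
Qed.

Section Equivalence.
Variables (R : realType) (k : scalar_kind) (K : Type).
Local Notation F := (scalars R k).
Variable f : nat -> K -> F.
Hypothesis fnorm : forall n, supnorm (f n) = 1.
Variable N0 : set nat.
Hypothesis N0_coef : forall u : nat -> F, fin u -> supp u `<=` N0 ->
  forall j, modulus (u j) <= 4 * nrm f u.
Hypothesis N0_segm : forall u : nat -> F, fin u -> supp u `<=` N0 ->
  forall a b, nrm f (segm a b u) <= 4 * nrm f u.
Variable u : nat -> nat -> F.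
Hypothesis u_unit : forall i, unit_block f N0 (u i).
Hypothesis u_lt : forall i, block_lt (u i) (u i.+1).

Lemma supp_max (v : nat -> F) : fin v -> supp v !=set0 ->
  exists2 z, supp v z & forall y, supp v y -> (y <= z)%N.
Proof.
move=> [N /bounded_byP vN] [y vy].
have [z vz zmax] := ex_maxnP (ex_intro (fun x => v x != 0) y vy) (fun x vx => ltnW (vN x vx)).
by exists z.
Qed.

Lemma lincomb_unit_vector (c : nat -> F) : fin c -> lincomb (unit_vector R k) c = c.
Proof.
move=> [N cN]; apply/funext => j.
have cN' : bounded_by (maxn N j.+1) c by apply: bounded_byW cN; rewrite leq_maxl.
have jN : (j < maxn N j.+1)%N by rewrite leq_max ltnSn orbT.
rewrite (lincombE _ _ cN') (bigD1 (Ordinal jN))//= /unit_vector eqxx mulr1 big1 ?addr0//.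
by move=> i ij; rewrite (_ : (j == i) = false) ?mulr0//; apply: contraNF ij => /eqP E;
  apply/eqP/val_inj.
Qed.

(** The upper estimate is the bound on sums of moduli, with [C + 1] to have a positive constant. The
    lower one holds because each [c j * u j] is a segment of the combination. *)
Lemma bounded_equivalent_c0 (C : R) :
  (forall n t, \sum_(i < n) modulus (lincomb f (u i) t) <= C) ->
  equivalent_c0_basis (fun n => lincomb f (u n)).
Proof.
move=> CP; have [t0 _] := point_ex fnorm.
have C0 : 0 <= C by have := CP 0%N t0; rewrite big_ord0.
exists 4^-1, (C + 1); split; [by rewrite invr_gt0|by lra|].
move=> c /finP fc; have [N cN] := fc; rewrite (lincomb_unit_vector fc).
pose y n := \sum_(i <- index_iota 0 N) c i * u i n.
have yE : lincomb f y = lincomb (fun n => lincomb f (u n)) c.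
  apply/funext => t; rewrite (lincomb_sumw u_unit) (lincombE _ _ cN).
  by rewrite big_mkord.
have yS n : y n = \sum_(i < N) c i * u i n by rewrite /y big_mkord.
have fy : fin y.
  have [B BP] := blocks_bound u_unit N; exists B => n Bn; rewrite yS big1// => i _.
  by rewrite (BP i)// mulr0.
have yN : supp y `<=` N0.
  move=> n; rewrite /supp/= yS => yn; apply: contrapT => nn; move: yn.
  rewrite big1 ?eqxx// => i _; have [_ _ uN _] := u_unit i.
  suff -> : u i n = 0 by rewrite mulr0.
  by apply/eqP; rewrite -[_ == _]negbK; apply/negP => /uN.
have cb i : modulus (c i) <= \sum_(j < N) modulus (c j).
  have [iN|/cN->] := ltnP i N.
    rewrite (bigD1 (Ordinal iN))//= lerDl; apply: sumr_ge0 => j _; exact: modulus_ge0.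
  by rewrite modulus0; apply: sumr_ge0 => j _; exact: modulus_ge0.
split.
  rewrite -yE -/(nrm f y) mulrC ler_pdivrMr// mulrC.
  apply: supnorm_le; first by exists 0%N.
  move=> j; have [jN|/cN->] := ltnP j N; last first.
    by rewrite modulus0 mulr_ge0// nrm_ge0.
  have [fj uj0 _ nj] := u_unit j.
  have [a [ua amin]] := min_ex uj0; have [z uz zmax] := supp_max fj uj0.
  have E : segm a z.+1 y = fun n => c j * u j n.
    apply/funext => n; rewrite /segm; case: ifP => [/andP[an nz]|/negbT].
      rewrite yS (bigD1 (Ordinal jN))//= big1 ?addr0// => i ij.
      suff -> : u i n = 0 by rewrite mulr0.
      apply/eqP; rewrite -[_ == _]negbK; apply/negP => un.
      have {ij} : val i != j by apply: contraNN ij => /eqP E; apply/eqP/val_inj.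
      rewrite neq_ltn => /orP[ij|ji].
        by have := blocks_lt u_unit u_lt ij un ua; rewrite ltnNge an.
      by have := blocks_lt u_unit u_lt ji uz un; rewrite ltnNge -ltnS nz.
    rewrite negb_and -!leqNgt -ltnNge => h; suff -> : u j n = 0 by rewrite mulr0.
    apply/eqP; rewrite -[_ == _]negbK; apply/negP => un.
    by case/orP: h => h; [have := amin _ un|have := zmax _ un]; lia.
  by have := N0_segm fy yN a z.+1; rewrite E nrmZ// nj mulr1.
apply: supnorm_le; first exact: point_ex fnorm.
move=> t; rewrite (lincombE _ _ cN); apply: le_trans (modulus_sum _ _ _) _.
have S0 : 0 <= supnorm c by apply: le_trans (modulus_ge0 (c 0%N)) (modulus_le_supnorm 0%N cb).
apply: (@le_trans _ _ (\sum_(i < N) supnorm c * modulus (lincomb f (u i) t))).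
  apply: ler_sum => i _; rewrite modulusM ler_wpM2r ?modulus_ge0//.
  exact: (modulus_le_supnorm (nat_of_ord i) cb).
rewrite -mulr_sumr mulrC ler_wpM2r//; apply: le_trans (CP N t) _; lra.
Qed.

End Equivalence.

Theorem corollary6p3 (R : realType) (k : scalar_kind)
    (W : omega1) (assoc : W -> nat -> W) (Hassoc : associated_sequences assoc)
    (K : metricType R) (Kcompact : compact [set: K])
    (f : nat -> K -> scalars R k)
    (fcont : forall n, continuous (f n))
    (fnorm : forall n, supnorm (f n) = 1)
    (fbasic : schauder_basic f)
    (fsum : forall t : K, cvgn (series (fun n => modulus (f n t)))) :
  exists (xi : W) (u : nat -> nat -> scalars R k),
    [/\ block_basis u,
        forall n, is_average f assoc xi (u n)
      & equivalent_c0_basis (fun n => lincomb f (u n))].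
Proof.
have [g [gm g2 gP]] := basic_subsequence Kcompact fcont fnorm fsum.
pose N0 := range g.
have gmono i j : (i < j)%N -> (g i < g j)%N.
  elim: j => // j IH; rewrite ltnS leq_eqVlt => /orP[/eqP->//|/IH h].
  exact: ltn_trans h (gm j).
have N0_coef (u : nat -> scalars R k) : fin u -> supp u `<=` N0 ->
    forall j, modulus (u j) <= 4 * nrm f u by move=> fu uN; case: (gP u fu uN).
have N0_segm (u : nat -> scalars R k) : fin u -> supp u `<=` N0 ->
    forall a b, nrm f (segm a b u) <= 4 * nrm f u.
  move=> fu uN a b; have [H _] := gP u fu uN.
  have [ab|ba] := leqP a b.
    have -> : segm a b u = segm 0 b u \- segm 0 a u.
      apply/funext => n; rewrite /segm /=; case: (leqP a n) => an; first by rewrite subr0.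
      by rewrite (leq_trans an ab) subrr.
    have := nrmB fnorm (fin_segm 0 b u) (fin_segm 0 a u); have := H a; have := H b; lra.
  have -> : segm a b u = segm 0 0 u.
    by apply/funext => n; rewrite /segm ltn0 andbF; case: ifP => //; lia.
  by rewrite segm0_nrm// mulr_ge0// nrm_ge0.
have N0_infinite : infinite_set N0.
  move=> /finite_nat_bound[N NP]; have : (N <= g N)%N.
    by elim: (N) => // i IH; exact: leq_ltn_trans IH (gm i).
  by rewrite leqNgt NP//; exists N.
have N0_weight := range_weight R gm g2.
have ftail := modulus_f_tail fsum.
have [t0 _] := point_ex fnorm.
suff [q [qq [h hm [C CP]]]] : exists q, average_blocks f assoc N0 q /\
    exists2 h : nat -> nat, forall i, (h i < h i.+1)%N &
    exists C : R, forall n t, \sum_(i < n) modulus (lincomb f (q.2 (h i)) t) <= C.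
  have qu := average_blocks_unit fnorm N0_coef qq.
  have hlt i : block_lt (q.2 (h i)) (q.2 (h i.+1)) by exact: (blocks_lt qu qq.2 (hm i)).
  exists q.1, (fun n => q.2 (h n)); split.
  - by split=> // n; have [/finP fn n0 _ _] := qu (h n).
  - by move=> n; exact: (avgN_average (qq.1 (h n))).
  - exact: (bounded_equivalent_c0 fnorm N0_segm (fun i => qu (h i)) hlt CP).
apply: contrapT => noc0.
have {}noc0 q : average_blocks f assoc N0 q -> forall h : nat -> nat,
    (forall i, (h i < h i.+1)%N) ->
    ~ exists C : R, forall n t, \sum_(i < n) modulus (lincomb f (q.2 (h i)) t) <= C.
  by move=> qq h hm hC; apply: noc0; exists q; split=> //; exists h.
have [V [Vo Vb]] := countable_base t0 Kcompact.
have [a0 a0min] : exists a : W, is_zero a.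
  have [|a _ amin] := @wf_min W setT; last by exists a => b; exact: amin.
  apply: contrapT => W0; apply: (@ord_uncountable W).
  by have -> : [set: W] = set0 by apply/seteqP; split=> // x _; apply: W0; exists x.
(* Stage n settles the base set [V n]: if some refinement of the current sequence is bounded on it,
   one such refinement is taken. *)
have step n (q : level R k W) : exists q', average_blocks f assoc N0 q ->
    [/\ average_blocks f assoc N0 q', refines f assoc N0 q q' &
    (exists r, [/\ average_blocks f assoc N0 r, refines f assoc N0 q r & abs_bounded f r (V n)]) ->
    abs_bounded f q' (V n)].
  have [[r [rr qr rV]]|no] := pselect (exists r, [/\ average_blocks f assoc N0 r,
    refines f assoc N0 q r & abs_bounded f r (V n)]); first by exists r.
  by exists q => qq; split=> //; exact: refines_refl.
have ex1 n : exists nx : level R k W -> level R k W, forall q, average_blocks f assoc N0 q ->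
    [/\ average_blocks f assoc N0 (nx q), refines f assoc N0 q (nx q) &
    (exists r, [/\ average_blocks f assoc N0 r, refines f assoc N0 q r & abs_bounded f r (V n)]) ->
    abs_bounded f (nx q) (V n)].
  by have [nx nxP] := boolp.choice (step n); exists nx.
have [nx nxP] := boolp.choice ex1.
pose q0 : level R k W := (a0, fun i => unit_vector R k (g i)).
pose q := fix q n := if n is m.+1 then nx m (q m) else q0.
have qq n : average_blocks f assoc N0 (q n).
  elim: n => [|n IH]; last by have [] := nxP n _ IH.
  split=> [i|i] /=; first by apply: avgN_zero => //; exists i.
  by move=> x y /supp_unit -> /supp_unit ->; exact: gm.
have qr n : refines f assoc N0 (q n) (q n.+1) by have [] := nxP n _ (qq n).
(* [p] is stable: a refinement of [p] bounded on [V n] also refines [q n], so stage n already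
   produced boundedness on [V n], and [p] inherits it. *)
have [p pp qp] := refines_bound fnorm Hassoc N0_infinite N0_coef qq qr.
(* Without bad points, compactness bounds the sums on all of [K], and the sequence [p] itself
   contradicts [noc0]. *)
have [bad|nobad] := pselect (exists x, bad_point f p x); last first.
  have [C CP] : abs_bounded f p setT.
    apply: (locally_bounded Kcompact) => x; apply: contrapT => no; apply: nobad; exists x.
    by move=> A xA [C CP]; apply: no; exists A => //; exists C => n t [At _]; exact: CP.
  by apply: (noc0 p pp id) => //; exists C => n t; exact: CP.
have [r [rr pr [x [A [bx xA rA]]]]] := improve Kcompact fcont fnorm ftail Hassoc N0_infinite
  N0_coef N0_segm N0_weight pp (noc0 p pp) bad.
have [n [Vx VA]] := Vb x A xA.
have rV : abs_bounded f r (V n) by case: rA => C CP; exists C => m t /VA; exact: CP.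
(* The improved sequence [r] is bounded on a base neighbourhood of the bad point x, so by stability
   [p] is bounded there too. *)
apply: (bx (V n)); first exact: open_nbhs_nbhs.
apply: (refines_bounded fnorm N0_infinite N0_coef N0_segm N0_weight (qq n.+1) pp (qp n.+1)).
have [_ _] := nxP n _ (qq n); apply; exists r; split=> //.
exact: (refines_trans fnorm N0_infinite N0_coef pp rr (qp n) pr).
Qed.
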